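(* Let $t=\pm1$, so that $c=c(t)=25$ or $1$, respectively, let $h=h_{r,s}(t)$ be such that $r\ne s$ and $T(c,h)=\langle S_{r,s}(t)\mathbf 1_{c,h}\rangle$, and let $2\le k\le\kappa_{r,s}^\pm$. Let $W(c,h,k)=\mathfrak L_0(U(c,h,k))$ be the $V_{Vir}(c,0)$-module induced from the $A_0(V_{Vir}(c,0))$-module $U(c,h,k)=\mathbb{C}[x]/((x-h)^k)$. Then $W(c,h,k)$ is strongly interlocked and has well-defined graded pseudo-traces. For instance, $$\mathrm{pstr}_{W(c,h,k)}(\mathbf 1_{c,0},\tau)=\sum_{\ell\in\mathbb{Z}_{\ge0}}\mathrm{pstr}(q^{N_\ell})q^{S_\ell-c/24}=q^{(1-c)/24+h}(1-q^{rs})\frac1{(k-1)!}(\log q)^{k-1}\eta(q)^{-1}=\frac1{(k-1)!}(\log q)^{k-1}Z_{L(c,h)}(\mathbf 1_{c,0},\tau),$$ where $S_\ell$, $N_\ell$ are the semisimple and nilpotent parts of $L_0|_{W(c,h,k)(\ell)}$. Furthermore, this graded pseudo-trace satisfies the logarithmic derivative property $$\mathrm{pstr}_{W(c,h,k)}(\omega,\tau)=q^{-c/24}q\frac{d}{dq}\,q^{c/24}\,\mathrm{pstr}_{W(c,h,k)}(\mathbf 1_{c,0},\tau).$$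
   Context: $\mathcal L$ is the Virasoro algebra, basis $L_n$ ($n\in\mathbb{Z}$), $\mathbf c$ central, $[L_m,L_n]=(m-n)L_{m+n}+\frac{m^3-m}{12}\delta_{m+n,0}\mathbf c$; $\mathcal L^-=\mathrm{span}\{L_n:n<0\}$. $M(c,h)$ is the Verma module generated by $\mathbf 1_{c,h}$ ($L_0=h$, $\mathbf c=c$, $L_n\mathbf 1_{c,h}=0$ for $n>0$), $T(c,h)$ its maximal proper submodule, $L(c,h)=M(c,h)/T(c,h)$. $V_{Vir}(c,0)=M(c,0)/\langle L_{-1}\mathbf 1_{c,0}\rangle$ is the universal Virasoro vertex operator algebra with vacuum $\mathbf 1_{c,0}$, conformal vector $\omega=L_{-2}\mathbf 1_{c,0}$; its level zero Zhu algebra is $\mathbb{C}[x]$, $x$ the class of $\omega$. $U(c,h,k)$ has Jordan basis $u_1,\dots,u_k$: $L_0u_1=hu_1$, $L_0u_j=hu_j+u_{j-1}$. $M(c,h,k)$ is the $\mathcal L$-module induced from $U(c,h,k)$ ($L_n=0$ for $n>0$ on $U(c,h,k)$, $L_0=x$, $\mathbf c=c$), $J(c,h,k)$ the submodule of all $v$ with $yv$ having zero degree-zero component for all $y\in\mathcal U(\mathcal L)$, and $\mathfrak L_0(U(c,h,k))=M(c,h,k)/J(c,h,k)$, graded by degree, $W(\ell)=W_{h+\ell}$. $\eta(q)=q^{1/24}\prod_{j\ge1}(1-q^j)$; $Z_{L(c,h)}(\mathbf 1_{c,0},\tau)=q^{-c/24}\sum_\ell\dim L(c,h)(\ell)\,q^{\ell+h}$;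 $q=e^{2\pi i\tau}$, $\log q=2\pi i\tau$. $c(t)=13+6t+6t^{-1}$, $h_{r,s}(t)=\frac{1-r^2}{4}t+\frac{1-rs}{2}+\frac{1-s^2}{4}t^{-1}$ for $r,s\in\mathbb{Z}_{>0}$, $t\in\mathbb{C}^\times$. $S_{r,s}(t)\in\mathcal U(\mathcal L^-)$ is the degree $rs$ element with coefficient of $L_{-1}^{rs}$ equal to $1$ such that $S_{r,s}(t)\mathbf 1_{c,h}$ is singular in $M(c(t),h_{r,s}(t))$. $\kappa^\pm_{r,s}$ (for $t=\pm1$): let $d=rs$, $\mathcal R_d$ the degree $d$ part of $\mathcal U(\mathcal L^-)$ with PBW basis $\mathcal B_d=\{B_i\}$, $\mathcal A_d(c,h)=(\langle B_i\mathbf 1_{c,h},B_j\mathbf 1_{c,h}\rangle)$ the Gram matrix of the Shapovalov form (contravariant for $L_n^\dagger=L_{-n}$, $\langle\mathbf 1_{c,h},\mathbf 1_{c,h}\rangle=1$), $\mathcal A_d(x,y)$ the same with $c,h$ replaced by formal variables. $\kappa^\pm_{r,s}\in\{2,3,\dots\}\cup\{\infty\}$ is the largest $n$ ($\infty$ if all $n$) for which there exist $R_d^1,\dots,R_d^n\in\mathcal R_d$, $R_d^n\ne0$, with $\sum_{j=i}^n\frac1{(j-i)!}(\frac{\partial}{\partial y})^{j-i}\mathcal A_d(x,y)[R_d^j]_{\mathcal B_d}|_{(x,y)=(c,h)}=0$ for all $i=1,\dots,n$. Strongly interlocked: an indecomposable generalized module $W$ is interlocked if for every submodule $W'$ there is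 a submodule $W''$ with $W'\cong W/W''$, $W''\cong W/W'$; it is strongly interlocked if moreover it is irreducible, or it has only finitely many nontrivial proper submodules $W^{(1)},\dots,W^{(k-1)}$, each indecomposable, with $0=W^{(0)}\subset W^{(1)}\subset\cdots\subset W^{(k)}=W$ and $W^{(j+1)}/W^{(j)}\cong W^{(1)}$. A weight-preserving module operator is a linear operator preserving all weight spaces $W_\mu$ and lying in the algebra generated by the modes $v_n$ ($v\in V_{Vir}(c,0)$) and the module endomorphisms. A strongly interlocked family of bases is a choice of ordered basis of every $W_\mu$ in which every such operator $\sigma$ has a $k\times k$ block upper triangular matrix with blocks of size $\dim Soc(W)_\mu$, diagonal blocks $A=\sigma|_{Soc(W)_\mu}$, first block row $(A,C_1,\dots,C_{k-2},B)$ and last block column $(B,C_{k-2},\dots,C_1,A)^T$. Graded pseudo-traces are well defined if $\mathrm{tr}(B)$ is independent of the choice of such a family; then $\mathrm{pstr}(\sigma|_{W_\mu})=\mathrm{tr}(B)$ and $\mathrm{pstr}_W(v,\tau)=\sum_\mu\sum_{j\ge0}\mathrm{pstr}(o(v)|_{W_\mu}\frac1{j!}(L_0^N)_\mu^j)(\log q)^jq^{\mu-c/24}$ with $o(v)=v_{\mathrm{wt}\,v-1}$ and $L_0^N$ the nilpotent part of $L_0$. It is computed in bases of the form $\{b_1u_1,\dots,b_pu_1,b_1u_2,\dots,b_pu_k\}$ (modulo $J$) of $W(\ell)$ with $u_1,\dots,u_k$ the Jordan basis of $U(c,h,k)$ satisfying $L_0u_1=hu_1$ and $L_0u_j=hu_j+u_{j-1}$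 for $2\le j\le k$, so that $N_\ell$ has ones on the $p$th superdiagonal ($p=\dim Soc(W)(\ell)$) and zeros elsewhere.
   Formalization: Pseudo-traces are well defined only over strongly interlocked families of bases normalized so that the nilpotent part of L_0 has ones on the p-th superdiagonal and zeros elsewhere; over all such families tr(B) is not invariant (scaling block j by a^j multiplies it by a^(k-1)). *)

(* Defs.v *)
From HB Require Import structures.
From mathcomp Require Import all_boot all_order all_algebra.
From mathcomp Require Import generic_quotient complex.
From mathcomp Require Import all_classical all_reals all_analysis.
From mathcomp.analysis.showcase Require Import summability.

Set Implicit Arguments.
Unset Strict Implicit.
Unset Printing Implicit Defensive.

Import Order.TTheory GRing.Theory Num.Theory.
Import numFieldNormedType.Exports.

Local Open Scope classical_set_scope.
Local Open Scope quotient_scope.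
Local Open Scope ring_scope.

(* A Virasoro module of central charge c is an [opmod K int] (operators L_n);
  a module for a vertex algebra V is an [opmod K (V * int)] (modes v_n).
  Submodules, quotients, isomorphisms, socles, etc. are then defined once. *)

Record opmod (R : pzRingType) (I : Type) := OpMod {
  opcar :> lmodType R;
  op : I -> {linear opcar -> opcar} }.
Arguments op {R I M} i : rename.

Section OpModules.
Variables (R : pzRingType) (I : Type).
Implicit Types M N : opmod R I.

Definition is_submod M (P : set M) : Prop :=
  [/\ P 0, (forall a u v, P u -> P v -> P (a *: u + v))
    & (forall i u, P u -> P (op i u))].

Record submod M := Submod { sset :> set M; submodP : is_submod sset }.

(* the submodule <G> generated by G *)
Definition gen M (G : set M) : set M :=
  [set v | forall P : submod M, G `<=` P -> sset P v].

Lemma gen_is_submod M (G : set M) : is_submod (gen G).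
Proof.
split=> [P _|a u v Gu Gv P GP|i u Gu P GP]; case: (submodP P) => P0 Pl Po //.
- by apply: Pl; [exact: Gu|exact: Gv].
- by apply: Po; exact: Gu.
Qed.

Definition is_hom M N (f : M -> N) : Prop :=
  (forall a u v, f (a *: u + v) = a *: f u + f v) /\
  (forall i u, f (op i u) = op i (f u)).

Definition isomorphic M N : Prop :=
  exists f : M -> N, is_hom f /\ bijective f.

Section Sub.
Variables (M : opmod R I) (P : submod M).

Definition sub_pred : {pred M} := fun x => `[< sset P x >].

Fact sub_pred_closed : submod_closed sub_pred.
Proof.
have [P0 Pl _] := submodP P; split; first exact/asboolP.
by move=> a u v /asboolP Pu /asboolP Pv; apply/asboolP; exact: Pl.
Qed.
HB.instance Definition _ := GRing.isSubmodClosed.Build R M sub_pred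
  (GRing.submod_closed_semi sub_pred_closed).

Record sub_car := SubCar { sub_val : M; _ : sub_val \in sub_pred }.
HB.instance Definition _ := [isSub for sub_val].
HB.instance Definition _ := [Choice of sub_car by <:].
HB.instance Definition _ := [SubChoice_isSubLmodule of sub_car by <:].

Fact sub_op_subproof i (x : sub_car) : op i (val x) \in sub_pred.
Proof.
have [_ _ Po] := submodP P.
by apply/asboolP/Po; apply/asboolP; exact: (valP x).
Qed.
Definition sub_op i (x : sub_car) : sub_car := SubCar (sub_op_subproof i x).
Fact sub_op_linear i : linear (sub_op i).
Proof. by move=> a u v; apply: val_inj => /=; rewrite !linearP. Qed.
HB.instance Definition _ i :=
  GRing.isLinear.Build R sub_car sub_car _ (sub_op i) (sub_op_linear i).

Definition subm : opmod R I :=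
  @OpMod R I sub_car (fun i => GRing.Linear.clone _ _ _ _ (sub_op i) _).
End Sub.

Section Quo.
Variables (M : opmod R I) (G : set M).

Definition quo_rel (u v : M) : bool := `[< gen G (u - v) >].

Fact quo_rel_equiv : equiv_class_of quo_rel.
Proof.
have [g0 gl _] := gen_is_submod G.
have gN w : gen G w -> gen G (- w).
  by move=> gw; rewrite -[- w]addr0 -scaleN1r; exact: gl.
split=> [u|u v|v u w].
- by apply/asboolP; rewrite subrr.
- by apply/asboolP/asboolP=> /gN; rewrite opprB.
- move=> /asboolP uv /asboolP vw; apply/asboolP.
  by have := gl 1 _ _ uv vw; rewrite scale1r addrA subrK.
Qed.
Canonical quo_equiv := EquivRelPack quo_rel_equiv.

Definition quo_car := {eq_quot quo_rel}.
HB.instance Definition _ := Choice.on quo_car.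
HB.instance Definition _ := EqQuotient.on quo_car.

Definition quo_pi (u : M) : quo_car := \pi_quo_car u.

Fact quo_piP u v : quo_pi u = quo_pi v <-> gen G (u - v).
Proof.
split; first by move/eqmodP/asboolP.
by move=> guv; apply/eqmodP/asboolP.
Qed.

Fact quo_piK (x : quo_car) : quo_pi (repr x) = x.
Proof. exact: reprK. Qed.

Definition quo_add (x y : quo_car) := quo_pi (repr x + repr y).
Definition quo_opp (x : quo_car) := quo_pi (- repr x).
Definition quo_scale (a : R) (x : quo_car) := quo_pi (a *: repr x).
Definition quo_op i (x : quo_car) := quo_pi (op i (repr x)).

Fact gen_repr u : gen G (repr (quo_pi u) - u).
Proof. by apply/quo_piP; rewrite quo_piK. Qed.

Fact gen_lin a u v : gen G u -> gen G v -> gen G (a *: u + v).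
Proof. by case: (gen_is_submod G) => _ + _; apply. Qed.
Fact gen_add u v : gen G u -> gen G v -> gen G (u + v).
Proof. by move=> gu gv; have := gen_lin 1 gu gv; rewrite scale1r. Qed.
Fact gen_sc a u : gen G u -> gen G (a *: u).
Proof.
move=> gu; rewrite -[_ *: _]addr0; apply: gen_lin => //.
by case: (gen_is_submod G).
Qed.

Fact quo_addE u v : quo_add (quo_pi u) (quo_pi v) = quo_pi (u + v).
Proof.
apply/quo_piP; rewrite opprD addrACA; apply: gen_add; exact: gen_repr.
Qed.
Fact quo_scaleE a u : quo_scale a (quo_pi u) = quo_pi (a *: u).
Proof. by apply/quo_piP; rewrite -scalerBr; apply: gen_sc; exact: gen_repr. Qed.
Fact quo_oppE u : quo_opp (quo_pi u) = quo_pi (- u).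
Proof.
apply/quo_piP; rewrite -opprD -[- (_ - _)]scaleN1r; apply: gen_sc; exact: gen_repr.
Qed.
Fact quo_opE i u : quo_op i (quo_pi u) = quo_pi (op i u).
Proof.
apply/quo_piP; rewrite -linearB; case: (gen_is_submod G) => _ _; apply.
exact: gen_repr.
Qed.

Fact quo_addA : associative quo_add.
Proof.
move=> x y z; rewrite -[x]quo_piK -[y]quo_piK -[z]quo_piK.
by rewrite !quo_addE addrA.
Qed.
Fact quo_addC : commutative quo_add.
Proof. by move=> x y; rewrite /quo_add addrC. Qed.
Fact quo_add0 : left_id (quo_pi 0) quo_add.
Proof. by move=> x; rewrite -[x]quo_piK quo_addE add0r. Qed.
Fact quo_addN : left_inverse (quo_pi 0) quo_opp quo_add.
Proof. by move=> x; rewrite -[x]quo_piK quo_oppE quo_addE addNr. Qed.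
HB.instance Definition _ :=
  GRing.isZmodule.Build quo_car quo_addA quo_addC quo_add0 quo_addN.

Fact quo_piD u v : quo_pi u + quo_pi v = quo_pi (u + v).
Proof. exact: quo_addE. Qed.

Fact quo_scaleA a b x : quo_scale a (quo_scale b x) = quo_scale (a * b) x.
Proof. by rewrite -[x]quo_piK !quo_scaleE scalerA. Qed.
Fact quo_scale1 : left_id 1 quo_scale.
Proof. by move=> x; rewrite -[x]quo_piK quo_scaleE scale1r. Qed.
Fact quo_scaleDr : right_distributive quo_scale +%R.
Proof.
move=> a x y; rewrite -[x]quo_piK -[y]quo_piK.
by rewrite quo_piD !quo_scaleE quo_piD scalerDr.
Qed.
Fact quo_scaleDl x : {morph quo_scale^~ x : a b / a + b}.
Proof.
move=> a b; rewrite -[x]quo_piK.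
by rewrite !quo_scaleE quo_piD scalerDl.
Qed.
HB.instance Definition _ := GRing.Zmodule_isLmodule.Build R quo_car
  quo_scaleA quo_scale1 quo_scaleDr quo_scaleDl.

Fact quo_piZ a u : a *: quo_pi u = quo_pi (a *: u).
Proof. exact: quo_scaleE. Qed.

Fact quo_op_linear i : linear (quo_op i).
Proof.
move=> a x y; rewrite -[x]quo_piK -[y]quo_piK.
by rewrite quo_piZ quo_piD !quo_opE quo_piZ quo_piD linearP.
Qed.
HB.instance Definition _ i :=
  GRing.isLinear.Build R quo_car quo_car _ (quo_op i) (quo_op_linear i).

Definition quo : opmod R I :=
  @OpMod R I quo_car (fun i => GRing.Linear.clone _ _ _ _ (quo_op i) _).

Definition proj (u : M) : quo := quo_pi u.
End Quo.

Definition irreducible M : Prop :=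
  (exists v : M, v <> 0) /\
  forall P : submod M, P = [set 0] :> set M \/ P = setT :> set M.

Definition indecomposable M : Prop :=
  (exists v : M, v <> 0) /\
  forall A B : submod M, A `&` B = [set 0] ->
    (forall v, exists a b, [/\ sset A a, sset B b & v = a + b]) ->
    A = [set 0] :> set M \/ B = [set 0] :> set M.

(* The sum of all proper submodules, i.e. the maximal proper submodule when
   there is one, as for the Verma modules below. *)
Definition maxsub M : set M :=
  gen [set v | exists P : submod M, P <> setT :> set M /\ sset P v].

Definition socle M : set M :=
  gen [set v | exists P : submod M, irreducible (subm P) /\ sset P v].

Definition interlocked M : Prop :=
  indecomposable M /\
  forall P : submod M, exists Q : submod M,
    isomorphic (subm P) (quo Q) /\ isomorphic (subm Q) (quo P).

(* Linear operators in the algebra generated by the operators [op i] and the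
   module endomorphisms. *)
Inductive op_alg M : (M -> M) -> Prop :=
| op_alg_op i : op_alg (op i)
| op_alg_end (f : M -> M) : is_hom f -> op_alg f
| op_alg_add f g : op_alg f -> op_alg g -> op_alg (fun x => f x + g x)
| op_alg_scale a f : op_alg f -> op_alg (fun x => a *: f x)
| op_alg_comp f g : op_alg f -> op_alg g -> op_alg (fun x => f (g x)).

End OpModules.

Arguments quo_pi {R I M G} u.
Arguments proj {R I M} G u.
Arguments gen {R I M} G _.
Arguments maxsub {R I} M _.
Arguments socle {R I} M _.

Section LinAlg.
Variables (K : pzRingType) (V : lmodType K).

Definition span (G : set V) : set V :=
  [set v | exists s : seq (K * V),
     (forall x, x \in s -> G x.2) /\ v = \sum_(x <- s) x.1 *: x.2].

Definition is_basis (J : finType) (P : set V) (e : J -> V) : Prop :=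
  [/\ (forall j, P (e j)),
      (forall a : J -> K, \sum_j a j *: e j = 0 -> forall j, a j = 0)
    & (forall v, P v -> exists a : J -> K, v = \sum_j a j *: e j)].

Definition findim (P : set V) : Prop :=
  exists n, exists e : 'I_n -> V, is_basis P e.

(* equal to 0 when P is not finite-dimensional *)
Definition wdim (P : set V) : nat :=
  xget 0%N [set n | exists e : 'I_n -> V, is_basis P e].

Definition gwt (f : V -> V) (mu : K) : set V :=
  [set w | exists n, iter n (fun u => f u - mu *: u) w = 0].

(* S and N are the semisimple and nilpotent parts of f on the subspace P *)
Record jordan_parts (P : set V) (f S N : V -> V) : Prop := {
  jordan_sum : forall w, P w -> f w = S w + N w;
  jordan_stab : forall w, P w -> P (S w) /\ P (N w);
  jordan_comm : forall w, P w -> S (N w) = N (S w);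
  jordan_semisimple :
    forall w, P w -> span [set u | P u /\ exists a, S u = a *: u] w;
  jordan_nilpotent : exists n, forall w, P w -> iter n N w = 0 }.

End LinAlg.

Section Induced.
Variables (R : comUnitRingType) (c : R) (k : nat) (X : 'M[R]_k).

(* M(c, U) for the A_0-module U = <u_1, ..., u_k> on which x acts by the
   matrix X: it is presented by generators u_j and operators L_n subject to
   the Virasoro relations at central charge c, L_n u_j = 0 for n > 0 and
   L_0 u_j = sum_i X_ij u_i, i.e. it is the quotient of the algebra of formal
   expressions [ind_term] by the congruence [ind_eq] these relations
   generate. *)
Inductive ind_term : Type :=
| ITgen of 'I_k
| ITzero
| ITadd of ind_term & ind_term
| ITscale of R & ind_term
| ITL of int & ind_term.

Inductive ind_eq : ind_term -> ind_term -> Prop :=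
| IE_refl x : ind_eq x x
| IE_sym x y : ind_eq x y -> ind_eq y x
| IE_trans y x z : ind_eq x y -> ind_eq y z -> ind_eq x z
| IE_cadd x x' y y' :
    ind_eq x x' -> ind_eq y y' -> ind_eq (ITadd x y) (ITadd x' y')
| IE_cscale a x x' : ind_eq x x' -> ind_eq (ITscale a x) (ITscale a x')
| IE_cL n x x' : ind_eq x x' -> ind_eq (ITL n x) (ITL n x')
| IE_addA x y z : ind_eq (ITadd x (ITadd y z)) (ITadd (ITadd x y) z)
| IE_addC x y : ind_eq (ITadd x y) (ITadd y x)
| IE_add0 x : ind_eq (ITadd ITzero x) x
| IE_addN x : ind_eq (ITadd (ITscale (-1) x) x) ITzero
| IE_scaleA a b x : ind_eq (ITscale a (ITscale b x)) (ITscale (a * b) x)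
| IE_scale1 x : ind_eq (ITscale 1 x) x
| IE_scaleDr a x y :
    ind_eq (ITscale a (ITadd x y)) (ITadd (ITscale a x) (ITscale a y))
| IE_scaleDl a b x :
    ind_eq (ITscale (a + b) x) (ITadd (ITscale a x) (ITscale b x))
| IE_Ladd n x y : ind_eq (ITL n (ITadd x y)) (ITadd (ITL n x) (ITL n y))
| IE_Lscale n a x : ind_eq (ITL n (ITscale a x)) (ITscale a (ITL n x))
| IE_vir m n x :
    ind_eq (ITL m (ITL n x))
      (ITadd (ITL n (ITL m x))
         (ITadd (ITscale (m - n)%:~R (ITL (m + n) x))
            (ITscale
               (if m + n == 0 then (m ^+ 3 - m)%:~R / 12%:R * c else 0) x)))
| IE_pos n j : (0 < n)%R -> ind_eq (ITL n (ITgen j)) ITzero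
| IE_zero j :
    ind_eq (ITL 0 (ITgen j))
      (\big[ITadd/ITzero]_(i < k) ITscale (X i j) (ITgen i)).

HB.instance Definition _ := gen_eqMixin ind_term.
HB.instance Definition _ := gen_choiceMixin ind_term.

Definition ind_rel (x y : ind_term) : bool := `[< ind_eq x y >].

Fact ind_rel_equiv : equiv_class_of ind_rel.
Proof.
split=> [x|x y|y x z]; first by apply/asboolP; exact: IE_refl.
- by apply/asboolP/asboolP; exact: IE_sym.
- by move=> /asboolP xy /asboolP yz; apply/asboolP; exact: IE_trans yz.
Qed.
Canonical ind_equiv := EquivRelPack ind_rel_equiv.

Definition ind_car := {eq_quot ind_rel}.
HB.instance Definition _ := Choice.on ind_car.
HB.instance Definition _ := EqQuotient.on ind_car.

Definition ind_pi (x : ind_term) : ind_car := \pi_ind_car x.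

Fact ind_piP x y : ind_pi x = ind_pi y <-> ind_eq x y.
Proof.
split; first by move/eqmodP/asboolP.
by move=> xy; apply/eqmodP/asboolP.
Qed.
Fact ind_piK (u : ind_car) : ind_pi (repr u) = u.
Proof. exact: reprK. Qed.
Fact ind_repr x : ind_eq (repr (ind_pi x)) x.
Proof. by apply/ind_piP; rewrite ind_piK. Qed.

Definition ind_add (u v : ind_car) := ind_pi (ITadd (repr u) (repr v)).
Definition ind_scale a (u : ind_car) := ind_pi (ITscale a (repr u)).
Definition ind_opp (u : ind_car) := ind_scale (-1) u.
Definition ind_L n (u : ind_car) := ind_pi (ITL n (repr u)).

Fact ind_addE x y : ind_add (ind_pi x) (ind_pi y) = ind_pi (ITadd x y).
Proof. by apply/ind_piP; apply: IE_cadd; exact: ind_repr. Qed.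
Fact ind_scaleE a x : ind_scale a (ind_pi x) = ind_pi (ITscale a x).
Proof. by apply/ind_piP; apply: IE_cscale; exact: ind_repr. Qed.
Fact ind_LE n x : ind_L n (ind_pi x) = ind_pi (ITL n x).
Proof. by apply/ind_piP; apply: IE_cL; exact: ind_repr. Qed.

Fact ind_addA : associative ind_add.
Proof.
move=> u v w; rewrite -[u]ind_piK -[v]ind_piK -[w]ind_piK !ind_addE.
by apply/ind_piP; exact: IE_addA.
Qed.
Fact ind_addC : commutative ind_add.
Proof.
move=> u v; rewrite -[u]ind_piK -[v]ind_piK !ind_addE.
by apply/ind_piP; exact: IE_addC.
Qed.
Fact ind_add0 : left_id (ind_pi ITzero) ind_add.
Proof.
by move=> u; rewrite -[u]ind_piK ind_addE; apply/ind_piP; exact: IE_add0.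
Qed.
Fact ind_addN : left_inverse (ind_pi ITzero) ind_opp ind_add.
Proof.
move=> u; rewrite -[u]ind_piK /ind_opp ind_scaleE ind_addE.
by apply/ind_piP; exact: IE_addN.
Qed.
HB.instance Definition _ :=
  GRing.isZmodule.Build ind_car ind_addA ind_addC ind_add0 ind_addN.

Fact ind_piD x y : ind_pi x + ind_pi y = ind_pi (ITadd x y).
Proof. exact: ind_addE. Qed.

Fact ind_scaleA a b u : ind_scale a (ind_scale b u) = ind_scale (a * b) u.
Proof.
by rewrite -[u]ind_piK !ind_scaleE; apply/ind_piP; exact: IE_scaleA.
Qed.
Fact ind_scale1 : left_id 1 ind_scale.
Proof.
by move=> u; rewrite -[u]ind_piK ind_scaleE; apply/ind_piP; exact: IE_scale1.
Qed.
Fact ind_scaleDr : right_distributive ind_scale +%R.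
Proof.
move=> a u v; rewrite -[u]ind_piK -[v]ind_piK ind_piD.
by rewrite !ind_scaleE ind_piD; apply/ind_piP; exact: IE_scaleDr.
Qed.
Fact ind_scaleDl u : {morph ind_scale^~ u : a b / a + b}.
Proof.
move=> a b; rewrite -[u]ind_piK !ind_scaleE ind_piD.
by apply/ind_piP; exact: IE_scaleDl.
Qed.
HB.instance Definition _ := GRing.Zmodule_isLmodule.Build R ind_car
  ind_scaleA ind_scale1 ind_scaleDr ind_scaleDl.

Fact ind_piZ a x : a *: ind_pi x = ind_pi (ITscale a x).
Proof. exact: ind_scaleE. Qed.

Fact ind_L_linear n : linear (ind_L n).
Proof.
move=> a u v; rewrite -[u]ind_piK -[v]ind_piK.
rewrite ind_piZ ind_piD !ind_LE ind_piZ ind_piD.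
apply/ind_piP; apply: IE_trans (IE_Ladd _ _ _) _.
by apply: IE_cadd; [exact: IE_Lscale|exact: IE_refl].
Qed.
HB.instance Definition _ n :=
  GRing.isLinear.Build R ind_car ind_car _ (ind_L n) (ind_L_linear n).

Definition ind_mod : opmod R int :=
  @OpMod R int ind_car (fun n => GRing.Linear.clone _ _ _ _ (ind_L n) _).

Definition ind_gen (j : 'I_k) : ind_mod := ind_pi (ITgen j).

End Induced.

Section VirModules.
Variables (R : comUnitRingType).
Implicit Types M : opmod R int.

(* L_{n_1} ... L_{n_m} v *)
Definition wact M (w : seq int) (v : M) : M := foldr (fun n u => op n u) v w.

(* Elements of U(L) at fixed central charge, written as finite linear
   combinations of words in the L_n, and their action. *)
Definition uact M (y : seq (R * seq int)) (v : M) : M :=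
  \sum_(x <- y) x.1 *: wact x.2 v.

(* The subspace of degree l, when the vectors in E have degree 0. *)
Definition degree M (E : set M) (l : int) : set M :=
  span [set v | exists w e, [/\ \sum_(n <- w) n = - l, E e & v = wact w e]].

(* The set J: every y v (y in U(L)) has zero component of degree 0. *)
Definition Jset M (E : set M) : set M :=
  [set v | forall y, span [set u | exists2 l, l != 0 & degree E l u]
                          (uact y v)].

Definition Verma (c h : R) : opmod R int := ind_mod c (h%:M : 'M[R]_1).
Definition hwv (c h : R) : Verma c h := ind_gen c (h%:M : 'M[R]_1) ord0.

(* L(c, h) = M(c, h) / T(c, h) *)
Definition Lirr (c h : R) : opmod R int := quo (maxsub (Verma c h)).
Definition Lirr_deg (c h : R) (l : nat) : set (Lirr c h) :=
  degree [set proj (maxsub (Verma c h)) (hwv c h)] l.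

(* x u_1 = h u_1 and x u_j = h u_j + u_{j-1} *)
Definition jordan_mx (h : R) (k : nat) : 'M[R]_k :=
  \matrix_(i, j) (if i == j then h else if i.+1 == j :> nat then 1 else 0).

(* M(c, h, k) and W(c, h, k) = M(c, h, k) / J(c, h, k) *)
Definition Mind (c h : R) (k : nat) : opmod R int := ind_mod c (jordan_mx h k).
Definition Mtop (c h : R) (k : nat) : set (Mind c h k) :=
  range (ind_gen c (jordan_mx h k)).
Arguments Mtop : clear implicits.
Definition Wmod (c h : R) (k : nat) : opmod R int := quo (Jset (Mtop c h k)).
Definition Wdeg (c h : R) (k l : nat) : set (Wmod c h k) :=
  degree (proj (Jset (Mtop c h k)) @` Mtop c h k) l.

(* V_Vir(c, 0) = M(c, 0) / <L_{-1} 1>, as a Virasoro module *)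
Definition VirV (c : R) : opmod R int :=
  quo [set op (-1) (hwv c 0)].
Definition vac (c : R) : VirV c := proj _ (hwv c 0).
Definition omega (c : R) : VirV c := op (-2) (vac c).

End VirModules.
Arguments Wdeg {R} c h k l _.
Arguments Lirr_deg {R} c h l _.

(* The PBW basis B_d of U(L^-)_d is indexed by the partitions of d: m i is the
   multiplicity of the part i + 1, and the basis element is
   L_{-1}^{m 0} L_{-2}^{m 1} ... *)
Definition pbw (d : nat) : finType :=
  {m : {ffun 'I_d -> 'I_d.+1} | (\sum_(i < d) i.+1 * m i)%N == d}.

Definition pbw_word d (b : pbw d) : seq int :=
  flatten [seq nseq (val b i) (- i.+1%:Z) | i : 'I_d].

(* An element of U(L^-)_d, given by its PBW coordinates. *)
Definition pbw_elt (R : comUnitRingType) d (S : {ffun pbw d -> R}) :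
    seq (R * seq int) :=
  [seq (S b, pbw_word b) | b : pbw d].

Section Kappa.
Variable K : fieldType.

Definition cc (t : K) : K := 13 + 6 * t + 6 * t^-1.
Definition hh (r s : nat) (t : K) : K :=
  (1 - r%:R ^+ 2) / 4 * t + (1 - r%:R * s%:R) / 2 + (1 - s%:R ^+ 2) / 4 * t^-1.

(* S, of degree rs, is S_{r,s}(t). *)
Definition is_Srs (r s : nat) (t : K) (S : {ffun pbw (r * s) -> K}) : Prop :=
  (forall b, pbw_word b = nseq (r * s) (-1) -> S b = 1) /\
  (forall n : int, 0 < n ->
     op n (uact (pbw_elt S) (hwv (cc t) (hh r s t))) = 0).

(* K[x][y]: x = 'X%:P stands for c and y = 'X for h. *)
Notation Kxy := {poly {poly K}}.
Definition genVerma : opmod Kxy int := Verma ('X%:P : Kxy) 'X.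
Definition genhwv : genVerma := hwv ('X%:P : Kxy) 'X.

Record shapovalov (F : genVerma -> genVerma -> Kxy) : Prop := {
  shap_linl : forall a u v w, F (a *: u + v) w = a * F u w + F v w;
  shap_linr : forall a u v w, F w (a *: u + v) = a * F w u + F w v;
  shap_contra : forall n u v, F (op n u) v = F u (op (- n) v);
  shap_norm : F genhwv genhwv = 1 }.

(* the entry of A_d(x, y) at the PBW basis elements a and b *)
Definition gram (F : genVerma -> genVerma -> Kxy) d (a b : pbw d) : Kxy :=
  F (wact (pbw_word a) genhwv) (wact (pbw_word b) genhwv).

Definition kappa_cond (c h : K) (d n : nat) : Prop :=
  exists2 F, shapovalov F &
  exists2 Rd : nat -> {ffun pbw d -> K}, (Rd n != 0) &
  forall i, (1 <= i <= n)%N -> forall a : pbw d,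
    \sum_(i <= j < n.+1) ((j - i)`!%:R)^-1 *
      \sum_(b : pbw d) ((gram F a b)^`(j - i)).[h%:P].[c] * Rd j b = 0.

(* kappa as an element of {1, 2, ...} u {oo}, with oo = None *)
Definition is_kappa (c h : K) (d : nat) (kappa : option nat) : Prop :=
  match kappa with
  | Some n => [/\ (0 < n)%N, kappa_cond c h d n
                & forall m, (0 < m)%N -> kappa_cond c h d m -> (m <= n)%N]
  | None => forall m, (0 < m)%N -> kappa_cond c h d m
  end.

Definition le_kappa (k : nat) (kappa : option nat) : Prop :=
  if kappa is Some n then (k <= n)%N else True.

End Kappa.

Section Vertex.
Variables (K : fieldType).

Definition binz (m : int) (i : nat) : K :=
  (\prod_(j < i) (m%:~R - j%:R)) / i`!%:R.

(* [Y] gives the modes of V on itself, [YW] those on W; vac and om are the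
   vacuum and the conformal vector. All sums in the Borcherds (Jacobi) identity
   are finite by truncation. *)
Record is_voa_module (V : opmod K int) (vac om : V)
    (Y : V -> int -> {linear V -> V})
    (W : opmod K int) (YW : V -> int -> {linear W -> W}) : Prop := {
  vm_lin : forall a u v n w, YW (a *: u + v) n w = a *: YW u n w + YW v n w;
  vm_trunc : forall v w, exists N : nat,
    forall n : int, N%:Z <= n -> YW v n w = 0;
  vm_vac : forall n w, YW vac n w = if n == -1 then w else 0;
  vm_borcherds : forall u v w (l m n : int), exists N0, forall N, (N0 <= N)%N ->
    \sum_(i < N) binz m i *: YW (Y u (l + i%:Z) v) (m + n - i%:Z) w =
    \sum_(i < N) ((-1) ^+ i * binz l i) *:
      (YW u (l + m - i%:Z) (YW v (n + i%:Z) w)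
       - (-1) ^ l *: YW v (l + n - i%:Z) (YW u (m + i%:Z) w));
  vm_vir : forall n w, YW om (n + 1) w = op n w;
  vm_der : forall v n w, YW (op (-1) v) n w = - (n%:~R *: YW v (n - 1) w) }.

(* vertex operator algebra structure on the graded Virasoro module V *)
Record is_voa (V : opmod K int) (vac om : V)
    (Y : V -> int -> {linear V -> V}) : Prop := {
  voa_mod : is_voa_module vac om Y Y;
  voa_create : forall v, Y v (-1) vac = v;
  voa_create0 : forall v (n : int), 0 <= n -> Y v n vac = 0 }.

Definition voa_opmod (V W : opmod K int) (YW : V -> int -> {linear W -> W}) :
    opmod K (V * int) :=
  @OpMod K (V * int) W (fun vn => YW vn.1 vn.2).

End Vertex.

Section Pseudo.
Variables (K : fieldType) (I : Type) (W : opmod K I) (L0 : W -> W).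

Definition is_generalized : Prop :=
  [/\ (forall w, span [set u | exists mu, gwt L0 mu u] w),
      (forall mu, findim (gwt L0 mu))
    & (forall mu, exists N : nat, forall n : nat, (N <= n)%N ->
         gwt L0 (mu - n%:R) = [set 0])].

(* k is the length of the chain of submodules (k = 1 for irreducible W). *)
Definition strongly_interlocked (k : nat) : Prop :=
  [/\ is_generalized, interlocked W &
   (irreducible W /\ k = 1%N) \/
   exists F : nat -> submod W,
   [/\ F 0%N = [set 0] :> set W /\ F k = setT :> set W,
       (forall j, (j < k)%N -> F j `<` F j.+1),
       (forall P : submod W, exists2 j, (j <= k)%N & P = F j :> set W),
       (forall j, (0 < j < k)%N -> indecomposable (subm (F j)))
     & (forall j, (j < k)%N ->
          isomorphic (quo [set x : subm (F j.+1) | sset (F j) (val x)])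
                     (subm (F 1%N)))]].

Definition weight_preserving (f : W -> W) : Prop :=
  forall mu w, gwt L0 mu w -> gwt L0 mu (f w).

Definition soc_dim (mu : K) : nat := wdim (socle W `&` gwt L0 mu).

(* b mu j i is the i-th vector of the j-th block of the ordered basis of W_mu;
   blocks are numbered from 0 to k - 1, and b mu j is irrelevant for j >= k. *)
Definition basis_family := forall mu : K, nat -> 'I_(soc_dim mu) -> W.

(* A is the block matrix of f on W_mu; A j' j is the block in block row j' and
   block column j. *)
Definition is_mx (k : nat) (b : basis_family) (mu : K) (f : W -> W)
    (A : nat -> nat -> 'M[K]_(soc_dim mu)) : Prop :=
  forall j i, (j < k)%N ->
    f (b mu j i) = \sum_(j' < k) \sum_i' A j' j i' i *: b mu j' i'.

Arguments is_mx : clear implicits.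

Definition si_family (k : nat) (b : basis_family) : Prop :=
  forall mu,
  [/\ is_basis (gwt L0 mu) (fun x : 'I_k * 'I_(soc_dim mu) => b mu x.1 x.2),
      is_basis (socle W `&` gwt L0 mu) (b mu 0%N)
    & forall f A, op_alg f -> weight_preserving f -> is_mx k b mu f A ->
      [/\ (forall j j', (j < j' < k)%N -> A j' j = 0),
          (forall j, (j < k)%N -> A j j = A 0%N 0%N)
        & (forall j, (j < k)%N -> A 0%N j = A (k.-1 - j)%N k.-1)]].

(* Bases b_i u_j with L_0 u_j = mu u_j + u_{j-1}: the matrix of the nilpotent
   part of L_0 has identity blocks on the first
   block superdiagonal and is zero elsewhere. Without such a normalization
   tr B is not invariant: replacing b mu j by a^j b mu j preserves
   [si_family] and multiplies tr B by a^(k - 1). *)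
Definition jordan_normalized (k : nat) (b : basis_family) : Prop :=
  forall mu i, forall j, (j < k)%N ->
    L0 (b mu j i) = mu *: b mu j i + (if j is j'.+1 then b mu j' i else 0).

Definition well_defined_pstr (k : nat) : Prop :=
  (exists b, si_family k b /\ jordan_normalized k b) /\
  forall b b', si_family k b -> jordan_normalized k b ->
    si_family k b' -> jordan_normalized k b' ->
  forall f, op_alg f -> weight_preserving f ->
  forall mu A A', is_mx k b mu f A -> is_mx k b' mu f A' ->
    \tr (A 0%N k.-1 : 'M[K]_(soc_dim mu)) = \tr (A' 0%N k.-1).

(* pstr (f |_{W_mu}) *)
Definition pstr (k : nat) (mu : K) (f : W -> W) : K :=
  xget 0 [set x | exists b A,
    [/\ si_family k b, jordan_normalized k b, is_mx k b mu f A
      & x = \tr (A 0%N k.-1 : 'M[K]_(soc_dim mu))]].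

(* exp (z N) for a locally nilpotent N *)
Definition opexp (z : K) (N : W -> W) (w : W) : W :=
  xget 0 [set u | \forall m \near \oo,
    u = \sum_(j < m) (z ^+ j / j`!%:R) *: iter j N w].

End Pseudo.

Section Analytic.
Variable R : realType.
Implicit Types (tau a : R[i]).

Definition cexp (z : R[i]) : R[i] :=
  (expR (complex.Re z))%:C%C *
  Complex (cos (complex.Im z)) (sin (complex.Im z)).

Definition twopii : R[i] := Complex 0 (2 * pi).

(* log q = 2 pi i tau and q^a = exp (a log q) *)
Definition logq tau : R[i] := twopii * tau.
Definition qpow tau a : R[i] := cexp (a * logq tau).

Definition eta tau : R[i] :=
  qpow tau 24^-1 *
  limn (fun n => (\prod_(1 <= j < n.+1) (1 - qpow tau j%:R)) : R[i]^o).

Definition Zirr (c h : R[i]) tau : R[i] :=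
  qpow tau (- (c / 24)) *
  limn (series (fun l : nat =>
    ((wdim (Lirr_deg c h l))%:R * qpow tau (l%:R + h)) : R[i]^o)).

(* q d/dq, that is (2 pi i)^-1 d/dtau *)
Definition qddq (f : R[i] -> R[i]) tau : R[i] :=
  twopii^-1 * derive1 (f : R[i]^o -> R[i]^o) tau.

Section Graded.
Variables (V W : opmod R[i] int) (om : V) (YW : V -> int -> {linear W -> W}).
Variables (c : R[i]) (k : nat).

Definition L0op : W -> W := YW om 1.

(* The summand of pstr_W(v, tau) at the weight mu, for v of weight d: then
   o(v) = v_{d - 1}, and the nilpotent part of L_0 on W_mu is L_0 - mu. *)
Definition pstr_term (v : V) (d : int) tau (mu : R[i]) : R[i]^o :=
  limn (series (fun j : nat =>
    (@pstr _ _ (voa_opmod YW) L0op k mu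
       (fun w => (j`!%:R)^-1 *:
          YW v (d - 1) (iter j (fun u => L0op u - mu *: u) w))
     * logq tau ^+ j) : R[i]^o))
  * qpow tau (mu - c / 24).

Definition pstr_graded (v : V) (d : int) tau : R[i] :=
  summability.sum (pstr_term v d tau).

Definition pstr_cvg (v : V) (d : int) tau : Prop :=
  cvg (partial_sum (pstr_term v d tau) @ totally).

End Graded.
End Analytic.

(* Main.v *)
(** The endomorphism x - h of U(c,h,k) induces a nilpotent endomorphism f of
    W = W(c,h,k), and M(c,h,k) is filtered by k copies of M(c,h). The definition
    of kappa provides, for k <= kappa, an element of the radical J(c,h,k) whose
    image in the top copy of M(c,h) is a nonzero vector of degree rs. As T(c,h) is
    generated by a singular vector of that degree, the image of J(c,h,k) is all of
    T(c,h); hence ker f^i = im f^(k-i), every layer of W is L(c,h), and the kernels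
    of the powers of f are the only submodules. The operators considered commute
    with f, so on a weight space they are linear over K[f]/(f^k), over which the
    weight space is free, and tr B is the coefficient of f^(k-1) in their trace:
    this is independent of bases, and equals a_(k-1) dim L(c,h)_mu for the operator
    a_0 + a_1 f + ... + a_(k-1) f^(k-1). The PBW monomials with fewer than rs
    factors L_{-1} give a basis of L(c,h), whence its character. *)

From HB Require Import structures.
Require Import Defs.
From mathcomp Require Import all_boot all_order all_algebra.
From mathcomp Require Import finmap complex zify ring lra.
From mathcomp Require Import all_classical all_reals all_analysis.

Set Implicit Arguments.
Unset Strict Implicit.
Unset Printing Implicit Defensive.

Import Order.TTheory GRing.Theory Num.Theory.
Import numFieldNormedType.Exports.

Local Open Scope classical_set_scope.
Local Open Scope ring_scope.

Local Notation span := Defs.span.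
Local Notation proj := Defs.proj.
Local Arguments op {R I M} i : simpl never.

(** * Independence of PBW monomials in induced modules *)

(** The modules are given by generators and relations, so that even u_1 <> 0 needs a proof. A
    representation on coordinate functions is therefore built by hand and checked against the
    Virasoro relations; it yields the linear independence of the PBW monomials, on which the later
    nonvanishing statements rest. The endomorphism f has two descriptions: it is a module
    endomorphism, and on the weight space of weight h + l it is L_0 - (h + l). The first makes all
    modes commute with f; the second makes submodules stable under f and endomorphisms commute with
    it. The V-module structure enters through Borcherds' identity, which expresses all modes by the
    L_n: submodules and endomorphisms are the same for V and for the Virasoro algebra. The sum over
    weights runs over all finite sets of complex numbers, hence the estimates of absolute
    convergence. The product in eta is compared with partition numbers through finite products, for
    which Euler's identity is an induction. *)

Definition normal (n : int) (w : seq int) :=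
  (n < 0) && (if w is a :: _ then a <= n else true).

(** The words of PBW monomials: negative letters in nonincreasing order, so that the factors L_{-1}
    stand in front, as in [pbw_word]. *)
Fixpoint good (w : seq int) : bool :=
  if w is a :: w' then normal a w' && good w' else true.

(** For n < 0 this is the word of the leading term of L_n L_w. *)
Fixpoint ins (n : int) (w : seq int) : seq int :=
  if w is a :: w' then if a <= n then n :: w else a :: ins n w' else [:: n].

Lemma size_ins n w : size (ins n w) = (size w).+1.
Proof. by elim: w => //= a w IH; case: ifP => //= _; rewrite IH. Qed.

Lemma normal_ins a n w : n < a -> normal a w -> normal a (ins n w).
Proof.
move=> na; case: w => [|b w] /=; rewrite /normal => /andP[-> //=].
  by move=> _; exact: ltW.
by case: ifP => //= _ _; exact: ltW.
Qed.

Lemma good_ins n w : n < 0 -> good w -> good (ins n w).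
Proof.
move=> n0; elim: w => [|a w IH] /=; first by rewrite /normal n0.
move=> /andP[na gw]; case: ifP => [an|/negbT]; first by rewrite /= na gw /normal n0 an.
by rewrite -ltNge => na'; rewrite /= normal_ins // IH.
Qed.

Lemma ins_normal n w : normal n w -> ins n w = n :: w.
Proof. by case: w => [|a w] //=; rewrite /normal => /andP[_ ->]. Qed.

Lemma ins_step n a w : n < 0 -> ~~ normal n (a :: w) ->
  n < a /\ ins n (a :: w) = a :: ins n w.
Proof.
by rewrite /normal /= => -> /=; rewrite -ltNge => na; split=> //; rewrite leNgt na.
Qed.

Section PBW.
Variables (R : comUnitRingType) (c : R) (k : nat) (X : 'M[R]_k).

Definition cen (m n : int) : R :=
  if m + n == 0 then (m ^+ 3 - m)%:~R / 12%:R * c else 0.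

Lemma cenC m n : cen m n = - cen n m.
Proof.
rewrite /cen [n + m]addrC; case: eqP => [mn|_]; last by rewrite oppr0.
have -> : n = - m by lia.
by rewrite -!mulNr -rmorphN; congr (_%:~R / _ * _); ring.
Qed.

Lemma cen0 n : cen 0 n = 0.
Proof. by rewrite /cen expr0n /= subrr mulr0z !mul0r if_same. Qed.

(** The cocycle identity of the central term, i.e. the central part of the Jacobi identity of the
    Virasoro algebra. *)
Lemma cen_cocycle m n a : (m - n)%:~R * cen (m + n) a =
  (m - a)%:~R * cen (m + a) n + (n - a)%:~R * cen m (n + a).
Proof.
rewrite /cen [m + a + n]addrAC addrA; case: eqP => [mna|_]; last by rewrite !mulr0 addr0.
have -> : a = - (m + n) by lia.
rewrite !mulrA -!mulrDl -!rmorphM -!rmorphD /=; congr (_%:~R / _ * _); ring.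
Qed.

(* A vector is encoded as a linear functional on coordinate functions, i.e. in
   the continuation monad: (w, j), standing for L_w u_j, is [fun phi => phi w j],
   and linear extension of an operator is composition. For n < 0, [low] is
   L_n L_w u_j minus its leading term; N is fuel, to be at least the size of w. *)
Fixpoint low (N : nat) (n : int) (w : seq int) (j : 'I_k)
    (phi : seq int -> 'I_k -> R) : R :=
  if normal n w then 0 else
  match w, N with
  | [::], _ => if n == 0 then \sum_i X i j * phi [::] i else 0
  | _, 0%N => 0
  | a :: w', N'.+1 =>
      low N' n w' j (fun x i => (if a < 0 then phi (ins a x) i else 0) + low N' a x i phi)
      + (n - a)%:~R * ((if n + a < 0 then phi (ins (n + a) w') j else 0)
                       + low N' (n + a) w' j phi)
      + cen n a * phi w' j
  end.

Definition act N n w j phi := (if n < 0 then phi (ins n w) j else 0) + low N n w j phi.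

Lemma low_cons N n a w j phi : low N.+1 n (a :: w) j phi =
  if normal n (a :: w) then 0 else
  low N n w j (fun x i => act N a x i phi) + (n - a)%:~R * act N (n + a) w j phi
  + cen n a * phi w j.
Proof. by []. Qed.

Lemma low_nil N n j phi : low N n [::] j phi =
  if n == 0 then \sum_i X i j * phi [::] i else 0.
Proof. by case: N => [|N] /=; rewrite /normal andbT; case: ltrgt0P. Qed.

(** Triangularity: apart from the leading term, L_n L_w involves only good words no longer than w.
    Both the fuel argument and the induction in [comm_relP] depend on this. *)
Lemma low_ext N n w j phi psi : good w ->
  (forall x i, good x -> (size x <= size w)%N -> phi x i = psi x i) ->
  low N n w j phi = low N n w j psi.
Proof.
elim: N n w j phi psi => [|N IH] n [|a w] j phi psi gw e.
- by rewrite !low_nil; case: ifP => // _; apply: eq_bigr => i _; rewrite e.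
- by [].
- by rewrite !low_nil; case: ifP => // _; apply: eq_bigr => i _; rewrite e.
rewrite !low_cons; case: ifP => // _.
have /andP[/andP[a0 _] gw'] := gw.
congr (_ + _ * _ + _ * _).
- apply: (IH) => // x i gx sx; rewrite /act a0; congr (_ + _).
    by apply: e; [exact: good_ins|rewrite size_ins].
  by apply: IH => // y l gy sy; apply: e => //=; lia.
- rewrite /act; congr (_ + _).
    by case: ifP => // na; apply: e; [exact: good_ins|rewrite size_ins].
  by apply: IH => // y l gy sy; apply: e => //=; lia.
- by apply: e => //=; lia.
Qed.

(** The recursive calls concern the tail of w and words produced from it, which by [low_ext] are no
    longer than the tail. *)
Lemma low_fuel N M n w j phi : good w -> (size w <= N)%N -> (size w <= M)%N ->
  low N n w j phi = low M n w j phi.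
Proof.
elim: N M n w j phi => [|N IH] M n [|a w] j phi gw sN sM //; try by rewrite !low_nil.
case: M sM => [//|M] sM; rewrite /= !ltnS in sN sM; rewrite !low_cons; case: ifP => // _.
have /andP[/andP[a0 _] gw'] := gw.
congr (_ + _ * _ + _ * _).
- rewrite (IH M) //; apply: low_ext => // x i gx sx.
  by rewrite /act; congr (_ + _); apply: IH => //; lia.
- by rewrite /act; congr (_ + _); apply: IH.
Qed.

Lemma low_linear N n w j r phi psi :
  low N n w j (fun x i => r * phi x i + psi x i) =
  r * low N n w j phi + low N n w j psi.
Proof.
have nil M m : low M m [::] j (fun x i => r * phi x i + psi x i) =
    r * low M m [::] j phi + low M m [::] j psi.
  rewrite !low_nil; case: ifP => _; last by rewrite mulr0 addr0.
  by rewrite mulr_sumr -big_split; apply: eq_bigr => i _ /=; ring.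
elim: N n w j phi psi nil => [|N IH] n [|a w] j phi psi nil //.
  by rewrite /=; case: ifP; rewrite mulr0 addr0.
have {}IH m x i p q : low N m x i (fun x i => r * p x i + q x i) =
    r * low N m x i p + low N m x i q.
  apply: IH => M l; rewrite !low_nil; case: ifP => _; last by rewrite mulr0 addr0.
  by rewrite mulr_sumr -big_split; apply: eq_bigr => i' _ /=; ring.
rewrite !low_cons; case: ifP => _; first by rewrite mulr0 addr0.
have -> : low N n w j (fun x i => act N a x i (fun y l => r * phi y l + psi y l)) =
          low N n w j (fun x i => r * act N a x i phi + act N a x i psi).
  congr low; apply/funext => x; apply/funext => i.
  by rewrite /act IH; case: ifP => _; ring.
by rewrite IH /act IH; case: ifP => _; ring.
Qed.

Definition actL n w j phi := act (size w) n w j phi.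

Lemma actL_linear n w j r phi psi :
  actL n w j (fun x i => r * phi x i + psi x i) = r * actL n w j phi + actL n w j psi.
Proof. by rewrite /actL /act low_linear; case: ifP => _; ring. Qed.

Lemma actL0 n w j : actL n w j (fun _ _ => 0) = 0.
Proof.
have := actL_linear n w j (-1) (fun _ _ => 0) (fun _ _ => 0).
have -> : (fun (_ : seq int) (_ : 'I_k) => -1 * 0 + 0 : R) = (fun _ _ => 0).
  by apply/funext => x; apply/funext => i; rewrite mulr0 addr0.
by rewrite mulN1r addNr.
Qed.

Lemma actL_scale n w j r phi :
  actL n w j (fun x i => r * phi x i) = r * actL n w j phi.
Proof.
have := actL_linear n w j r phi (fun _ _ => 0); rewrite actL0 addr0 => <-.
by congr actL; apply/funext => x; apply/funext => i; rewrite addr0.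
Qed.

Lemma actL_ext n w j phi psi : good w ->
  (n < 0 -> phi (ins n w) j = psi (ins n w) j) ->
  (forall x i, good x -> (size x <= size w)%N -> phi x i = psi x i) ->
  actL n w j phi = actL n w j psi.
Proof.
by move=> gw e1 e2; rewrite /actL /act; congr (_ + _); [case: ifP|exact: low_ext].
Qed.

Lemma actL_good n w j phi psi : good w ->
  (forall x i, good x -> phi x i = psi x i) -> actL n w j phi = actL n w j psi.
Proof.
by move=> gw e; apply: actL_ext => // [n0|*]; apply: e => //; exact: good_ins.
Qed.

Lemma actL_normal n w j phi : normal n w -> actL n w j phi = phi (n :: w) j.
Proof.
move=> nw; rewrite /actL /act ins_normal //; have /andP[-> _] := nw.
by case: w nw => [|a w] nw /=; rewrite nw addr0.
Qed.

Lemma actL_nil n j phi : 0 <= n ->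
  actL n [::] j phi = if n == 0 then \sum_i X i j * phi [::] i else 0.
Proof. by move=> n0; rewrite /actL /act ltNge n0 low_nil add0r. Qed.

(** L_n L_a = L_a L_n + [L_n, L_a], applied to w. In continuation form the operator applied last is
    the one in the inner functional. *)
Lemma actL_step n a w j phi : good (a :: w) -> ~~ normal n (a :: w) ->
  actL n (a :: w) j phi = actL n w j (fun x i => actL a x i phi)
  + (n - a)%:~R * actL (n + a) w j phi + cen n a * phi w j.
Proof.
move=> gaw nn; have /andP[naw gw] := gaw; have /andP[a0 _] := naw.
set psi := (fun x i => actL a x i phi).
have -> : actL n w j psi = act (size w) n w j psi by [].
rewrite [LHS]/actL {1}/act [size _]/= low_cons (negbTE nn) !addrA.
congr (_ + _ + _); rewrite {1}/act; congr (_ + _).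
  case: ifP => // n0; have [na ->] := ins_step n0 nn.
  by rewrite /psi actL_normal // normal_ins.
by apply: low_ext => // x i gx sx; rewrite /psi /actL /act; congr (_ + _); exact: low_fuel.
Qed.

Definition comm_rel m n w := forall j phi,
  actL n w j (fun x i => actL m x i phi) - actL m w j (fun x i => actL n x i phi)
  = (m - n)%:~R * actL (m + n) w j phi + cen m n * phi w j.

Lemma comm_relC m n w : comm_rel m n w -> comm_rel n m w.
Proof.
move=> H j phi; rewrite -opprB H cenC [n + m]addrC -[n - m]opprB rmorphN /=; ring.
Qed.

(** Here L_n w is the single word n :: w, and the recursion for L_m on that word is the commutation
    relation itself. *)
Lemma comm_rel_normal1 m n w : good w -> normal n w -> (0 <= m) || (m < n) ->
  comm_rel m n w.
Proof.
move=> gw nw mn j phi.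
have nn : ~~ normal m (n :: w) by rewrite /normal negb_and -leNgt -ltNge.
by rewrite actL_normal // actL_step //= ?nw //; ring.
Qed.

(** In the remaining case n <= m < 0. If n < m, then m may be prepended to w as well, and the
    relation with m and n exchanged is the previous case. *)
Lemma comm_rel_normal m n w : good w -> normal n w -> comm_rel m n w.
Proof.
move=> gw nw; case: (boolP ((0 <= m) || (m < n))); first exact: comm_rel_normal1.
rewrite negb_or -leNgt -ltNge => /andP[m0 nm].
case: (eqVneq n m) => [<- j phi|nm'].
  rewrite /cen; case: eqP => [nn|]; rewrite !subrr mulr0z ?mul0r ?add0r //.
  by have -> : n = 0; [lia|rewrite expr0n subrr mulr0z !mul0r].
apply: comm_relC; apply: comm_rel_normal1 => //; last first.
  by apply/orP; right; rewrite lt_neqAle nm' nm.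
by move: nw; rewrite /normal m0; case: (w) => //= a w' /andP[_] /le_trans; apply.
Qed.

(** Strong induction on the length of w. If neither m nor n may be prepended to w = a :: w', both
    are moved past L_a by the relations for words no longer than w'; what remains is the Jacobi
    identity for m, n, a. *)
Lemma comm_relP m n w : good w -> comm_rel m n w.
Proof.
move: {2}(size w).+1 (ltnSn (size w)) => s.
elim: s m n w => // s IH m n w sw gw.
case: (boolP (normal n w)) => [nn|nn]; first exact: comm_rel_normal.
case: (boolP (normal m w)) => [nm|nm].
  by apply: comm_relC; exact: comm_rel_normal.
case: w gw sw nn nm => [_ _|a w gaw sw nn nm].
  rewrite /normal !andbT -!leNgt => n0 m0 j phi.
  have aX (l : int) psi : 0 <= l -> actL l [::] j psi =
    if l == 0 then \sum_i X i j * psi [::] i else 0 by exact: actL_nil.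
  rewrite !aX ?addr_ge0 //.
  have [->|n0'] := eqVneq n 0; have [->|m0'] := eqVneq m 0; rewrite /= ?addr0 ?add0r.
  - by rewrite !subrr mulr0z cen0 !mul0r addr0.
  - by rewrite (negbTE m0') cenC cen0 oppr0 mulr0 mul0r !addr0 big1 // => i _;
      rewrite actL_nil // (negbTE m0') mulr0.
  - by rewrite (negbTE n0') cen0 mulr0 mul0r addr0 big1 ?oppr0 // => i _;
      rewrite actL_nil // (negbTE n0') mulr0.
  - have mn0 : (m + n == 0) = false by apply/negP; lia.
    by rewrite mn0 /cen mn0 mulr0 mul0r addr0 oppr0.
have /andP[naw gw] := gaw; have /andP[a0 _] := naw.
have sw' : (size w < s)%N by [].
have nlt (l : int) : ~~ normal l (a :: w) -> (0 <= l) || (l < a).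
  by rewrite /normal negb_and -leNgt -ltNge.
move=> j phi.
(* L_p L_q L_a w, with L_a moved to the left end and the commutators collected. *)
have E p q : ~~ normal p (a :: w) -> ~~ normal q (a :: w) ->
  actL q (a :: w) j (fun x i => actL p x i phi) =
  actL q w j (fun x i => actL p x i (fun y l => actL a y l phi))
  + (p - a)%:~R * actL q w j (fun x i => actL (p + a) x i phi)
  + cen p a * actL q w j phi
  + (q - a)%:~R * actL (q + a) w j (fun x i => actL p x i phi)
  + cen q a * actL p w j phi.
  move=> np nq; rewrite actL_step //; congr (_ + _ + _).
  transitivity (actL q w j (fun x i =>
      1 * actL p x i (fun y l => actL a y l phi) +
      ((p - a)%:~R * actL (p + a) x i phi + cen p a * phi x i))).
    apply: actL_ext => //.
      (* The leading word [ins q w] is longer than w and escapes the induction hypothesis, but a may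
         be prepended to it, so that [comm_rel_normal1] applies. *)
      move=> q0; have [qa _] := ins_step q0 nq.
      have := @comm_rel_normal1 p a (ins q w) (good_ins q0 gw)
         (normal_ins qa naw) (nlt _ np) j phi.
      by move/eqP; rewrite subr_eq => /eqP ->; ring.
    move=> x i gx sx; have := IH p a x (leq_ltn_trans sx sw') gx i phi.
    by move/eqP; rewrite subr_eq => /eqP ->; ring.
  by rewrite !actL_linear actL_scale mul1r addrA.
have IHj p q := IH p q w sw' gw j.
have Cmn : actL n w j (fun x i => actL m x i (fun y l => actL a y l phi))
    - actL m w j (fun x i => actL n x i (fun y l => actL a y l phi)) =
    (m - n)%:~R * (actL (m + n) w j (fun y l => actL a y l phi))
    + cen m n * phi (a :: w) j.
  by rewrite IHj; congr (_ + _ * _); exact: actL_normal.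
have C3 := IHj (m + n) a phi.
rewrite (actL_normal _ _ naw) in C3.
rewrite !E //.
have {}C3 : actL (m + n) (a :: w) j phi =
   actL (m + n) w j (fun x i => actL a x i phi) +
   (m + n - a)%:~R * actL (m + n + a) w j phi + cen (m + n) a * phi w j.
  by rewrite -addrA -C3; ring.
have C1 := IHj (m + a) n phi; have C2 := IHj m (n + a) phi.
have J := cen_cocycle m n a.
rewrite C3.
rewrite [m + a + n]addrAC addrA in C1 C2.
move: Cmn C1 C2 => /eqP + /eqP + /eqP.
rewrite ![_ - _ == _]subr_eq => /eqP -> /eqP C1 /eqP C2.
rewrite C1 C2.
have -> : (m - n)%:~R * (actL (m + n) w j (fun x i => actL a x i phi) +
   (m + n - a)%:~R * actL (m + n + a) w j phi + cen (m + n) a * phi w j)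
 = (m - n)%:~R * actL (m + n) w j (fun x i => actL a x i phi) +
   ((m - n) * (m + n - a))%:~R * actL (m + n + a) w j phi
   + ((m - n)%:~R * cen (m + n) a) * phi w j :> R by rewrite rmorphM /=; ring.
rewrite J !rmorphM !rmorphB !rmorphD /=; ring.
Qed.

(** The interpretation of formal expressions in the model just constructed. *)
Fixpoint ev (x : ind_term R k) (phi : seq int -> 'I_k -> R) : R :=
  match x with
  | ITgen j => phi [::] j
  | ITzero => 0
  | ITadd x y => ev x phi + ev y phi
  | ITscale a x => a * ev x phi
  | ITL n x => ev x (fun w j => actL n w j phi)
  end.

Lemma ev_linear x r phi psi :
  ev x (fun w j => r * phi w j + psi w j) = r * ev x phi + ev x psi.
Proof.
elim: x phi psi => [j||x IHx y IHy|a x IHx|n x IHx] phi psi /=.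
- by [].
- by rewrite mulr0 addr0.
- by rewrite IHx IHy; ring.
- by rewrite IHx; ring.
- rewrite -IHx; congr ev; apply/funext => w; apply/funext => j.
  exact: actL_linear.
Qed.

Lemma ev_ext x phi psi : (forall w j, good w -> phi w j = psi w j) ->
  ev x phi = ev x psi.
Proof.
elim: x phi psi => [j||x IHx y IHy|a x IHx|n x IHx] phi psi e /=.
- exact: e.
- by [].
- by rewrite (IHx _ _ e) (IHy _ _ e).
- by rewrite (IHx _ _ e).
- by apply: IHx => w j gw; apply: actL_good => // y i gy; exact: e.
Qed.

(** All defining relations hold in the model, the Virasoro relation by [comm_relP]; so coordinates
    are well defined on the induced module. *)
Lemma ev_eq x y : ind_eq c X x y -> ev x = ev y.
Proof.
move=> H; apply/funext; elim: x y / H => //=.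
- by move=> x y _ IH phi; rewrite IH.
- by move=> y x z _ IH1 _ IH2 phi; rewrite IH1.
- by move=> x x' y y' _ IH1 _ IH2 phi; rewrite IH1 IH2.
- by move=> a x x' _ IH phi; rewrite IH.
- by move=> n x x' _ IH phi; rewrite IH.
- by move=> x y z phi; rewrite addrA.
- by move=> x y phi; rewrite addrC.
- by move=> x phi; rewrite add0r.
- by move=> x phi; rewrite mulN1r addNr.
- by move=> a b x phi; rewrite mulrA.
- by move=> x phi; rewrite mul1r.
- by move=> a x y phi; rewrite mulrDr.
- by move=> a b x phi; rewrite mulrDl.
- move=> m n x phi.
  transitivity (ev x (fun w j => 1 * actL m w j (fun y l => actL n y l phi) +
     ((m - n)%:~R * actL (m + n) w j phi + cen m n * phi w j))).
    apply: ev_ext => w j gw; have := comm_relP m n gw j phi.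
    by move/eqP; rewrite subr_eq => /eqP ->; ring.
  rewrite !ev_linear mul1r; congr (_ + (_ + _)).
  (* A pure multiple is brought into the shape [r * phi + psi] that [ev_linear] expects. *)
  have -> : (fun w j => cen m n * phi w j) = (fun w j => (cen m n - 1) * phi w j + phi w j).
    by apply/funext => w; apply/funext => j; ring.
  by rewrite ev_linear -/(cen m n); ring.
- by move=> n j n0 phi; rewrite actL_nil ?ltW // gt_eqF.
- move=> j phi; rewrite actL_nil // eqxx.
  rewrite (big_morph (fun x => ev x phi) (id1 := 0) (op1 := +%R)) //.
Qed.

Definition coord (w : seq int) (j : 'I_k) (v : ind_mod c X) : R :=
  ev (repr (v : ind_car c X)) (fun w' j' => ((w' == w) && (j' == j))%:R).

Lemma coord_pi w j x : coord w j (ind_pi c X x) =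
  ev x (fun w' j' => ((w' == w) && (j' == j))%:R).
Proof. by rewrite /coord (ev_eq (ind_repr c X x)). Qed.

Lemma coord_linear w j : linear_for *%R (coord w j).
Proof.
move=> a u v; rewrite -[u]ind_piK -[v]ind_piK ind_piZ ind_piD.
by rewrite !coord_pi.
Qed.

Fixpoint word_term (w : seq int) (j : 'I_k) : ind_term R k :=
  if w is a :: w' then ITL a (word_term w' j) else ITgen R j.

Lemma word_termE w j : wact w (ind_gen c X j) = ind_pi c X (word_term w j).
Proof. by elim: w => //= a w ->; rewrite [LHS]ind_LE. Qed.

(** Independence of the PBW monomials: along a good word each letter is simply prepended, so the
    model sends L_w' u_j' to the pair (w', j'). *)
Lemma coord_word w j w' j' : good w' -> 
  coord w j (wact w' (ind_gen c X j')) = ((w' == w) && (j' == j))%:R.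
Proof.
move=> gw'; rewrite word_termE coord_pi.
suff H phi : ev (word_term w' j') phi = phi w' j' by rewrite H.
elim: w' gw' phi => //= a w' IH /andP[na gw'] phi.
by rewrite IH // actL_normal.
Qed.

End PBW.

(** * Homomorphisms, grading and spanning sets *)

Definition wsum (w : seq int) : int := \sum_(n <- w) n.

Lemma wsum_cons a w : wsum (a :: w) = a + wsum w.
Proof. by rewrite /wsum big_cons. Qed.

Lemma wsum_cat w w' : wsum (w ++ w') = wsum w + wsum w'.
Proof. by rewrite /wsum big_cat. Qed.

Lemma wsum_ins n w : wsum (ins n w) = n + wsum w.
Proof.
elim: w => [|a w IH] //=; first by rewrite wsum_cons.
by case: ifP => _; rewrite !wsum_cons // IH; lia.
Qed.

Section Span.
Variables (K : pzRingType) (V : lmodType K).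
Implicit Types (G P : set V).

Definition linset P := P 0 /\ forall a u v, P u -> P v -> P (a *: u + v).

Lemma linsetD P u v : linset P -> P u -> P v -> P (u + v).
Proof. by move=> [_ lP] Pu Pv; rewrite -[u]scale1r; exact: lP. Qed.
Lemma linsetZ P a u : linset P -> P u -> P (a *: u).
Proof. by move=> [P0 lP] Pu; rewrite -[_ *: _]addr0; exact: lP. Qed.
Lemma linsetN P u : linset P -> P u -> P (- u).
Proof. by move=> lP Pu; rewrite -scaleN1r; exact: linsetZ. Qed.
Lemma linsetB P u v : linset P -> P u -> P v -> P (u - v).
Proof. by move=> lP Pu Pv; apply: linsetD => //; exact: linsetN. Qed.
Lemma linset_sum P (I : Type) (s : seq I) (Q : pred I) (F : I -> V) : linset P ->
  (forall i, Q i -> P (F i)) -> P (\sum_(i <- s | Q i) F i).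
Proof.
move=> lP H; elim/big_ind: _ => [|u v Pu Pv|//]; first by case: lP.
exact: linsetD.
Qed.
Lemma linset_sum_seq P (I : eqType) (s : seq I) (F : I -> V) : linset P ->
  (forall i, i \in s -> P (F i)) -> P (\sum_(i <- s) F i).
Proof. by move=> lP H; rewrite big_seq; exact: linset_sum. Qed.

Lemma span_linset G : linset (span G).
Proof.
split; first by exists [::]; split=> //; rewrite big_nil.
move=> a u v [s [sG ->]] [s' [sG' ->]].
exists ([seq (a * x.1, x.2) | x <- s] ++ s'); split=> [x|].
  rewrite mem_cat => /orP[/mapP[y /sG Gy ->] //|]; exact: sG'.
rewrite big_cat big_map scaler_sumr; congr (_ + _).
by apply: eq_bigr => x _; rewrite scalerA.
Qed.

Lemma span_min G P : linset P -> G `<=` P -> span G `<=` P.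
Proof.
move=> lP GP v [s [sG ->]]; apply: linset_sum_seq => // x /sG Gx.
by apply: linsetZ => //; exact: GP.
Qed.

Lemma sub_span G : G `<=` span G.
Proof.
move=> v Gv; exists [:: (1, v)]; split; first by move=> x; rewrite inE => /eqP ->.
by rewrite big_seq1 scale1r.
Qed.

Lemma span_mono G G' : G `<=` G' -> span G `<=` span G'.
Proof.
move=> s; apply: span_min (span_linset G') _; apply: subset_trans s _.
exact: sub_span.
Qed.

End Span.

Lemma linset_preim (K : pzRingType) (V V' : lmodType K) (f : V -> V') (P : set V') :
  (forall a u v, f (a *: u + v) = a *: f u + f v) -> linset P -> linset (f @^-1` P).
Proof.
move=> lf [P0 lP]; split; last by move=> a u v Pu Pv; rewrite /preimage /= lf; exact: lP.
by rewrite /preimage /=; have := lf (-1) 0 0; rewrite scaleN1r addNr scaleN1r addNr => ->.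
Qed.

Lemma linset_eq0 (K : pzRingType) (V V' : lmodType K) (f : V -> V') :
  (forall a u v, f (a *: u + v) = a *: f u + f v) -> linset [set v | f v = 0].
Proof.
move=> lf; have : linset ([set 0] : set V').
  by split=> // a u v /= -> ->; rewrite scaler0 addr0.
by move/(linset_preim lf).
Qed.

Section Hom.
Variables (R : pzRingType) (I : Type).
Implicit Types M N : opmod R I.

Lemma homD M N (f : M -> N) : is_hom f -> {morph f : u v / u + v}.
Proof. by move=> [lf _] u v; rewrite -[u]scale1r lf !scale1r. Qed.
Lemma hom0 M N (f : M -> N) : is_hom f -> f 0 = 0.
Proof. by move=> hf; apply: (addrI (f 0)); rewrite -homD // !addr0. Qed.
Lemma homZ M N (f : M -> N) a : is_hom f -> {morph f : u / a *: u}.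
Proof. by move=> hf u; rewrite -[a *: u]addr0 hf.1 (hom0 hf) addr0. Qed.
Lemma homN M N (f : M -> N) : is_hom f -> {morph f : u / - u}.
Proof. by move=> hf u; rewrite -scaleN1r homZ // scaleN1r. Qed.
Lemma homB M N (f : M -> N) : is_hom f -> {morph f : u v / u - v}.
Proof. by move=> hf u v; rewrite homD // homN. Qed.
Lemma hom_sum M N (f : M -> N) : is_hom f -> forall (J : Type) (s : seq J) (P : pred J) F,
  f (\sum_(i <- s | P i) F i) = \sum_(i <- s | P i) f (F i).
Proof.
by move=> hf J s P F; apply: (big_morph f); [exact: homD|exact: hom0].
Qed.

Lemma hom_comp M N N' (f : M -> N) (g : N -> N') :
  is_hom f -> is_hom g -> is_hom (g \o f).
Proof. by move=> [lf of_] [lg og]; split=> *; rewrite /= ?lf ?lg ?of_ ?og. Qed.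

Lemma hom_id M : is_hom (@id M). Proof. by []. Qed.

Lemma hom_iter M (f : M -> M) n : is_hom f -> is_hom (iter n f).
Proof.
move=> hf; elim: n => [|n IH]; first exact: hom_id.
exact: (hom_comp IH hf).
Qed.

Lemma preim_is_submod M N (f : M -> N) (P : set N) : is_hom f -> is_submod P ->
  is_submod (f @^-1` P).
Proof.
move=> hf [P0 lP oP]; have [l0 ll] := linset_preim hf.1 (conj P0 lP).
by split=> // i u Pu; rewrite /preimage /= hf.2; exact: oP.
Qed.

Lemma ker_is_submod M N (f : M -> N) : is_hom f -> is_submod [set v | f v = 0].
Proof.
move=> hf; have [k0 kl] := linset_eq0 hf.1; split=> // i u /= fu.
by rewrite hf.2 fu linear0.
Qed.

Lemma im_is_submod M N (f : M -> N) : is_hom f -> is_submod (range f).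
Proof.
move=> hf; split; first by exists 0 => //; exact: hom0.
  by move=> a _ _ [u _ <-] [v _ <-]; exists (a *: u + v) => //; rewrite hf.1.
by move=> i _ [u _ <-]; exists (op i u) => //; rewrite hf.2.
Qed.

Lemma gen_sub M (G : set M) : G `<=` gen G.
Proof. by move=> v Gv P; apply. Qed.

Lemma gen_min M (G P : set M) : is_submod P -> G `<=` P -> gen G `<=` P.
Proof. by move=> sP GP v /(_ (Submod sP)); apply. Qed.

Lemma gen_id M (G : set M) : is_submod G -> gen G = G.
Proof. by move=> sG; apply/seteqP; split; [exact: gen_min|exact: gen_sub]. Qed.

Lemma gen_linset M (G : set M) : linset (gen G).
Proof. by case: (gen_is_submod G). Qed.

Lemma proj_hom M (G : set M) : is_hom (proj G).
Proof.
split=> [a u v|i u]; first by rewrite /proj -quo_piD -quo_piZ.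
by rewrite /proj [RHS]quo_opE.
Qed.

Lemma proj_eq M (G : set M) u v : proj G u = proj G v <-> gen G (u - v).
Proof. exact: quo_piP. Qed.

Lemma proj_eq0 M (G : set M) u : proj G u = 0 <-> gen G u.
Proof. by rewrite -(hom0 (proj_hom G)) proj_eq subr0. Qed.

Lemma proj_surj M (G : set M) (x : quo G) : exists u, x = proj G u.
Proof. by exists (repr (x : quo_car G)); rewrite /proj quo_piK. Qed.

Definition qlift M N (G : set M) (f : M -> N) (x : quo G) : N := f (repr (x : quo_car G)).

Lemma qliftE M N (G : set M) (f : M -> N) u : is_hom f -> (forall v, G v -> f v = 0) ->
  qlift f (proj G u) = f u.
Proof.
move=> hf Gf; apply/eqP; rewrite -subr_eq0 /qlift -(homB hf); apply/eqP.
have : gen G (repr (proj G u : quo_car G) - u) by exact: gen_repr.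
by move/(gen_min (ker_is_submod hf)); apply.
Qed.

Lemma qlift_hom M N (G : set M) (f : M -> N) : is_hom f -> (forall v, G v -> f v = 0) ->
  is_hom (qlift (G := G) f).
Proof.
move=> hf Gf; split=> [a x y|i x].
  have [u ->] := proj_surj x; have [v ->] := proj_surj y.
  by rewrite -(proj_hom G).1 !qliftE // hf.1.
by have [u ->] := proj_surj x; rewrite -(proj_hom G).2 !qliftE // hf.2.
Qed.

End Hom.

Section Vir.
Variable (R : comUnitRingType).

Definition vir_rel (c : R) (M : opmod R int) := forall m n (x : M),
  op m (op n x) = op n (op m x) + ((m - n)%:~R *: op (m + n) x + cen c m n *: x).

Lemma vir_quo c (M : opmod R int) (G : set M) : vir_rel c M -> vir_rel c (quo G).
Proof.
move=> H m n x; have [u ->] := proj_surj x; have hp := proj_hom G.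
by rewrite -!hp.2 H !(homD hp) !(homZ _ hp).
Qed.

Variables (c : R) (k : nat) (X : 'M[R]_k).
Local Notation M := (ind_mod c X).
Local Notation u_ := (ind_gen c X).

Lemma vir_ind : vir_rel c M.
Proof.
move=> m n x; rewrite -[x]ind_piK.
have opE p y : op p (ind_pi c X y : M) = ind_pi c X (ITL p y) by exact: ind_LE.
rewrite !opE [X in _ + X](_ : _ = ind_pi c X (ITadd (ITscale (m - n)%:~R
  (ITL (m + n) (repr x))) (ITscale (cen c m n) (repr x)))).
  by rewrite [RHS]ind_piD; apply/ind_piP; exact: IE_vir.
by rewrite [X in X + _]ind_piZ [X in _ + X]ind_piZ ind_piD.
Qed.

Lemma ind_gen_pos n j : 0 < n -> op n (u_ j) = 0.
Proof. by move=> n0; rewrite [LHS]ind_LE; apply/ind_piP; exact: IE_pos. Qed.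

Lemma ind_gen_zero j : op 0 (u_ j) = \sum_i X i j *: u_ i.
Proof.
rewrite [LHS]ind_LE; transitivity (ind_pi c X (\big[@ITadd R k/ITzero R k]_(i < k)
   ITscale (X i j) (ITgen R i))); first by apply/ind_piP; exact: IE_zero.
rewrite (big_morph (ind_pi c X) (id1 := 0) (op1 := +%R)) //; last first.
  by move=> x y; rewrite -ind_piD.
by apply: eq_bigr => i _; rewrite [RHS]ind_piZ.
Qed.

Lemma ind_mod_ind (P : set M) : is_submod P -> (forall j, P (u_ j)) -> P = setT.
Proof.
move=> [P0 lP oP] Pu; apply/seteqP; split=> // v _; rewrite -[v]ind_piK.
elim: (repr _) => [j||x IHx y IHy|a x IHx|n x IHx].
- exact: Pu.
- exact: P0.
- by rewrite -ind_piD -[ind_pi _ _ x]scale1r; exact: lP.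
- by rewrite -ind_piZ -[_ *: _]addr0; exact: lP.
- by have := oP n _ IHx; rewrite /= ind_LE.
Qed.

Lemma ind_hom_eq (N : opmod R int) (f g : M -> N) : is_hom f -> is_hom g ->
  (forall j, f (u_ j) = g (u_ j)) -> f =1 g.
Proof.
move=> hf hg e v; have : [set v | f v = g v] v; last by [].
rewrite (@ind_mod_ind [set v | f v = g v]) //; split=> /=.
- by rewrite !hom0.
- by move=> a x y /= ex ey; rewrite hf.1 hg.1 ex ey.
- by move=> i x /= ex; rewrite hf.2 hg.2 ex.
Qed.

Section Lift.
Variables (N : opmod R int) (g : 'I_k -> N).
Hypotheses (vN : vir_rel c N) (gpos : forall n j, 0 < n -> op n (g j) = 0)
  (gzero : forall j, op 0 (g j) = \sum_i X i j *: g i).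

(** The universal property of the presentation: vectors [g j] subject to the relations of the
    generators determine a homomorphism. *)
Fixpoint tlift (x : ind_term R k) : N :=
  match x with
  | ITgen j => g j
  | ITzero => 0
  | ITadd x y => tlift x + tlift y
  | ITscale a x => a *: tlift x
  | ITL n x => op n (tlift x)
  end.

Lemma tlift_eq x y : ind_eq c X x y -> tlift x = tlift y.
Proof.
move=> H; elim: x y / H => //=; try by move=> *; congruence.
- by move=> x y z; rewrite addrA.
- by move=> x y; rewrite addrC.
- by move=> x; rewrite add0r.
- by move=> x; rewrite scaleN1r addNr.
- by move=> a b x; rewrite scalerA.
- by move=> x; rewrite scale1r.
- by move=> a x y; rewrite scalerDr.
- by move=> a b x; rewrite scalerDl.
- by move=> n x y; rewrite linearD.
- by move=> n a x; rewrite linearZ.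
- by move=> j; rewrite gzero (big_morph tlift (id1 := 0) (op1 := +%R)).
Qed.

Definition ilift (v : M) : N := tlift (repr (v : ind_car c X)).

Lemma ilift_pi x : ilift (ind_pi c X x) = tlift x.
Proof. by apply: tlift_eq; exact: ind_repr. Qed.

Lemma ilift_hom : is_hom ilift.
Proof.
split=> [a u v|n u]; rewrite -[u]ind_piK.
  by rewrite -[v]ind_piK ind_piZ ind_piD !ilift_pi.
by rewrite [op n _]ind_LE !ilift_pi.
Qed.

Lemma ilift_gen j : ilift (u_ j) = g j.
Proof. exact: ilift_pi. Qed.
End Lift.

(** The component of degree l, defined on formal expressions; it passes to the quotient because all
    relations are homogeneous. As L_n lowers the degree by n, it takes the component of degree l + n
    to that of degree l. *)
Fixpoint tproj (x : ind_term R k) (l : int) : M :=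
  match x with
  | ITgen j => if l == 0 then u_ j else 0
  | ITzero => 0
  | ITadd x y => tproj x l + tproj y l
  | ITscale a x => a *: tproj x l
  | ITL n x => op n (tproj x (l + n))
  end.

Lemma tproj_eq x y : ind_eq c X x y -> tproj x =1 tproj y.
Proof.
move=> H; elim: x y / H => //=.
- by move=> x y _ IH l; rewrite IH.
- by move=> y x z _ IH1 _ IH2 l; rewrite IH1.
- by move=> x x' y y' _ IH1 _ IH2 l; rewrite IH1 IH2.
- by move=> a x x' _ IH l; rewrite IH.
- by move=> a x x' _ IH l; rewrite IH.
- by move=> x y z l; rewrite addrA.
- by move=> x y l; rewrite addrC.
- by move=> x l; rewrite add0r.
- by move=> x l; rewrite scaleN1r addNr.
- by move=> a b x l; rewrite scalerA.
- by move=> x l; rewrite scale1r.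
- by move=> a x y l; rewrite scalerDr.
- by move=> a b x l; rewrite scalerDl.
- by move=> n x y l; rewrite linearD.
- by move=> n a x l; rewrite linearZ.
- move=> m n x l; rewrite [l + n + m]addrAC [l + (m + n)]addrA vir_ind.
  congr (_ + (_ + _)); rewrite /cen; case: eqP => [mn|_]; last by rewrite !scale0r.
  by rewrite -addrA mn addr0.
- by move=> n j n0 l; case: ifP => _; [exact: ind_gen_pos|rewrite linear0].
- move=> j l; rewrite (big_morph (tproj^~ l) (id1 := 0) (op1 := +%R)) //= addr0.
  case: ifP => _; first exact: ind_gen_zero.
  by rewrite linear0 big1 // => i _; rewrite scaler0.
Qed.

Definition gproj (l : int) (v : M) : M := tproj (repr (v : ind_car c X)) l.

Lemma gproj_pi l x : gproj l (ind_pi c X x) = tproj x l.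
Proof. by apply: tproj_eq; exact: ind_repr. Qed.

Lemma gproj_linear l a u v : gproj l (a *: u + v) = a *: gproj l u + gproj l v.
Proof. by rewrite -[u]ind_piK -[v]ind_piK ind_piZ ind_piD !gproj_pi. Qed.

Lemma gproj_op l n u : gproj l (op n u) = op n (gproj (l + n) u).
Proof. by rewrite -[u]ind_piK [op n _]ind_LE !gproj_pi. Qed.

Lemma gproj_gen l j : gproj l (u_ j) = if l == 0 then u_ j else 0.
Proof. exact: gproj_pi. Qed.

Lemma gproj_word l w j : gproj l (wact w (u_ j)) =
  if wsum w == - l then wact w (u_ j) else 0.
Proof.
elim: w l => [|a w IH] l /=.
  by rewrite gproj_gen /wsum big_nil [0 == _]eq_sym oppr_eq0.
rewrite gproj_op IH wsum_cons (_ : (wsum w == - (l + a)) = (a + wsum w == - l)).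
  by case: ifP => // _; rewrite linear0.
by apply/eqP/eqP; lia.
Qed.

Lemma degree_gproj l v : degree (range u_) l v -> gproj l v = v.
Proof.
rewrite /degree; move: v; apply: span_min.
  split; first by have := gproj_linear l (-1) 0 0; rewrite scaleN1r addNr scaleN1r addNr.
  by move=> a x y; rewrite gproj_linear => -> ->.
by move=> _ [w [_ [sw [j _ <-] ->]]]; rewrite gproj_word /wsum sw eqxx.
Qed.

Lemma degree_gproj0 l l' v : l != l' -> degree (range u_) l v -> gproj l' v = 0.
Proof.
move=> ll'; rewrite /degree; move: v; apply: span_min.
  by apply: linset_eq0; exact: gproj_linear.
move=> _ [w [_ [sw [j _ <-] ->]]]; rewrite gproj_word /wsum sw.
by rewrite eqr_opp (negbTE ll').
Qed.

(** The PBW filtration in one degree: d is the letter sum, hence minus the degree, and the number of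
    letters is strictly less than m. *)
Definition pspan (d : int) (m : nat) : set M := span [set v | exists w j,
  [/\ good w, wsum w = d, (size w < m)%N & v = wact w (u_ j)]].

Lemma pspan_mono d m m' v : (m <= m')%N -> pspan d m v -> pspan d m' v.
Proof.
move=> mm'; apply: span_mono => {v}v [w [j [gw sw lw ->]]].
by exists w, j; split=> //; exact: leq_trans mm'.
Qed.

Lemma pspan_lin d m : linset (pspan d m). Proof. exact: span_linset. Qed.

Lemma linset_op (P : set M) n : linset P -> linset [set v | P (op n v)].
Proof. by move=> lP; apply: (linset_preim _ lP) => a x y; rewrite linearP. Qed.

Lemma pspan_word w j m : good w -> (size w < m)%N -> pspan (wsum w) m (wact w (u_ j)).
Proof. by move=> gw sw; apply: sub_span; exists w, j. Qed.

(** Moving L_n past the letters of w costs commutators, each of which has one letter less; this is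
    [low] inside the module itself. *)
Lemma straighten n w j : good w ->
  pspan (n + wsum w) (size w).+1
    (op n (wact w (u_ j)) - (if n < 0 then wact (ins n w) (u_ j) else 0)).
Proof.
move: {2}(size w).+1 (ltnSn (size w)) => s.
elim: s n w j => // s IH n w j sw gw; have lS d m := pspan_lin d m.
case: (boolP (normal n w)) => [nn|nn].
  by have /andP[-> _] := nn; rewrite ins_normal // subrr; case: (lS (n + wsum w) (size w).+1).
case: w gw sw nn => [_ _|a w gaw sw nn].
  rewrite /normal andbT -leNgt => n0; rewrite ltNge n0 subr0 /=.
  rewrite le_eqVlt eq_sym in n0; case/orP: n0 => [/eqP ->|n0].
    rewrite ind_gen_zero; apply: linset_sum => // i _; apply: linsetZ => //.
    by rewrite add0r; exact: (@pspan_word [::] i 1).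
  by rewrite ind_gen_pos //; case: (lS (n + wsum [::]) 1%N).
have /andP[naw gw] := gaw; have /andP[a0 _] := naw.
have up d m p v : p < 0 -> (m <= s)%N -> pspan d m v -> pspan (p + d) m.+1 (op p v).
  move=> p0 ms; rewrite /pspan; apply: (span_min (linset_op p (lS (p + d) m.+1))).
  move=> _ [x [i [gx <- sx ->]]] /=; have := IH p x i (leq_trans sx ms) gx; rewrite p0 => H.
  rewrite -[op p (wact x (u_ i))](subrK (wact (ins p x) (u_ i))); apply: linsetD => //.
      exact: pspan_mono (leqW sx) H.
  by rewrite -wsum_ins; apply: pspan_word; [exact: good_ins|rewrite size_ins].
rewrite [size (a :: w)]/= wsum_cons [wact (a :: w) _]/= vir_ind.
have key : pspan (n + (a + wsum w)) (size w).+2 ((n - a)%:~R *: op (n + a) (wact w (u_ j)) +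
    cen c n a *: wact w (u_ j)).
  apply: linsetD => //; last first.
    rewrite /cen; case: eqP => [na|_]; last by rewrite scale0r; case: (lS (n + (a + wsum w)) (size w).+2).
    apply: linsetZ => //; rewrite addrA na add0r; exact: pspan_word.
  apply: linsetZ => //; rewrite addrA.
  have H := IH (n + a) w j sw gw.
  rewrite -[op (n + a) (wact w (u_ j))](subrK (if n + a < 0 then wact (ins (n + a) w) (u_ j) else 0)).
  apply: linsetD => //; first exact: pspan_mono (leqnSn _) H.
  case: ifP => na; last by case: (lS (n + a + wsum w) (size w).+2).
  by rewrite -wsum_ins; apply: pspan_word; [exact: good_ins|rewrite size_ins].
rewrite addrAC; apply: linsetD => //.
have H := up _ (size w).+1 a _ a0 sw (IH n w j sw gw).
have E : n + (a + wsum w) = a + (n + wsum w) by lia.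
rewrite E; case: ifP H => n0; rewrite linearB.
  by have [_ ->] := ins_step n0 nn.
by rewrite linear0.
Qed.

Lemma pspan_op_neg d m p v : p < 0 -> pspan d m v -> pspan (p + d) m.+1 (op p v).
Proof.
move=> p0; have lS d' m' := pspan_lin d' m'.
rewrite /pspan; apply: (span_min (linset_op p (lS (p + d) m.+1))).
move=> _ [x [i [gx <- sx ->]]] /=; have := straighten p i gx; rewrite p0 => H.
rewrite -[op p (wact x (u_ i))](subrK (wact (ins p x) (u_ i))); apply: linsetD => //.
  exact: pspan_mono (leqW sx) H.
by rewrite -wsum_ins; apply: pspan_word; [exact: good_ins|rewrite size_ins].
Qed.

Lemma pspan_op d m p v : pspan d m v -> pspan (p + d) m.+1 (op p v).
Proof.
case: (ltP p 0) => p0; first exact: pspan_op_neg.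
have lS d' m' := pspan_lin d' m'.
rewrite /pspan; apply: (span_min (linset_op p (lS (p + d) m.+1))).
move=> _ [x [i [gx <- sx ->]]] /=; have := straighten p i gx.
by rewrite ltNge p0 subr0 => H; exact: pspan_mono (leqW sx) H.
Qed.

Lemma pspan_wact w d m v : pspan d m v -> pspan (wsum w + d) (size w + m) (wact w v).
Proof.
move=> dv; elim: w => [|a w IH] /=; first by rewrite /wsum big_nil add0r add0n.
by rewrite wsum_cons -addrA addSn; exact: pspan_op.
Qed.

Lemma pspan_words w j : pspan (wsum w) (size w).+1 (wact w (u_ j)).
Proof.
rewrite -[wsum w]addr0 -addn1; apply: pspan_wact.
have -> : 0 = wsum [::] by rewrite /wsum big_nil.
exact: (@pspan_word [::] j).
Qed.

Definition isort (w : seq int) : seq int := foldr ins [::] w.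

Lemma size_isort w : size (isort w) = size w.
Proof. by elim: w => //= a w IH; rewrite size_ins IH. Qed.
Lemma wsum_isort w : wsum (isort w) = wsum w.
Proof. by elim: w => //= a w IH; rewrite wsum_ins IH wsum_cons. Qed.
Lemma good_isort w : all (fun a : int => a < 0) w -> good (isort w).
Proof. by elim: w => //= a w IH /andP[a0 /IH]; exact: good_ins. Qed.

(** Each exchange of two letters changes the vector by shorter words only: the graded algebra of the
    filtration is commutative. *)
Lemma reorder w j : all (fun a : int => a < 0) w ->
  pspan (wsum w) (size w) (wact w (u_ j) - wact (isort w) (u_ j)).
Proof.
elim: w => [_|a w IH /andP[a0 aw]] /=; first by rewrite subrr; case: (pspan_lin (wsum [::]) 0).
have {IH} H := IH aw; have lS := pspan_lin (wsum (a :: w)) (size w).+1.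
rewrite -(subrK (op a (wact (isort w) (u_ j))) (op a _)) -addrA; apply: linsetD => //.
  by rewrite -linearB wsum_cons; exact: pspan_op.
have := straighten a j (good_isort aw); rewrite a0 wsum_isort size_isort.
by rewrite wsum_cons.
Qed.

(** The spanning half of the PBW theorem; the independent half is [coord_word]. *)
Lemma ind_span v : span [set x | exists w j, good w /\ x = wact w (u_ j)] v.
Proof.
set P := span _; have -> : P = setT; last by [].
apply: ind_mod_ind => [|j]; last by apply: sub_span; exists [::], j.
split; [by case: (span_linset [set x : M | exists w j, good w /\ x = wact w (u_ j)])..|].
move=> n u; move: u; apply: (span_min (linset_op n (span_linset _))).
move=> _ [w [j [gw ->]]] /=; have := pspan_words (n :: w) j.
by apply: span_mono => _ [x [i [gx _ _ ->]]]; exists x, i.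
Qed.

End Vir.

(** * Enumeration of PBW monomials *)

Lemma good_all w : good w -> all (fun a : int => a < 0) w.
Proof. by elim: w => //= a w IH /andP[/andP[-> _] /IH]. Qed.

Lemma good_path a w : good (a :: w) -> all (fun b : int => b <= a) w.
Proof.
elim: w a => //= b w IH a /andP[/andP[a0 ba] gbw]; rewrite ba /=.
by apply: sub_all (IH _ gbw) => x /le_trans; apply.
Qed.

Lemma good_cons a w : good (a :: w) = [&& a < 0, all (fun b : int => b <= a) w & good w].
Proof.
apply/idP/and3P => [gaw|[a0 aw gw]].
  by split; [have := good_all gaw => /= /andP[]|exact: good_path|case/andP: gaw].
by rewrite /= gw andbT /normal a0; case: w aw gw => //= b w /andP[-> _].
Qed.

Lemma good_sorted w : good w -> sorted >=%O w.
Proof. by elim: w => //= a [|b w] //= IH /andP[/andP[_ ->]]. Qed.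

Lemma good_rcons w x : good (rcons w x) = [&& good w, x < 0 & all (fun a : int => x <= a) w].
Proof.
elim: w => [|a w IH]; first by rewrite /= /normal !andbT.
rewrite rcons_cons !good_cons IH /= all_rcons; apply/idP/idP.
  by move=> /and5P[-> /andP[-> ->] -> -> ->].
move=> /and3P[/and3P[-> aw ->] -> /andP[-> ->]]; rewrite aw. by [].
Qed.

Lemma good_nseq_cat n x w : x < 0 -> all (fun b : int => b <= x) w -> good w ->
  good (nseq n x ++ w).
Proof.
move=> x0 wx gw; elim: n => // n IH.
by rewrite /= -/good -[normal _ _ && _]/(good (x :: _)) good_cons x0 all_cat wx IH all_nseq lexx orbT.
Qed.

Lemma wsum_nseq n x : wsum (nseq n x) = x *+ n.
Proof. by elim: n => [|n IH]; rewrite ?mulr0n /= ?wsum_cons ?IH ?mulrS // /wsum big_nil. Qed.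

Lemma wsum_le0 w : all (fun a : int => a < 0) w -> wsum w <= - (size w)%:Z.
Proof.
elim: w => [|a w IH] /=; first by rewrite /wsum big_nil.
by move=> /andP[a0 /IH]; rewrite wsum_cons; lia.
Qed.

Lemma wsum_mem w a : all (fun a : int => a < 0) w -> a \in w -> wsum w <= a.
Proof.
elim: w => //= b w IH /andP[b0 nw]; rewrite inE wsum_cons => /predU1P[->|/(IH nw)]; last by lia.
by have := wsum_le0 nw; lia.
Qed.

Lemma wsum_extremal w : all (fun a : int => a < 0) w -> wsum w = - (size w)%:Z ->
  w = nseq (size w) (-1).
Proof.
elim: w => //= a w IH /andP[a0 nw]; rewrite wsum_cons; have := wsum_le0 nw => h1 h2.
by rewrite -IH //; [congr (_ :: _)|]; lia.
Qed.

(* the good words with letters at least -n and sum -l; N is fuel, to exceed n + l *)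
Fixpoint enum_words (N n l : nat) : seq (seq int) :=
  match N, l, n with
  | 0%N, _, _ => [::]
  | _, 0%N, _ => [:: [::]]
  | _, _, 0%N => [::]
  | N'.+1, _, n'.+1 => enum_words N' n' l ++
      (if (n <= l)%N then [seq rcons w (- n%:Z) | w <- enum_words N' n (l - n)] else [::])
  end.

Lemma mem_enum_words N n l w : (n + l < N)%N ->
  (w \in enum_words N n l) = [&& good w, all (fun a : int => - n%:Z <= a) w & wsum w == - l%:Z].
Proof.
elim: N n l w => // N IH [|n] [|l] w nlN.
- rewrite inE; apply/eqP/and3P => [->|[/good_all gw _ /eqP]]; first by rewrite /wsum big_nil.
  by have := wsum_le0 gw; case: (w) => //= a w'; lia.
- rewrite /= in_nil; apply/esym/negP => /and3P[/good_all gw aw /eqP].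
  by case: w gw aw => [|a w] /=; [rewrite /wsum big_nil; lia|move=> /andP[? _] /andP[? _]; lia].
- rewrite inE; apply/eqP/and3P => [->|[/good_all gw _ /eqP]]; first by rewrite /wsum big_nil.
  by have := wsum_le0 gw; case: (w) => //= a w'; lia.
have sN : (n.+1 + l < N)%N by lia.
rewrite [enum_words _ _ _]/= mem_cat IH; last by lia.
have -> : (w \in (if (n < l.+1)%N then
     [seq rcons w (- n.+1%:Z) | w <- enum_words N n.+1 (l.+1 - n.+1)] else [::]))
   = [&& last 0 w == - n.+1%:Z, good w, all (fun a : int => - n.+1%:Z <= a) w & wsum w == - l.+1%:Z].
  case/lastP: w => [|w x].
    rewrite /=; case: ifP => // _; apply/negP => /mapP => -[y _] /(congr1 size).
    by rewrite size_rcons.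
  rewrite last_rcons good_rcons all_rcons -cats1 wsum_cat wsum_cons /wsum big_nil addr0 -/(wsum w) cats1.
  apply/idP/idP.
    case: ifP => // nl /mapP[y]; rewrite IH; last by lia.
    move=> /and3P[gy ay /eqP sy] /eqP; rewrite eqseq_rcons => /andP[/eqP -> /eqP ->].
    rewrite eqxx gy ay sy lexx /=.
    by apply/eqP; lia.
  move=> /and4P[/eqP xn /and3P[gw _ aw] _ /eqP]; rewrite xn in aw * => sw.
  have := wsum_le0 (good_all gw) => sw0.
  have -> : (n < l.+1)%N by lia.
  apply/mapP; exists w => //; rewrite IH; last by lia.
  by rewrite gw aw; apply/eqP; lia.
apply/idP/idP.
  move=> /orP[/and3P[-> aw ->]|/and4P[_ -> -> ->]] //; rewrite andbT /=.
  by apply: sub_all aw => x; lia.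
move=> /and3P[gw aw sw]; rewrite gw aw sw !andbT /=.
case: (eqVneq (last 0 w) (- n.+1%:Z)) => /= [|lw]; first by rewrite orbT.
rewrite orbF; case/lastP: w gw aw lw {sw} => // w x.
rewrite good_rcons last_rcons => /and3P[gw x0 xw]; rewrite !all_rcons => /andP[nx nw] xn.
apply/andP; split; first by lia.
apply/allP => y yw; have := allP xw y yw; lia.
Qed.

Lemma uniq_enum_words N n l : (n + l < N)%N -> uniq (enum_words N n l).
Proof.
elim: N n l => // N IH [|n] [|l] nlN //.
rewrite [enum_words _ _ _]/= cat_uniq IH /=; last by lia.
case: ifP => nl; last by [].
rewrite map_inj_uniq ?IH ?andbT; [|lia|by move=> x y /eqP; rewrite eqseq_rcons => /andP[/eqP]].
apply/hasPn => _ /mapP[y _ ->]; rewrite mem_enum_words; last by lia.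
by rewrite all_rcons; apply/negP => /and3P[_ /andP[]]; lia.
Qed.

Definition gwords (z : int) : seq (seq int) :=
  if z <= 0 then enum_words (`|z| + `|z|).+1 `|z| `|z| else [::].

Lemma mem_gwords z w : (w \in gwords z) = good w && (wsum w == z).
Proof.
rewrite /gwords; case: ifP => z0; last first.
  apply/esym/negP => /andP[/good_all/wsum_le0 + /eqP]; lia.
rewrite mem_enum_words //; apply/and3P/andP => [[-> _]|[gw sw]].
  by rewrite (_ : - (`|z|%N : int) = z) //; lia.
split=> //; last by move: sw; lia.
by apply/allP => a aw; have := wsum_mem (good_all gw) aw; move: sw; lia.
Qed.

Lemma uniq_gwords z : uniq (gwords z).
Proof. by rewrite /gwords; case: ifP => // z0; rewrite uniq_enum_words. Qed.

(** As -1 is the largest negative letter, all letters -1 of a good word come first. *)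
Lemma good_ones w n : good w -> (n <= count_mem (-1)%R w)%N ->
  exists2 w', good w' & w = nseq n (-1) ++ w'.
Proof.
elim: n w => [|n IH] w gw nw; first by exists w.
case: w gw nw => // a w gaw nw; move: (gaw); rewrite good_cons => /and3P[a0 aw gw].
have am1 : a = -1.
  have : -1 \in a :: w by rewrite -has_pred1 has_count; apply: leq_ltn_trans nw.
  by rewrite inE => /predU1P[->//|/(allP aw)]; lia.
case: (IH w gw); first by move: nw; rewrite am1 /= add1n ltnS.
by move=> w' gw' ->; exists w'; rewrite ?am1.
Qed.

Lemma good_le_m1 w : good w -> all (fun b : int => b <= -1) w.
Proof. by move/good_all; apply: sub_all => x; lia. Qed.

Lemma good_ones_cat n w : good w -> good (nseq n (-1) ++ w).
Proof. by move=> gw; apply: good_nseq_cat => //; exact: good_le_m1. Qed.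

Lemma isort_good w : good w -> isort w = w.
Proof. by elim: w => //= a w IH /andP[naw gw]; rewrite IH // ins_normal. Qed.

(** Used for the leading term of L_w S_{r,s}, whose leading part L_w L_{-1}^n has to be sorted. *)
Lemma isort_ones n w : good w -> isort (w ++ nseq n (-1)) = nseq n (-1) ++ w.
Proof.
have insc (a : int) x : a <= -1 -> good x -> ins a (nseq n (-1) ++ x) = nseq n (-1) ++ ins a x.
  move=> a1 gx; elim: n => //= m ->; case: ifP => // a1'.
  have {a1 a1'} -> : a = -1 by lia.
  have -> : ins (-1) x = -1 :: x.
    by case: x gx => [|b x] // gx; rewrite /= (allP (good_le_m1 gx)) ?mem_head.
  by congr (_ :: _); elim: m => //= m <-.
elim: w => [|a w IH] gaw; first by rewrite cats0 isort_good // -[nseq _ _]cats0 good_ones_cat.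
rewrite /= -[isort _]/(isort (w ++ nseq n (-1))) IH; last by case/andP: gaw.
rewrite insc; last by case/andP: gaw.
  by case/andP: gaw => naw _; rewrite ins_normal.
by have := good_le_m1 gaw => /= /andP[].
Qed.

(** Deleting d letters -1 maps the words having at least d of them bijectively onto the words of
    degree l - d. This is the source of the factor 1 - q^(rs). *)
Lemma size_gwords_ones d l :
  (size [seq w <- gwords (- l%:Z) | (count_mem (-1)%R w < d)%N] +
   size (gwords (d%:Z - l%:Z)) = size (gwords (- l%:Z)))%N.
Proof.
rewrite -[RHS](count_predC (fun w => (count_mem (-1)%R w < d)%N)) size_filter; congr (_ + _)%N.
rewrite -size_filter -(size_map (cat (nseq d (-1)))); apply: perm_size.
apply: uniq_perm; rewrite ?filter_uniq ?uniq_gwords ?map_inj_uniq ?uniq_gwords //.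
  by move=> x y /eqP; rewrite eqseq_cat // eqxx => /eqP.
move=> w; rewrite mem_filter mem_gwords /= -leqNgt; apply/mapP/and3P.
  move=> [w']; rewrite mem_gwords => /andP[gw' /eqP sw'] ->.
  rewrite count_cat count_nseq /= mul1n leq_addr good_ones_cat //; split=> //.
  by rewrite wsum_cat wsum_nseq sw'; apply/eqP; lia.
move=> [dw gw /eqP sw]; have [w' gw' ew] := good_ones gw dw.
exists w' => //; rewrite mem_gwords gw' /=; apply/eqP.
by move: sw; rewrite ew wsum_cat wsum_nseq; lia.
Qed.

Section PbwWord.
Variable d : nat.
Implicit Types (f : 'I_d -> nat) (b : pbw d).

Definition flat f : seq int := flatten [seq nseq (f i) (- i.+1%:Z) | i : 'I_d].

Lemma wsum_flat f : wsum (flat f) = - (\sum_(i < d) i.+1 * f i)%N%:Z.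
Proof.
transitivity (- (\sum_(i <- enum 'I_d) i.+1 * f i)%N%:Z); last by rewrite big_enum.
rewrite /flat /image_mem; elim: (enum _) => [|i s IH]; first by rewrite big_nil /= /wsum big_nil.
rewrite /= wsum_cat IH wsum_nseq big_cons mulNrn -[in LHS](natz i.+1) -mulrnA natz.
by rewrite PoszD opprD.
Qed.

Lemma good_flat f : good (flat f).
Proof.
rewrite /flat /image_mem; have : sorted ltn (map val (enum 'I_d)) by rewrite val_enum_ord iota_ltn_sorted.
elim: (enum _) => //= i s IH /[dup] /path_sorted /IH gs.
rewrite (path_sortedE ltn_trans) => /andP[/allP is_ _].
apply: good_nseq_cat => //.
apply/allP => x /flattenP[_ /mapP[j js ->]]; rewrite mem_nseq => /andP[_ /eqP ->].
by have := is_ _ (map_f val js); rewrite /=; lia.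
Qed.

Lemma count_flat f i : count_mem (- (i : 'I_d).+1%:Z) (flat f) = f i.
Proof.
rewrite /flat count_flatten -map_comp sumnE big_map big_enum /= (bigD1 i) //=.
rewrite count_nseq /= eqxx mul1n big1 ?addn0 // => j ji; rewrite count_nseq /=.
by rewrite eqr_opp; case: eqP => // -[ij]; case/eqP: ji; exact: val_inj.
Qed.

(** Both words are sorted, and a sorted word is determined by its letter counts. *)
Lemma flat_good w : good w -> all (fun a : int => - d%:Z <= a) w ->
  w = flat (fun i => count_mem (- i.+1%:Z) w).
Proof.
move=> gw dw; apply: (sorted_eq ge_trans ge_anti); [exact: good_sorted|..].
  exact/good_sorted/good_flat.
apply/allP => x; rewrite mem_cat => xx /=; apply/eqP.
have {xx} [i ->] : exists i : 'I_d, x = - i.+1%:Z; last by rewrite count_flat.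
case/orP: xx => [xw|/flattenP[_ /mapP[j js ->]]]; last first.
  by rewrite mem_nseq => /andP[_ /eqP ->]; exists j.
have x0 := allP (good_all gw) _ xw; have xd := allP dw _ xw; rewrite /= in x0 xd.
have ltd : (`|x|.-1 < d)%N by lia.
by exists (Ordinal ltd) => /=; lia.
Qed.

Lemma good_pbw b : good (pbw_word b).
Proof. exact: good_flat. Qed.

Lemma wsum_pbw b : wsum (pbw_word b) = - d%:Z.
Proof. by rewrite [LHS](wsum_flat (fun i => val b i)) (eqP (valP b)). Qed.

Lemma pbw_word_inj : injective (@pbw_word d).
Proof.
move=> b b' e; apply/val_inj/ffunP => i; apply/val_inj => /=.
have := count_flat (fun i => val b i) i; have := count_flat (fun i => val b' i) i.
by move=> <- <-; move: e; rewrite /pbw_word /flat => ->.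
Qed.

Lemma pbw_word_surj w : good w -> wsum w = - d%:Z -> exists b : pbw d, w = pbw_word b.
Proof.
move=> gw sw; have nw := good_all gw.
have dw : all (fun a : int => - d%:Z <= a) w.
  by apply/allP => a aw; have := wsum_mem nw aw; lia.
have e := flat_good gw dw; set f := (fun i => _) in e.
have sf : (\sum_(i < d) i.+1 * f i)%N = d by move: sw; rewrite {1}e wsum_flat; lia.
have fd i : (f i < d.+1)%N.
  rewrite ltnS -[X in (_ <= X)%N]sf (bigD1 i) //=.
  by apply: leq_trans (leq_addr _ _); rewrite leq_pmull.
have bP : (\sum_(i < d) i.+1 * [ffun i => Ordinal (fd i)] i)%N == d.
  by apply/eqP; rewrite -[RHS]sf; apply: eq_bigr => i _; rewrite ffunE.
exists (exist _ [ffun i => Ordinal (fd i)] bP); rewrite {1}e /pbw_word /flat; congr flatten.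
by apply: eq_map => i; rewrite ffunE.
Qed.

Lemma size_pbw b : (size (pbw_word b) <= d)%N.
Proof. by have := wsum_le0 (good_all (good_pbw b)); rewrite wsum_pbw; lia. Qed.

Lemma size_pbw_max b : size (pbw_word b) = d -> pbw_word b = nseq d (-1).
Proof.
move=> sb; rewrite -[in RHS]sb; apply: wsum_extremal; last by rewrite wsum_pbw sb.
exact: good_all (good_pbw b).
Qed.

Lemma uact_pbw (R : comUnitRingType) (M : opmod R int) (S : {ffun pbw d -> R}) (v : M) :
  uact (pbw_elt S) v = \sum_b S b *: wact (pbw_word b) v.
Proof. by rewrite /uact /pbw_elt big_map big_enum. Qed.

End PbwWord.

(** * Verma modules and singular vectors *)

Lemma wact_hom (R : comUnitRingType) (M N : opmod R int) (f : M -> N) w v :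
  is_hom f -> f (wact w v) = wact w (f v).
Proof. by move=> hf; elim: w => //= a w IH; rewrite hf.2 IH. Qed.

Lemma uact_hom (R : comUnitRingType) (M N : opmod R int) (f : M -> N) y v :
  is_hom f -> f (uact y v) = uact y (f v).
Proof.
move=> hf; rewrite /uact hom_sum //; apply: eq_bigr => x _.
by rewrite homZ // wact_hom.
Qed.

Lemma wact_submod (R : comUnitRingType) (M : opmod R int) (P : set M) w v :
  is_submod P -> P v -> P (wact w v).
Proof. by move=> [_ _ oP] Pv; elim: w => //= a w IH; exact: oP. Qed.

Lemma uact_submod (R : comUnitRingType) (M : opmod R int) (P : set M) y v :
  is_submod P -> P v -> P (uact y v).
Proof.
move=> sP Pv; have lP : linset P by case: sP.
by apply: linset_sum => // x _; apply: linsetZ => //; exact: wact_submod.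
Qed.

Lemma wact_cat (R : comUnitRingType) (M : opmod R int) w w' (v : M) :
  wact (w ++ w') v = wact w (wact w' v).
Proof. by rewrite /wact foldr_cat. Qed.

Lemma wact_linear (R : comUnitRingType) (M : opmod R int) w a (u v : M) :
  wact w (a *: u + v) = a *: wact w u + wact w v.
Proof. by elim: w => //= n w ->; rewrite linearP. Qed.

Lemma wact0 (R : comUnitRingType) (M : opmod R int) w : wact w (0 : M) = 0.
Proof. by elim: w => //= n w ->; rewrite linear0. Qed.

Lemma wactB (R : comUnitRingType) (M : opmod R int) w (u v : M) :
  wact w (u - v) = wact w u - wact w v.
Proof. by elim: w => //= n w ->; rewrite linearB. Qed.

Lemma wact_sum (R : comUnitRingType) (M : opmod R int) w (I : Type) (s : seq I)
    (P : pred I) (F : I -> M) :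
  wact w (\sum_(i <- s | P i) F i) = \sum_(i <- s | P i) wact w (F i).
Proof.
apply: (big_morph (wact w)); last exact: wact0.
by move=> u v; rewrite -[u]scale1r wact_linear !scale1r.
Qed.

Lemma wactZ (R : comUnitRingType) (M : opmod R int) w a (u : M) :
  wact w (a *: u) = a *: wact w u.
Proof. by rewrite -[a *: u]addr0 wact_linear wact0 addr0. Qed.

Section Expand.
Variables (R : comUnitRingType) (c : R) (k : nat) (X : 'M[R]_k).
Local Notation M := (ind_mod c X).
Local Notation u_ := (ind_gen c X).

Lemma coord0 w j : coord w j (0 : M) = 0.
Proof. by have := coord_linear w j 1 (0 : M) 0; rewrite scaler0 addr0 mul1r => /esym/eqP;
  rewrite -[X in _ == X]addr0 (inj_eq (addrI _)) => /eqP. Qed.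

Lemma coord_sum w j (I : Type) (s : seq I) (P : pred I) (F : I -> M) :
  coord w j (\sum_(i <- s | P i) F i) = \sum_(i <- s | P i) coord w j (F i).
Proof.
apply: (big_morph (coord w j)); last exact: coord0.
by move=> u v; rewrite -[u]scale1r coord_linear mul1r scale1r.
Qed.

Lemma coordZ w j a (v : M) : coord w j (a *: v) = a * coord w j v.
Proof. by rewrite -[a *: v]addr0 coord_linear coord0 addr0. Qed.

Lemma coord_pspan e m w j (v : M) : (m <= size w)%N -> pspan e m v -> coord w j v = 0.
Proof.
move=> mw; rewrite /pspan; move: v; apply: span_min.
  split; first exact: coord0.
  by move=> a u v; rewrite coord_linear => -> ->; rewrite mulr0 addr0.
move=> _ [x [i [gx _ sx ->]]]; rewrite /= coord_word //; case: eqP => // xw.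
by move: sx; rewrite xw ltnNge mw.
Qed.

Lemma gproj0 l : gproj l (0 : M) = 0.
Proof. by have := gproj_linear l (-1) (0 : M) 0; rewrite scaleN1r addNr scaleN1r addNr. Qed.

Lemma gprojZ l a (v : M) : gproj l (a *: v) = a *: gproj l v.
Proof. by rewrite -[a *: v]addr0 gproj_linear gproj0 addr0. Qed.

Lemma gproj_sum l (I : Type) (s : seq I) (P : pred I) (F : I -> M) :
  gproj l (\sum_(i <- s | P i) F i) = \sum_(i <- s | P i) gproj l (F i).
Proof.
apply: (big_morph (gproj l)); last exact: gproj0.
by move=> u v; rewrite -[u]scale1r gproj_linear !scale1r.
Qed.

Lemma gproj_expand l (v : M) : gproj l v =
  \sum_(w <- gwords (- l)) \sum_j coord w j v *: wact w (u_ j).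
Proof.
have := ind_span v; move: v; apply: span_min.
  split; [|move=> a u v].
    rewrite big1 => [|w _]; last by rewrite big1 // => j _; rewrite coord0 scale0r.
    exact: gproj0.
  rewrite /= gproj_linear => -> ->; rewrite scaler_sumr -big_split; apply: eq_bigr => w _ /=.
  rewrite scaler_sumr -big_split; apply: eq_bigr => j _ /=.
  by rewrite coord_linear scalerDl scalerA.
move=> _ [w0 [j0 [gw0 ->]]]; rewrite /= gproj_word.
have E w : \sum_j coord w j (wact w0 (u_ j0) : M) *: wact w (u_ j) =
    if w == w0 then wact w0 (u_ j0) else 0.
  case: eqP => [->|ww0].
    rewrite (bigD1 j0) //= coord_word // !eqxx scale1r big1 ?addr0 // => j jj0.
    by rewrite coord_word // eqxx eq_sym (negbTE jj0) scale0r.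
  rewrite big1 // => j _; rewrite coord_word //; case: eqP => [e|]; last by rewrite scale0r.
  by case: ww0.
rewrite (eq_bigr _ (fun w _ => E w)) -big_mkcond /=.
case: ifP => sw0.
  by rewrite (big_rem w0) ?mem_gwords ?gw0 //= eqxx big_seq_cond big1 ?addr0 // => w
    /andP[]; rewrite mem_rem_uniq ?uniq_gwords // inE /= => /andP[/negbTE ->].
rewrite big_seq_cond big1 // => w /andP[+ /eqP ww0].
by rewrite mem_gwords ww0 sw0 andbF.
Qed.

(** Letters of good words are negative, so only degrees l >= 0 occur. *)
Lemma ind_comp_sum (v : M) : exists n : nat, forall m, (n <= m)%N ->
  v = \sum_(l < m) gproj l%:Z v.
Proof.
have := ind_span v; move: v; apply: span_min.
  split; first by exists 0%N => m _; rewrite big1 // => l _; rewrite gproj0.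
  move=> a u v [n Hn] [n' Hn']; exists (maxn n n') => m; rewrite geq_max => /andP[nm n'm].
  rewrite {1}(Hn m nm) {1}(Hn' m n'm) scaler_sumr -big_split.
  by apply: eq_bigr => l _; rewrite gproj_linear.
move=> _ [w [j [gw ->]]]; exists `|wsum w|%N.+1 => m wm.
have ws := wsum_le0 (good_all gw).
rewrite (bigD1 (Ordinal wm)) //= gproj_word.
have -> : wsum w == - (`|wsum w|%N%:Z) by apply/eqP; lia.
rewrite big1 ?addr0 // => l /eqP ll; rewrite gproj_word; case: eqP => // wl; case: ll.
by apply: val_inj => /=; lia.
Qed.

End Expand.

Section Verma.
Variables (R : comUnitRingType) (c h : R).

Lemma ind_gen_hwv j : ind_gen c (h%:M : 'M[R]_1) j = hwv c h.
Proof. by rewrite [j]ord1. Qed.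

Lemma hwv_zero : op 0 (hwv c h) = h *: hwv c h.
Proof. by rewrite /hwv ind_gen_zero big_ord1 mxE eqxx mulr1n. Qed.

Lemma hwv_pos n : 0 < n -> op n (hwv c h) = 0.
Proof. exact: ind_gen_pos. Qed.

Definition vlift (M : opmod R int) (x : M) : Verma c h -> M := ilift (fun _ => x).

Section VLift.
Variables (M : opmod R int) (x : M).
Hypotheses (vM : vir_rel c M) (xpos : forall n, 0 < n -> op n x = 0)
  (xzero : op 0 x = h *: x).

Let xz (j : 'I_1) : op 0 x = \sum_i (h%:M : 'M[R]_1) i j *: x.
Proof. by rewrite xzero big_ord1 mxE [j]ord1 eqxx mulr1n. Qed.

Lemma vlift_hom : is_hom (vlift x).
Proof. by apply: ilift_hom => // n j; exact: xpos. Qed.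

Lemma vlift_hwv : vlift x (hwv c h) = x.
Proof. by rewrite /vlift /hwv ilift_gen // => n j; exact: xpos. Qed.
End VLift.

Lemma verma_span (v : Verma c h) :
  span [set x | exists w, good w /\ x = wact w (hwv c h)] v.
Proof.
have := ind_span v; apply: span_mono => _ [w [j [gw ->]]].
by exists w; rewrite ind_gen_hwv.
Qed.

Lemma range_gen : range (ind_gen c (h%:M : 'M[R]_1)) = [set hwv c h].
Proof.
apply/seteqP; split=> [_ [j _ <-]|_ ->] /=; first exact: ind_gen_hwv.
by exists ord0.
Qed.
End Verma.

Lemma degree_proj (R : comUnitRingType) (M N : opmod R int) (f : M -> N) (E : set M) l v :
  is_hom f -> degree E l v -> degree (f @` E) l (f v).
Proof.
move=> hf; rewrite /degree; move: v; apply: span_min.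
  by apply: (linset_preim hf.1); exact: span_linset.
move=> _ [w [e [sw Ee ->]]] /=; rewrite wact_hom //; apply: sub_span.
by exists w, (f e); split=> //; exists e.
Qed.

Lemma degree_lift (R : comUnitRingType) (M N : opmod R int) (f : M -> N) (E : set M) l v :
  is_hom f -> degree (f @` E) l v -> exists2 u, degree E l u & f u = v.
Proof.
move=> hf; rewrite /degree; move: v; apply: span_min.
  split; first by exists 0; [case: (span_linset [set v : M | exists w e,
     [/\ \sum_(n <- w) n = - l, E e & v = wact w e]])|exact: hom0].
  move=> a _ _ [u Eu <-] [v Ev <-]; exists (a *: u + v); last by rewrite hf.1.
  by case: (span_linset [set v : M | exists w e,
     [/\ \sum_(n <- w) n = - l, E e & v = wact w e]]) => _; apply.
move=> _ [w [_ [sw [e Ee <-] ->]]]; exists (wact w e); last by rewrite wact_hom.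
by apply: sub_span; exists w, e.
Qed.

(** * The submodule generated by a singular vector, and a PBW basis of the quotient *)

Section Singular.
Variables (K : fieldType) (c h : K) (d : nat) (S : {ffun pbw d -> K}).
Local Notation v0 := (hwv c h).
Let s1 := uact (pbw_elt S) v0.
Hypotheses (S1 : forall b, pbw_word b = nseq d (-1) -> S b = 1)
  (Spos : forall n : int, 0 < n -> op n s1 = 0).

Lemma good_ones_nil : good (nseq d (-1)).
Proof. by rewrite -[nseq _ _]cats0 good_ones_cat. Qed.

(** L_{-1}^d is the only PBW monomial of degree d with d factors, and its coefficient in s1 is 1. *)
Lemma singular_lead : @pspan _ c _ (h%:M : 'M[K]_1) (- d%:Z) d (s1 - wact (nseq d (-1)) v0).
Proof.
have [|b0 eb0] := pbw_word_surj (d := d) good_ones_nil.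
  by rewrite wsum_nseq mulNrn natz.
rewrite /s1 uact_pbw (bigD1 b0) //= S1 // scale1r -eb0 addrAC subrr add0r.
apply: linset_sum; first exact: pspan_lin.
move=> b bb0; apply: linsetZ; first exact: pspan_lin.
rewrite -(wsum_pbw b) /v0; apply: pspan_word; first exact: good_pbw.
rewrite ltn_neqAle size_pbw andbT; apply: contra bb0 => /eqP/size_pbw_max e.
by apply/eqP/pbw_word_inj; rewrite e.
Qed.

(** L_w s1 is L_w L_{-1}^d up to shorter words, and sorting the latter moves L_{-1}^d to the front,
    again up to shorter words. *)
Lemma singular_word_lead w : good w ->
  @pspan _ c _ (h%:M : 'M[K]_1) (wsum w - d%:Z) (size w + d)
    (wact w s1 - wact (nseq d (-1) ++ w) v0).
Proof.
move=> gw; have lP := @pspan_lin _ c _ (h%:M : 'M[K]_1) (wsum w - d%:Z) (size w + d).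
rewrite -(subrK (wact w (wact (nseq d (-1)) v0)) (wact w s1)) -addrA.
apply: linsetD => //; first by rewrite -wactB; apply: pspan_wact; exact: singular_lead.
rewrite -wact_cat -(isort_ones d gw).
have := @reorder _ c _ (h%:M : 'M[K]_1) (w ++ nseq d (-1)) ord0.
rewrite wsum_cat wsum_nseq mulNrn natz size_cat size_nseq; apply.
by rewrite all_cat good_all // all_nseq orbT.
Qed.

Lemma singular_zero : op 0 s1 = (h + d%:R) *: s1.
Proof.
rewrite /s1 uact_pbw linear_sum scaler_sumr; apply: eq_bigr => b _.
rewrite linearZ scalerA [_ * S b]mulrC -scalerA; congr (_ *: _).
have H w : op 0 (wact w v0) = (h - (wsum w)%:~R) *: wact w v0.
  elim: w => [|a w IH] /=; first by rewrite hwv_zero /wsum big_nil subr0.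
  rewrite vir_ind cen0 scale0r addr0 IH linearZ !add0r wsum_cons.
  rewrite -scalerDl; congr (_ *: _).
  by rewrite rmorphN rmorphD /=; ring.
by rewrite H wsum_pbw rmorphN /= opprK.
Qed.

Let psi : Verma c (h + d%:R) -> Verma c h := vlift s1.

Lemma psi_hom : is_hom psi.
Proof. by apply: vlift_hom => //; [exact: vir_ind|exact: singular_zero]. Qed.

Lemma psi_hwv : psi (hwv c (h + d%:R)) = s1.
Proof. by apply: vlift_hwv => //; [exact: vir_ind|exact: singular_zero]. Qed.

(** The submodule is the image of the Verma module M(c,h+d), so its elements have PBW expansions in
    the L_w s1. *)
Lemma gen_singular : gen [set s1] = range psi.
Proof.
apply/seteqP; split.
  apply: gen_min; first exact: im_is_submod psi_hom.
  by move=> _ ->; exists (hwv c (h + d%:R)) => //; exact: psi_hwv.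
have sg := gen_is_submod [set s1].
move=> _ [v _ <-].
have : [set u | gen [set s1] (psi u)] v; last by [].
rewrite (@ind_mod_ind _ _ _ _ [set u | gen [set s1] (psi u)]) //.
  exact: (preim_is_submod psi_hom sg).
by move=> j; rewrite /= ind_gen_hwv psi_hwv; exact: gen_sub.
Qed.

Lemma gproj_psi l v : gproj l (psi v) = psi (gproj (l - d%:Z) v).
Proof.
have := verma_span v; move: v; apply: span_min.
  split; first by rewrite /= (hom0 psi_hom) !gproj0 (hom0 psi_hom).
  by move=> a u v; rewrite /= psi_hom.1 !gproj_linear psi_hom.1 => -> ->.
move=> _ [w [gw ->]] /=.
have sw : psi (wact w (hwv c (h + d%:R))) =
    \sum_b S b *: wact (w ++ pbw_word b) v0.
  rewrite (wact_hom _ _ psi_hom) psi_hwv /s1 uact_pbw wact_sum.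
  by apply: eq_bigr => b _; rewrite wactZ wact_cat.
rewrite gproj_word; transitivity (if wsum w == - (l - d%:Z) then
    psi (wact w (hwv c (h + d%:R))) else 0); last by case: ifP => // _; rewrite (hom0 psi_hom).
rewrite sw gproj_sum.
have -> : (wsum w == - (l - d%:Z)) = (wsum w - d%:Z == - l) by apply/eqP/eqP; lia.
have E b : gproj l (S b *: wact (w ++ pbw_word b) v0) =
    if wsum w - d%:Z == - l then S b *: wact (w ++ pbw_word b) v0 else 0.
  rewrite gprojZ gproj_word wsum_cat wsum_pbw.
  by case: ifP; rewrite ?scaler0.
rewrite (eq_bigr _ (fun b _ => E b)); case: ifP => // _; exact: big1.
Qed.

(* PBW words w with fewer than d letters -1 are a basis modulo s1: the leading
   term of w s1 is L_{-1}^d w. *)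
Definition rwords (l : nat) : seq (seq int) :=
  [seq w <- gwords (- l%:Z) | (count_mem (-1)%R w < d)%N].

(** Otherwise the combination is [psi y] with y <> 0. At a longest word w2 of y, the coordinate of
    [psi y] along L_{-1}^d L_{w2} is the coefficient of w2 in y, which is nonzero; but that word has
    at least d letters -1 and cannot occur in the combination. *)
Lemma rwords_free l (a : seq int -> K) :
  gen [set s1] (\sum_(w <- rwords l) a w *: wact w v0) ->
  forall w, w \in rwords l -> a w = 0.
Proof.
set x := \sum_(_ <- _) _ => gx.
have ur : uniq (rwords l) by rewrite filter_uniq ?uniq_gwords.
have gr w : w \in rwords l -> good w by rewrite mem_filter mem_gwords => /and3P[].
have cx w : good w -> coord w ord0 x = if w \in rwords l then a w else 0.
  move=> gw; rewrite /x coord_sum big_seq.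
  rewrite (eq_bigr (fun w' => if w' == w then a w' else 0)); last first.
    move=> w' w'r; rewrite coordZ /v0 coord_word ?gr // eqxx andbT.
    by case: eqP; rewrite ?mulr1 ?mulr0.
  rewrite -big_seq -big_mkcond /=; case: ifP => wr.
    rewrite (big_rem w) //= eqxx big_seq_cond big1 ?addr0 // => w' /andP[].
    by rewrite mem_rem_uniq // inE /= => /andP[/negbTE ->].
  rewrite big_seq_cond big1 // => w' /andP[w'r /eqP e].
  by rewrite -e w'r in wr.
have x0 : x = 0; last first.
  by move=> w wr; have := cx w (gr _ wr); rewrite x0 coord0 wr.
move: gx; rewrite gen_singular => -[y0 _ y0x].
have xl : gproj l%:Z x = x.
  rewrite /x gproj_sum big_seq [RHS]big_seq; apply: eq_bigr => w wr.
  rewrite gprojZ gproj_word.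
  by move: wr; rewrite mem_filter mem_gwords => /and3P[_ _ ->].
(* x is homogeneous, so y0 may be replaced by one homogeneous component, supported on a finite list
   of words. *)
pose y := gproj (l%:Z - d%:Z) y0.
have yx : psi y = x by rewrite -gproj_psi y0x xl.
pose p (w : seq int) := coord w ord0 y0.
pose G := gwords (- (l%:Z - d%:Z)).
have yE : y = \sum_(w <- G) p w *: wact w (hwv c (h + d%:R)).
  rewrite /y gproj_expand; apply: eq_bigr => w _; by rewrite big_ord1.
case: (pselect (exists2 w, w \in G & p w != 0)) => [[w1 w1G pw1]|np]; last first.
  rewrite -yx yE big_seq big1 ?(hom0 psi_hom) // => w wG.
  have [->|pw] := eqVneq (p w) 0; first by rewrite scale0r.
  by case: np; exists w.
(* [P n]: a word of length n has a nonzero coefficient in y. The largest such n gives w2. *)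
pose P n := [exists i : 'I_(size G), (p (nth [::] G i) != 0) && (size (nth [::] G i) == n)].
have exP : exists n, P n.
  exists (size w1); apply/existsP; have iw : (index w1 G < size G)%N by rewrite index_mem.
  by exists (Ordinal iw); rewrite /= nth_index // pw1 eqxx.
have bP n : P n -> (n <= \max_(w <- G) size w)%N.
  by move=> /existsP[i /andP[_ /eqP <-]]; rewrite (big_rem (nth [::] G i)) ?mem_nth //= leq_maxl.
have [n /existsP[i /andP[pi /eqP si]] maxn] := ex_maxnP exP bP.
set w2 := nth [::] G i in pi si.
have w2G : w2 \in G by exact: mem_nth.
have gG w : w \in G -> good w by rewrite mem_gwords => /andP[].
have gw2 := gG _ w2G.
have szG w : w \in G -> p w != 0 -> (size w <= size w2)%N.
  move=> wG pw; rewrite si; apply: maxn; apply/existsP.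
  have iw : (index w G < size G)%N by rewrite index_mem.
  by exists (Ordinal iw); rewrite /= nth_index // pw eqxx.
have := cx _ (good_ones_cat d gw2).
rewrite mem_filter count_cat count_nseq /= mul1n ltnNge leq_addr /=.
rewrite -yx yE (hom_sum psi_hom) coord_sum.
have uG : uniq G := uniq_gwords _.
rewrite (big_rem w2) //= big_seq big1 => [|w]; last first.
  rewrite mem_rem_uniq // inE /= => /andP[ww2 wG].
  have [->|pw] := eqVneq (p w) 0; first by rewrite scale0r (hom0 psi_hom) coord0.
  rewrite (homZ _ psi_hom) coordZ (wact_hom _ _ psi_hom) psi_hwv.
  have gw := gG _ wG; have := singular_word_lead gw => /(coord_pspan ord0).
  move=> /(_ (nseq d (-1) ++ w2)); rewrite size_cat size_nseq addnC leq_add2l szG // => /(_ isT).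
  have cB u v (w' : seq int) : coord w' ord0 ((u : Verma c h) - v) = coord w' ord0 u - coord w' ord0 v.
    by rewrite -scaleN1r addrC coord_linear mulN1r addrC.
  rewrite cB => /eqP; rewrite subr_eq0 => /eqP ->.
  rewrite /v0 coord_word ?good_ones_cat // eqseq_cat // eqxx (negbTE ww2) /=.
  by rewrite mulr0.
rewrite addr0 (homZ _ psi_hom) coordZ (wact_hom _ _ psi_hom) psi_hwv.
have := singular_word_lead gw2 => /(coord_pspan ord0).
move=> /(_ (nseq d (-1) ++ w2)); rewrite size_cat size_nseq addnC leqnn => /(_ isT).
have cB u v (w' : seq int) : coord w' ord0 ((u : Verma c h) - v) = coord w' ord0 u - coord w' ord0 v.
  by rewrite -scaleN1r addrC coord_linear mulN1r addrC.
rewrite cB => /eqP; rewrite subr_eq0 => /eqP ->.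
by rewrite /v0 coord_word ?good_ones_cat // !eqxx mulr1 => /eqP; rewrite (negbTE pi).
Qed.

(** Induction on the number of letters: a word with d letters -1 is the leading term of L_{w'} s1,
    so modulo the submodule it is a combination of shorter words. *)
Lemma rwords_span l m v : @pspan _ c _ (h%:M : 'M[K]_1) (- l%:Z) m v ->
  exists a : seq int -> K,
    gen [set s1] (v - \sum_(w <- rwords l) a w *: wact w v0).
Proof.
have lg := gen_linset [set s1].
pose Q := [set v | exists a : seq int -> K,
    gen [set s1] (v - \sum_(w <- rwords l) a w *: wact w v0)].
have lP : linset Q.
  split; first by exists (fun _ => 0); rewrite big1 ?subr0; [case: lg|move=> w _; rewrite scale0r].
  move=> r u {}v [a ga] [b gb]; exists (fun w => r * a w + b w).
  have -> : \sum_(w <- rwords l) (r * a w + b w) *: wact w v0 =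
      r *: (\sum_(w <- rwords l) a w *: wact w v0) + \sum_(w <- rwords l) b w *: wact w v0.
    by rewrite scaler_sumr -big_split; apply: eq_bigr => w _; rewrite scalerDl scalerA.
  rewrite opprD addrACA -scalerBr; exact: (linsetD lg (linsetZ r lg ga) gb).
elim: m v => [|m IH] v.
  by rewrite /pspan -/(Q v); move: v; apply: (span_min lP) => v [w [j []]].
rewrite /pspan -/(Q v); move: v; apply: (span_min lP) => v [w [j [gw sw]]].
rewrite ltnS ind_gen_hwv => wm {v}->.
have ur : uniq (rwords l) by rewrite filter_uniq ?uniq_gwords.
case: (ltnP (count_mem (-1)%R w) d) => [wd|/(good_ones gw)[w' gw' e]].
  exists (fun w' => (w' == w)%:R); have wr : w \in rwords l.
    by rewrite mem_filter wd mem_gwords gw sw eqxx.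
  rewrite (big_rem w) //= eqxx scale1r big_seq_cond big1 ?addr0 ?subrr; first by case: lg.
  move=> x /andP[]; rewrite mem_rem_uniq // inE /= => /andP[/negbTE -> _ _].
  by rewrite scale0r.
have := singular_word_lead gw'; rewrite -e => H.
have : @pspan _ c _ (h%:M : 'M[K]_1) (- l%:Z) m (wact w' s1 - wact w v0).
  move: H; have -> : wsum w' - d%:Z = - l%:Z.
    by move: sw; rewrite e wsum_cat wsum_nseq mulNrn natz; lia.
  apply: pspan_mono; move: wm; rewrite e size_cat size_nseq; lia.
move/IH => [a ga]; exists (fun w => - a w).
rewrite (eq_bigr (fun w => - (a w *: wact w v0))); last by move=> x _; rewrite scaleNr.
rewrite sumrN opprK -[X in gen _ X]opprK; apply: (linsetN lg).
have gs1 : gen [set s1] s1 by move=> P; apply.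
have gs := wact_submod w' (gen_is_submod [set s1]) gs1.
set sg := \sum_(i <- _) _; rewrite (_ : - _ = wact w' s1 - wact w v0 - sg - wact w' s1).
  exact: (linsetB lg ga gs).
by rewrite opprD -[wact w' s1 - _ - _]addrA [wact w' s1 + _]addrC addrK.
Qed.

End Singular.

(** * The nilpotent endomorphism of the induced module *)

Section GeneralizedEigenspaces.
Variables (K : fieldType) (V : lmodType K) (T : {linear V -> V}).

Definition shifted (a : K) (u : V) : V := T u - a *: u.

Lemma shifted_linear a b u v : shifted a (b *: u + v) = b *: shifted a u + shifted a v.
Proof.
by rewrite /shifted linearP scalerBr scalerDr !scalerA [a * b]mulrC opprD addrACA.
Qed.

Lemma iter_shifted_linear n a b u v :
  iter n (shifted a) (b *: u + v) = b *: iter n (shifted a) u + iter n (shifted a) v.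
Proof. by elim: n => //= n ->; rewrite shifted_linear. Qed.

Lemma iter_shifted0 n a : iter n (shifted a) 0 = 0.
Proof. by elim: n => //= n ->; rewrite /shifted linear0 scaler0 subr0. Qed.

Lemma shiftedC a b u : shifted a (shifted b u) = shifted b (shifted a u).
Proof.
have E r x : T (r *: x) = r *: T x by rewrite linearZ.
have D x y : T (x - y) = T x - T y by rewrite linearB.
rewrite /shifted !D !scalerBr !E !scalerA [b * a]mulrC !opprB -!addrA.
by congr (_ + _); rewrite addrCA [in RHS]addrCA; congr (_ + _); rewrite addrC.
Qed.

Lemma iter_shiftedC n a b u :
  iter n (shifted a) (shifted b u) = shifted b (iter n (shifted a) u).
Proof. by elim: n => //= n ->; rewrite shiftedC. Qed.

Lemma gwt_lin a : linset (gwt T a).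
Proof.
split; first by exists 0%N.
move=> b u v [n un] [m vm]; exists (n + m)%N; rewrite -/(shifted a) iter_shifted_linear.
by rewrite addnC iterD un iter_shifted0 addnC iterD vm iter_shifted0 scaler0 addr0.
Qed.

Variable P : set V.
Hypotheses (lP : linset P) (TP : forall u, P u -> P (T u)).

Lemma shifted_stable a u : P u -> P (shifted a u).
Proof. by move=> Pu; apply: (linsetB lP); [exact: TP|exact: linsetZ]. Qed.

(** By induction (T - a) u is in P, and (T - b) u - (T - a) u is the nonzero multiple (a - b) u. *)
Lemma shifted_mem a b m u : a != b -> iter m (shifted a) u = 0 -> P (shifted b u) -> P u.
Proof.
move=> ab; elim: m u => [|m IH] u; first by move=> /= ->; case: lP.
rewrite iterSr => um Pu.
have Pu' : P (shifted a u).
  by apply: IH => //; rewrite shiftedC; exact: shifted_stable.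
have : P ((a - b)^-1 *: (shifted b u - shifted a u)) by apply: (linsetZ _ lP); exact: linsetB.
have -> : shifted b u - shifted a u = (a - b) *: u.
  by rewrite /shifted opprB addrC addrA subrK scalerBl.
rewrite scalerA.
by rewrite mulVf ?scale1r ?subr_eq0.
Qed.

Lemma iter_shifted_mem a b m n u : a != b -> iter m (shifted a) u = 0 ->
  P (iter n (shifted b) u) -> P u.
Proof.
move=> ab um; elim: n => //= n IH /(@shifted_mem a b m) H; apply/IH/H => //.
elim: n {IH H} => //= n IH; by rewrite iter_shiftedC IH /shifted linear0 scaler0 subr0.
Qed.

(** A stable subspace contains the generalized eigencomponents of its elements. Applying (T - lam
    n)^m kills the last component; by induction the images of the others are in P, and
    [iter_shifted_mem] removes the power of T - lam n. *)
Lemma component_mem (lam : nat -> K) (m n : nat) (x : nat -> V) : injective lam ->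
  (forall l, iter m (shifted (lam l)) (x l) = 0) ->
  P (\sum_(l < n) x l) -> forall l, (l < n)%N -> P (x l).
Proof.
move=> lam_inj; elim: n x => // n IH x xm; rewrite big_ord_recr /= => Px.
have Plt l : (l < n)%N -> P (x l).
  move=> ln; apply: (@iter_shifted_mem (lam l) (lam n) m m) => //.
    by rewrite (inj_eq lam_inj) neq_ltn ln.
  apply: (IH (fun l => iter m (shifted (lam n)) (x l))) => //.
    move=> l'; elim: (m in iter m (shifted (lam n))) => //= p IHp.
    by rewrite iter_shiftedC IHp /shifted linear0 scaler0 subr0.
  have := iter_shifted_linear m (lam n) 1 (\sum_(l < n) x l) (x n).
  rewrite xm !scale1r addr0 => E.
  have -> : \sum_(l < n) iter m (shifted (lam n)) (x l) =
      iter m (shifted (lam n)) (\sum_(l < n) x l).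
    apply/esym/(big_morph (iter m (shifted (lam n)))); last exact: iter_shifted0.
    by move=> u v; rewrite -[u]scale1r iter_shifted_linear !scale1r.
  by rewrite -E; elim: (m) => //= p; exact: shifted_stable.
move=> l; rewrite ltnS leq_eqVlt => /predU1P[->|/Plt //].
have := linsetB lP Px (linset_sum _ lP (fun i _ => Plt _ (ltn_ord i)) : P (\sum_(l < n) x l)).
by rewrite addrAC subrr add0r.
Qed.

End GeneralizedEigenspaces.

(** The case P = {0} of [iter_shifted_mem]. *)
Lemma gwt_disjoint (K : fieldType) (V : lmodType K) (T : {linear V -> V}) a b u :
  a != b -> gwt T a u -> gwt T b u -> u = 0.
Proof.
move=> ab [m um] [n un].
have l0 : linset ([set 0] : set V) by split=> // r x y /= -> ->; rewrite scaler0 addr0.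
apply: (@iter_shifted_mem _ _ T [set 0] l0 _ a b m n) => //.
by move=> x /= ->; rewrite linear0.
Qed.

Lemma gen1 (R : comUnitRingType) (M : opmod R int) (x : M) :
  gen [set x] = range (fun y => uact y x).
Proof.
apply/seteqP; split; last first.
  have gx : gen [set x] x by move=> P; apply.
  by move=> _ [y _ <-]; exact: (uact_submod y (gen_is_submod [set x]) gx).
apply: gen_min; last by move=> _ ->; exists [:: (1, [::])] => //; rewrite /uact big_seq1 scale1r.
split; first by exists [::] => //; rewrite /uact big_nil.
  move=> a _ _ [y _ <-] [y' _ <-]; exists ([seq (a * z.1, z.2) | z <- y] ++ y') => //.
  rewrite /uact big_cat big_map scaler_sumr /=; congr (_ + _).
  by apply: eq_bigr => z _; rewrite scalerA.
move=> n _ [y _ <-]; exists [seq (z.1, n :: z.2) | z <- y] => //.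
rewrite /uact big_map linear_sum; apply: eq_bigr => z _ /=.
by rewrite linearZ.
Qed.

Lemma image_is_submod (R : pzRingType) (I : Type) (M N : opmod R I) (f : M -> N) (P : set M) :
  is_hom f -> is_submod P -> is_submod (f @` P).
Proof.
move=> hf [P0 lP oP]; split; first by exists 0 => //; exact: hom0.
  by move=> a _ _ [u Pu <-] [v Pv <-]; exists (a *: u + v); [exact: lP|rewrite hf.1].
by move=> i _ [u Pu <-]; exists (op i u); [exact: oP|rewrite hf.2].
Qed.

(** * The grading of induced modules and the radical J *)

Section Grading.
Variables (R : comUnitRingType) (c : R) (k : nat) (X : 'M[R]_k).
Local Notation M := (ind_mod c X).
Local Notation u_ := (ind_gen c X).

Lemma gproj_wact l w (v : M) : gproj l (wact w v) = wact w (gproj (l + wsum w) v).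
Proof.
elim: w l => [|a w IH] l /=; first by rewrite /wsum big_nil addr0.
by rewrite gproj_op IH wsum_cons addrA.
Qed.

Lemma gproj_gproj l l' (v : M) : gproj l (gproj l' v) = if l == l' then gproj l v else 0.
Proof.
have := ind_span v; move: v; apply: span_min.
  split; first by rewrite /= !gproj0 if_same.
  move=> a u v /=; rewrite !gproj_linear => -> ->.
  by case: ifP; rewrite ?scaler0 ?addr0.
move=> _ [w [j [gw ->]]]; rewrite /= !gproj_word.
case: (eqVneq l l') => [<-|ll']; case: ifP => [sw|]; rewrite ?gproj0 ?gproj_word ?sw //.
by rewrite (eqP sw) eqr_opp eq_sym (negbTE ll').
Qed.

Lemma gproj_degree l (v : M) : degree (range u_) l (gproj l v).
Proof.
rewrite gproj_expand; apply: linset_sum_seq; first exact: span_linset.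
move=> w; rewrite mem_gwords => /andP[_ /eqP sw].
apply: linset_sum => [|j _]; first exact: span_linset.
by apply: linsetZ; [exact: span_linset|apply: sub_span; exists w, (u_ j)].
Qed.

Lemma gproj_comm k' (X' : 'M[R]_k') (f : M -> ind_mod c X') l v : is_hom f ->
  (forall l j, gproj l (f (u_ j)) = if l == 0 then f (u_ j) else 0) ->
  gproj l (f v) = f (gproj l v).
Proof.
move=> hf H; suff : [set v | forall l, gproj l (f v) = f (gproj l v)] v by apply.
rewrite (@ind_mod_ind _ _ _ _ [set v | forall l, gproj l (f v) = f (gproj l v)]) //.
  split=> /= [l'|a u v' uH vH l'|n u uH l'].
  - by rewrite !(hom0 hf, gproj0).
  - by rewrite !(hf.1, gproj_linear) uH vH.
  - by rewrite hf.2 !gproj_op hf.2 uH.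
by move=> j l' /=; rewrite H gproj_gen; case: ifP => // _; rewrite (hom0 hf).
Qed.

(** A vector is the sum of its homogeneous components, so lying in the span of nonzero degrees means
    that [gproj 0] vanishes; by linearity monomials suffice as tests. *)
Lemma Jset_iff (v : M) : Jset (range u_) v <-> forall w, gproj 0 (wact w v) = 0.
Proof.
split=> [Jv w|H y].
  have := Jv [:: (1, w)]; rewrite /uact big_seq1 scale1r; move: (wact w v).
  apply: span_min.
    by apply: linset_eq0 => a x y; exact: gproj_linear.
  by move=> x [l l0 dx] /=; exact: degree_gproj0 dx.
have E : gproj 0 (uact y v) = 0.
  by rewrite /uact gproj_sum big1 // => x _; rewrite gprojZ H scaler0.
have [n /(_ n (leqnn n)) ->] := ind_comp_sum (uact y v).
apply: linset_sum; first exact: span_linset.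
move=> [[|l] ln] _ /=; first by rewrite E; case: (span_linset
  [set u | exists2 l, l != 0 & degree (range u_) l u]).
by apply: sub_span; exists l.+1%:Z => //; exact: gproj_degree.
Qed.

Lemma Jset_is_submod : is_submod (Jset (range u_)).
Proof.
split.
- by apply/Jset_iff => w; rewrite wact0 gproj0.
- move=> a u v /Jset_iff Ju /Jset_iff Jv; apply/Jset_iff => w.
  by rewrite wact_linear gproj_linear Ju Jv scaler0 addr0.
- by move=> n u /Jset_iff Ju; apply/Jset_iff => w; have := Ju (rcons w n);
    rewrite -cats1 wact_cat.
Qed.

(** For a fixed word w only one homogeneous component of v contributes to the degree 0 part of w v,
    so J is graded. *)
Lemma Jset_gproj l (v : M) : Jset (range u_) v -> Jset (range u_) (gproj l v).
Proof.
move=> /Jset_iff Jv; apply/Jset_iff => w; rewrite gproj_wact add0r gproj_gproj.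
by case: eqP => _; [have := Jv w; rewrite gproj_wact add0r|rewrite wact0].
Qed.

Lemma Jset_degree0 j : Jset (range u_) (u_ j) -> u_ j = 0.
Proof. by move=> /Jset_iff/(_ [::]); rewrite /= gproj_gen eqxx. Qed.

End Grading.

(** * The endomorphism x - h and the projection onto the Verma module *)

Section Jordan.
Variables (K : numFieldType) (c h : K) (k : nat).
Hypothesis k0 : (0 < k)%N.
Local Notation X := (jordan_mx h k).
Local Notation M := (Mind c h k).
Local Notation u_ := (ind_gen c X).
Local Notation J := (Jset (@Mtop K c h k)).
Local Notation W := (Wmod c h k).

(* u_j for 1 <= j <= k, as in the paper, and 0 for other j *)
Definition ug (j : nat) : M :=
  if j is j'.+1 then (if insub j' is Some i then u_ i else 0) else 0.

Lemma ugS (i : 'I_k) : ug i.+1 = u_ i.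
Proof. by rewrite /ug valK. Qed.

Lemma jordan_sum_col (N : lmodType K) (G : nat -> N) (j : 'I_k) :
  \sum_(i < k) X i j *: G i = h *: G j + (if (j : nat) is j'.+1 then G j' else 0).
Proof.
rewrite (bigD1 j) //= mxE eqxx; congr (_ + _).
case ej : (j : nat) => [|j'].
  apply: big1 => i ij; rewrite mxE (negbTE ij) ej /= scale0r //.
have j'k : (j' < k)%N by apply: leq_trans (ltn_ord j); rewrite ej.
rewrite (bigD1 (Ordinal j'k)) /=; last by rewrite -val_eqE /= ej ltn_eqF.
rewrite mxE ej eqxx ifN ?scale1r; last by rewrite -val_eqE /= ej ltn_eqF.
rewrite big1 ?addr0 // => i /andP[ij ij']; rewrite mxE (negbTE ij) ej eqSS ifN ?scale0r //.
Qed.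

Lemma ug_zero j : (j <= k)%N -> op 0 (ug j) = h *: ug j + ug j.-1.
Proof.
case: j => [|j] jk; first by rewrite /= linear0 scaler0 addr0.
have -> : ug j.+1 = u_ (Ordinal jk) by rewrite -ugS.
rewrite ind_gen_zero (eq_bigr (fun i : 'I_k => X i (Ordinal jk) *: ug i.+1)) => [|i _]; last by rewrite ugS.
by rewrite (jordan_sum_col (fun i => ug i.+1)) -ugS; congr (_ + _); rewrite [nat_of_ord _]/=; clear; case: j.
Qed.

Lemma ug_pos j n : 0 < n -> op n (ug j) = 0.
Proof.
move=> n0; case: j => [|j]; rewrite /= ?linear0 //.
by case: insubP => [i _ _|_]; [exact: ind_gen_pos|rewrite linear0].
Qed.

(* x - h, extended from U(c,h,k) to M(c,h,k) *)
Definition nil_end : M -> M := ilift (fun j : 'I_k => ug j).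

Let nil_zero (j : 'I_k) : op 0 (ug j) = \sum_i X i j *: ug i.
Proof.
rewrite (jordan_sum_col ug) ug_zero; last exact: ltnW.
by case: (j : nat).
Qed.

Lemma nil_hom : is_hom nil_end.
Proof. by apply: ilift_hom => //; [exact: vir_ind|move=> n j; exact: ug_pos]. Qed.

Lemma nil_ug j : (j <= k)%N -> nil_end (ug j) = ug j.-1.
Proof.
case: j => [|j] jk; first exact: hom0 nil_hom.
rewrite -[j.+1]/(Ordinal jk).+1 ugS /nil_end ilift_gen //; first exact: vir_ind.
by move=> n i; exact: ug_pos.
Qed.

Lemma iter_nil_ug n j : (j <= k)%N -> iter n nil_end (ug j) = ug (j - n).
Proof.
move=> jk; elim: n => [|n IH]; first by rewrite subn0.
by rewrite iterS IH nil_ug ?subnS // (leq_trans (leq_subr _ _)).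
Qed.

Lemma iter_nil_k (v : M) : iter k nil_end v = 0.
Proof.
have h0 : is_hom (fun _ : M => 0 : M).
  by split=> *; rewrite ?scaler0 ?addr0 ?linear0.
apply: (ind_hom_eq (hom_iter k nil_hom) h0) => j.
rewrite -ugS iter_nil_ug; last exact: ltn_ord.
by move/eqP: (ltn_ord j) => ->.
Qed.

Lemma gproj_ug l j : gproj l (ug j) = if l == 0 then ug j else 0.
Proof.
case: j => [|j] /=; first by rewrite gproj0 if_same.
by case: insubP => [i _ _|_]; rewrite ?gproj0 ?if_same // gproj_gen.
Qed.

Lemma gproj_nil l v : gproj l (nil_end v) = nil_end (gproj l v).
Proof.
apply: (gproj_comm _ _ nil_hom) => l' j.
by rewrite -ugS nil_ug ?gproj_ug // ltn_ord.
Qed.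

Lemma nil_J (v : M) : J v -> J (nil_end v).
Proof.
move=> /Jset_iff Jv; apply/Jset_iff => w.
by rewrite -(wact_hom _ _ nil_hom) gproj_nil Jv (hom0 nil_hom).
Qed.

(** True on the generators, and it propagates because [nil_end] commutes with every L_a while L_0
    changes by -a. Thus the nilpotent part of L_0 is a module endomorphism. *)
Lemma gproj_zero l v : op 0 (gproj l v) = (h + l%:~R) *: gproj l v + nil_end (gproj l v).
Proof.
have := ind_span v; move: v; apply: span_min.
  split; first by rewrite /mkset !gproj0 linear0 scaler0 (hom0 nil_hom) addr0.
  move=> a u v; rewrite /mkset !gproj_linear linearP nil_hom.1 => -> ->.
  by rewrite !scalerDr !scalerA [(h + _) * a]mulrC addrACA.
move=> _ [w [j [gw ->]]]; rewrite /mkset gproj_word; case: eqP => [sw|_]; last first.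
  by rewrite linear0 scaler0 (hom0 nil_hom) addr0.
have H : op 0 (wact w (u_ j)) = (h - (wsum w)%:~R) *: wact w (u_ j) + nil_end (wact w (u_ j)).
  elim: w {gw sw} => [|a w IH] /=.
    rewrite /wsum big_nil subr0 -ugS ug_zero ?nil_ug //; exact: ltn_ord.
  rewrite vir_ind cen0 scale0r addr0 IH linearD linearZ !add0r wsum_cons nil_hom.2.
  rewrite addrAC -scalerDl; congr (_ *: _ + _).
  by rewrite rmorphN rmorphD /=; ring.
by rewrite H sw rmorphN opprK.
Qed.

(* the projection M(c,h,k) -> M(c,h), u_k |-> 1, u_j |-> 0 for j < k *)
Definition topmap : M -> Verma c h :=
  ilift (fun j : 'I_k => if j.+1 == k then hwv c h else 0).

Let top_zero (j : 'I_k) : op 0 (if j.+1 == k then hwv c h else 0) =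
  \sum_i X i j *: (if i.+1 == k then hwv c h else 0).
Proof.
rewrite (jordan_sum_col (fun i => if i.+1 == k then hwv c h else 0)).
have -> : (if (j : nat) is j'.+1 then if j'.+1 == k then hwv c h else 0 else 0) = 0.
  by case ej : (j : nat) => [|j'] //; rewrite -ej ltn_eqF.
by rewrite addr0; case: ifP => _; rewrite ?hwv_zero // linear0 scaler0.
Qed.

Let top_pos n (j : 'I_k) : 0 < n -> op n (if j.+1 == k then hwv c h else 0) = 0.
Proof. by move=> n0; case: ifP => _; rewrite ?hwv_pos // linear0. Qed.

Lemma top_hom : is_hom topmap.
Proof. by apply: ilift_hom => //; exact: vir_ind. Qed.

Lemma top_gen (j : 'I_k) : topmap (u_ j) = if j.+1 == k then hwv c h else 0.
Proof. by rewrite /topmap ilift_gen //; exact: vir_ind. Qed.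

Lemma top_ug : topmap (ug k) = hwv c h.
Proof.
have kk : (k.-1 < k)%N by rewrite prednK.
rewrite -(prednK k0) -[k.-1.+1]/(Ordinal kk).+1 ugS top_gen.
by rewrite /= prednK // eqxx.
Qed.

Lemma gproj_top l v : gproj l (topmap v) = topmap (gproj l v).
Proof.
apply: (gproj_comm _ _ top_hom) => l' j; rewrite top_gen.
by case: ifP => _; rewrite ?gproj0 ?if_same // /hwv gproj_gen.
Qed.

(** The quotient by the range of [nil_end] is generated by the class of u_k, a highest weight
    vector. Hence the projection to it factors through [topmap], as is checked on generators. *)
Lemma ker_top v : topmap v = 0 -> exists u, v = nil_end u.
Proof.
have rs := im_is_submod nil_hom.
have vq : vir_rel c (quo (range nil_end)) by apply: vir_quo; exact: vir_ind.
have hp := proj_hom (range nil_end).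
pose x := proj (range nil_end) (ug k).
have xpos n : 0 < n -> op n x = 0 by move=> n0; rewrite /x -hp.2 ug_pos ?(hom0 hp).
have xzero : op 0 x = h *: x.
  rewrite /x -hp.2 ug_zero // (homD hp) (homZ _ hp) [X in _ + X](_ : _ = 0) ?addr0 //.
  by apply/proj_eq0/gen_sub; exists (ug k) => //; rewrite nil_ug.
have E : vlift x \o topmap =1 proj (range nil_end).
  apply: ind_hom_eq => //; first exact: hom_comp top_hom (vlift_hom vq xpos xzero).
  move=> j; rewrite /= top_gen; case: eqP => jk.
    by rewrite vlift_hwv // /x -ugS jk.
  rewrite (hom0 (vlift_hom vq xpos xzero)); apply/esym/proj_eq0/gen_sub.
  have jk' : (j.+1 < k)%N by rewrite ltn_neqAle; apply/andP; split; [apply/eqP|exact: ltn_ord].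
  by exists (ug j.+2) => //; rewrite nil_ug // ugS.
move=> v0; have := E v; rewrite /= v0 (hom0 (vlift_hom vq xpos xzero)) => /esym/proj_eq0.
by rewrite (gen_id rs) => -[u _ <-]; exists u.
Qed.

Lemma ug1_neq0 : ug 1 <> 0.
Proof.
move=> e; have := @coord_word _ c _ X [::] (Ordinal k0) [::] (Ordinal k0) isT.
have e' : u_ (Ordinal k0) = 0 by rewrite -ugS.
by rewrite [wact _ _]/= e' coord0 !eqxx => /eqP; rewrite eq_sym oner_eq0.
Qed.

Lemma ug1_notin_J : ~ J (ug 1).
Proof.
by rewrite -[1%N]/(Ordinal k0).+1 ugS => /Jset_degree0; rewrite -ugS; exact: ug1_neq0.
Qed.

Lemma gen_J : gen J = J. Proof. exact: gen_id (@Jset_is_submod _ _ _ _). Qed.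

(** If z in J were mapped to the highest weight vector, then z would be u_k modulo the range of
    [nil_end], and [nil_end]^(k-1) would send z to u_1, which is not in J. *)
Lemma top_J_proper : topmap @` J <> setT.
Proof.
move=> e; have : (topmap @` J) (hwv c h) by rewrite e.
move=> [z Jz]; rewrite -top_ug => ez.
have [u eu] : exists u, z - ug k = nil_end u.
  by apply: ker_top; rewrite (homB top_hom) ez subrr.
apply: ug1_notin_J.
have : J (iter k.-1 nil_end z) by elim: k.-1 => //= n; exact: nil_J.
have -> : z = ug k + nil_end u by rewrite -eu addrC subrK.
rewrite (homD (hom_iter _ nil_hom)) -iterSr prednK // iter_nil_k addr0.
have kk : (k - k.-1 = 1)%N by lia.
by rewrite iter_nil_ug // kk.
Qed.

Lemma top_J_maxsub : topmap @` J `<=` maxsub (Verma c h).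
Proof.
have sJ := image_is_submod top_hom (@Jset_is_submod _ _ _ X).
by move=> v Jv; apply: gen_sub; exists (Submod sJ); split=> //; exact: top_J_proper.
Qed.

End Jordan.

(** * Submodules of W(c,h,k) and its socle *)

Lemma gproj00 (R : comUnitRingType) (c h : R) (v : Verma c h) :
  exists a, gproj 0 v = a *: hwv c h.
Proof.
exists (coord [::] ord0 v); rewrite gproj_expand oppr0 -[gwords 0]/[:: [::]] big_seq1 big_ord1.
by rewrite ind_gen_hwv.
Qed.

(** In degree d the submodule generated by the singular vector is a line, the image of degree 0 of
    M(c,h+d). So the image of z is a nonzero multiple of the singular vector. *)
Lemma top_J_full (K : numFieldType) (c h : K) (k d : nat) (S : {ffun pbw d -> K})
    (z : Mind c h k) : (0 < k)%N ->
  (forall b, pbw_word b = nseq d (-1) -> S b = 1) ->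
  (forall n : int, 0 < n -> op n (uact (pbw_elt S) (hwv c h)) = 0) ->
  maxsub (Verma c h) = gen [set uact (pbw_elt S) (hwv c h)] ->
  Jset (@Mtop K c h k) z -> gproj d%:Z (topmap z) = topmap z -> topmap z <> 0 ->
  maxsub (Verma c h) `<=` (@topmap K c h k) @` Jset (@Mtop K c h k).
Proof.
move=> k0 S1 Spos maxE Jz zd z0; rewrite maxE.
have sJ := image_is_submod (@top_hom K c h k) (@Jset_is_submod _ c _ (jordan_mx h k)).
have : maxsub (Verma c h) (topmap z) := @top_J_maxsub K c h k k0 _ (imageP _ Jz).
rewrite maxE (gen_singular Spos) => -[x _ ex].
have := gproj_psi Spos d%:Z x; rewrite ex zd subrr.
have [a ->] := gproj00 x; rewrite (homZ _ (psi_hom Spos)) (psi_hwv Spos) => ez.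
have a0 : a != 0 by apply/eqP => a0; apply: z0; rewrite ez a0 scale0r.
rewrite -(gen_singular Spos); apply: (gen_min sJ) => _ ->.
have -> : uact (pbw_elt S) (hwv c h) = a^-1 *: topmap z.
  by rewrite ez scalerA mulVf // scale1r.
have lJ : linset ((@topmap K c h k) @` Jset (@Mtop K c h k)) by case: sJ.
by apply: (linsetZ _ lJ); exists z.
Qed.

Section Wmodule.
Variables (K : numFieldType) (c h : K) (k : nat).
Hypothesis k0 : (0 < k)%N.
Local Notation M := (Mind c h k).
Local Notation J := (Jset (@Mtop K c h k)).
Local Notation W := (Wmod c h k).
Hypothesis J_full : maxsub (Verma c h) `<=` (@topmap K c h k) @` J.

Let p : M -> W := proj J.
Let hp : is_hom p := proj_hom J.

Lemma projW_eq0 v : p v = 0 <-> J v.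
Proof. by rewrite proj_eq0 gen_J. Qed.

(* x - h, acting on W = M(c,h,k) / J(c,h,k) *)
Definition fW : W -> W := qlift (p \o @nil_end K c h k).

Let nilJ v : J v -> (p \o @nil_end K c h k) v = 0.
Proof. by move=> Jv; apply/projW_eq0; exact: nil_J. Qed.

Lemma fW_hom : is_hom fW.
Proof. by apply: qlift_hom nilJ; exact: hom_comp (@nil_hom K c h k) hp. Qed.

Lemma fW_proj v : fW (p v) = p (nil_end v).
Proof. by rewrite /fW qliftE //; exact: hom_comp (@nil_hom K c h k) hp. Qed.

Lemma iter_fW_proj n v : iter n fW (p v) = p (iter n (@nil_end K c h k) v).
Proof. by elim: n => //= n ->; rewrite fW_proj. Qed.

Definition uW j : W := p (ug c h k j).

Lemma virW : vir_rel c W.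
Proof. by apply: vir_quo; exact: vir_ind. Qed.

Lemma W_gen (P : set W) : is_submod P -> (forall j, (0 < j <= k)%N -> P (uW j)) -> P = setT.
Proof.
move=> sP Pu; apply/seteqP; split=> // w _; have [v ->] := proj_surj w.
suff : [set v | P (p v)] v by [].
rewrite (@ind_mod_ind _ _ _ _ [set v | P (p v)]) //; first exact: (preim_is_submod hp sP).
by move=> j; rewrite -ugS; apply: Pu; rewrite /= ltn_ord.
Qed.

Lemma iter_fW_k w : iter k fW w = 0.
Proof. by have [v ->] := proj_surj w; rewrite -/p iter_fW_proj iter_nil_k (hom0 hp). Qed.

Lemma iter_fW_ge n w : (k <= n)%N -> iter n fW w = 0.
Proof.
move=> kn; rewrite -(subnK kn) iterD iter_fW_k.
exact: (hom0 (hom_iter (n - k) fW_hom)).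
Qed.

Lemma iter_fW_u n j : (j <= k)%N -> iter n fW (uW j) = uW (j - n).
Proof. by move=> jk; rewrite /uW iter_fW_proj iter_nil_ug. Qed.

Lemma uW1_neq0 : uW 1 <> 0.
Proof. by move/projW_eq0; exact: ug1_notin_J. Qed.

Lemma iter_fW_top : iter k.-1 fW (uW k) = uW 1.
Proof. by rewrite iter_fW_u //; congr uW; lia. Qed.

(** Let x lift w. If [topmap x] were in T(c,h), x would differ from an element of J by one of the
    range of [nil_end]. So [topmap x] lies in no proper submodule and generates M(c,h). *)
Lemma top_cyclic w : ~ (exists u, w = fW u) ->
  exists y u, uact y w = uW k + fW u.
Proof.
have [x ->] := proj_surj w; rewrite -/p => nf.
have nT : ~ maxsub (Verma c h) (topmap x).
  move=> /J_full[z Jz ez]; apply: nf.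
  have [u eu] : exists u, x - z = nil_end u.
    by apply: ker_top => //; rewrite (homB (@top_hom K c h k)) ez subrr.
  exists (p u); rewrite fW_proj -eu (homB hp).
  by move/projW_eq0: Jz => ->; rewrite subr0.
have g1 : gen [set topmap x] = setT.
  apply: contrapT => ng; apply: nT; apply: gen_sub.
  by exists (Submod (gen_is_submod [set topmap x])); split=> // P; apply.
have : gen [set topmap x] (hwv c h) by rewrite g1.
rewrite gen1 => -[y _ ey].
have [u eu] : exists u, uact y x - ug c h k k = nil_end u.
  apply: ker_top => //.
  by rewrite (homB (@top_hom K c h k)) (uact_hom _ _ (@top_hom K c h k)) ey top_ug ?subrr.
exists y, (p u); rewrite -(uact_hom _ _ hp) fW_proj -eu (homB hp).
by rewrite addrC subrK.
Qed.

(** Otherwise some y u equals u_k + f v, and f^(k-1) of this is u_1 <> 0, although f^(k-1) u = 0. *)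
Lemma range_fW u : iter k.-1 fW u = 0 -> exists v, u = fW v.
Proof.
move=> fu; apply: contrapT => /top_cyclic[y [v ey]].
have hi := hom_iter k.-1 fW_hom.
have := uact_hom y u hi; rewrite fu ey (homD hi) iter_fW_top -iterSr prednK // iter_fW_k addr0.
rewrite (_ : uact y 0 = 0); first exact: uW1_neq0.
by rewrite /uact big1 // => x _; rewrite wact0 scaler0.
Qed.

(** Induction on m: w = f^m u by the previous case, and then f^(k-1) u = 0, so [range_fW] gives one
    more factor f. *)
Lemma ker_range m w : (m <= k)%N -> iter (k - m) fW w = 0 -> exists u, w = iter m fW u.
Proof.
elim: m w => [|m IH] w mk; first by exists w.
move=> fw; have [|u eu] := IH w (ltnW mk).
  by rewrite (_ : k - m = (k - m.+1).+1)%N /= ?fw ?(hom0 fW_hom) //; lia.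
have e : (k - m.+1 + m = k.-1)%N by lia.
have [|v ev] := @range_fW u; last by exists v; rewrite eu ev -iterSr.
by move: fw; rewrite eu -iterD e.
Qed.

Lemma Wdeg_iff l x : Wdeg c h k l x <-> exists2 v, gproj l%:Z v = v & p v = x.
Proof.
split=> [/(degree_lift hp)[v dv <-]|[v dv <-]].
  by exists v => //; exact: degree_gproj.
by apply: degree_proj => //; rewrite -dv; exact: gproj_degree.
Qed.

Lemma Wdeg_lin l : linset (Wdeg c h k l).
Proof. exact: span_linset. Qed.

Lemma Wdeg_zero l x : Wdeg c h k l x -> op 0 x = (h + l%:R) *: x + fW x.
Proof.
move=> /Wdeg_iff[v dv <-]; rewrite fW_proj -hp.2 -dv gproj_zero (homD hp) (homZ _ hp).
by [].
Qed.

Lemma Wdeg_fW l x : Wdeg c h k l x -> Wdeg c h k l (fW x).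
Proof.
move=> /Wdeg_iff[v dv <-]; apply/Wdeg_iff; exists (nil_end v); last by rewrite fW_proj.
by rewrite gproj_nil dv.
Qed.

Lemma Wdeg_iter n l x : Wdeg c h k l x -> Wdeg c h k l (iter n fW x).
Proof. by move=> dx; elim: n => //= n; exact: Wdeg_fW. Qed.

Lemma Wdeg_sum w : exists n (x : nat -> W),
  (forall l, Wdeg c h k l (x l)) /\ w = \sum_(l < n) x l.
Proof.
have [v ->] := proj_surj w; have [n /(_ n (leqnn n)) vE] := ind_comp_sum v.
exists n, (fun l => p (gproj l%:Z v)); split.
  by move=> l; apply/Wdeg_iff; exists (gproj l%:Z v) => //; rewrite gproj_gproj eqxx.
by rewrite {1}vE -/p (hom_sum hp).
Qed.

Local Notation T := (op 0 : {linear W -> W}).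

Lemma Wdeg_shifted n l x : Wdeg c h k l x ->
  iter n (shifted T (h + l%:R)) x = iter n fW x.
Proof.
move=> dx; elim: n => //= n ->; rewrite /shifted (Wdeg_zero (Wdeg_iter n dx)).
by rewrite addrAC subrr add0r.
Qed.

Lemma weight_inj : injective (fun l : nat => h + l%:R : K).
Proof. by move=> l l' /addrI/eqP; rewrite eqr_nat => /eqP. Qed.

Lemma Wdeg_component (P : set W) n (x : nat -> W) : linset P ->
  (forall u, P u -> P (T u)) -> (forall l, Wdeg c h k l (x l)) ->
  P (\sum_(l < n) x l) -> forall l, (l < n)%N -> P (x l).
Proof.
move=> lP TP dx; apply: (component_mem lP TP weight_inj (m := k)) => l.
by rewrite Wdeg_shifted // iter_fW_k.
Qed.

(** A submodule contains the weight components of its elements, and on the component of weight h + l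
    the map f is L_0 - (h + l). *)
Lemma submod_fW (P : set W) w : is_submod P -> P w -> P (fW w).
Proof.
move=> [P0 lP oP] Pw; have lsP : linset P by [].
have [n [x [dx ew]]] := Wdeg_sum w.
rewrite ew (hom_sum fW_hom); apply: (linset_sum _ lsP) => l _.
have Px : P (x l).
  by apply: (Wdeg_component lsP (oP 0) dx (n := n)) => //; rewrite -ew.
have -> : fW (x l) = op 0 (x l) - (h + l%:R) *: x l.
  by rewrite (Wdeg_zero (dx l)) addrAC subrr add0r.
by apply: (linsetB lsP); [exact: oP|exact: linsetZ].
Qed.

Lemma submod_iter_fW (P : set W) n w : is_submod P -> P w -> P (iter n fW w).
Proof. by move=> sP Pw; elim: n => //= n; exact: submod_fW. Qed.

(** Take the least i with P inside ker f^i. Some v in P has f^(i-1) v <> 0 and is f^(k-i) u with u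
    outside the range of f, so [top_cyclic] puts u_i + f^(k-i+1) t into P. Then P contains im
    f^(k-j) = ker f^j for j = 0, ..., i in turn. *)
Lemma submod_chain (P : set W) : is_submod P ->
  exists2 i, (i <= k)%N & P = [set w | iter i fW w = 0].
Proof.
move=> sP; have [P0 lP oP] := sP; have lsP : linset P by [].
pose Q i := `[< P `<=` [set w | iter i fW w = 0] >].
have exQ : exists i, Q i by exists k; apply/asboolP => w _; exact: iter_fW_k.
have [i /asboolP Qi mi] := ex_minnP exQ.
have ik : (i <= k)%N by apply: mi; apply/asboolP => w _; exact: iter_fW_k.
exists i => //; apply/seteqP; split=> //.
case: i Qi mi ik => [|i] Qi mi ik; first by move=> w /= ->.
have [v Pv fv] : exists2 v, P v & iter i fW v <> 0.
  apply: contrapT => nv; have : (i.+1 <= i)%N; last by rewrite ltnn.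
  apply: mi; apply/asboolP => v Pv; apply: contrapT => fv; apply: nv; by exists v.
have [|u eu] := @ker_range (k - i.+1) v (leq_subr _ _).
  by rewrite subKn //; exact: Qi.
have [y [t ey]] : exists y t, uact y u = uW k + fW t.
  apply: top_cyclic => -[t et]; apply: fv; rewrite eu et -iterSr -iterD.
  by apply: iter_fW_ge; lia.
have Pz : P (uW i.+1 + iter (k - i) fW t).
  have hi := hom_iter (k - i.+1) fW_hom.
  have := uact_submod y sP Pv; rewrite eu -(uact_hom _ _ hi) ey (homD hi) -iterSr.
  by rewrite iter_fW_u // subKn // -subSn //.
suff H j w : (j <= i.+1)%N -> P (iter (k - j) fW w).
  move=> w /= fw; have [||w' ->] := @ker_range (k - i.+1) w; rewrite ?leq_subr ?subKn //.
  exact: H.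
elim: j w => [|j IH] w ji; first by rewrite subn0 iter_fW_k.
(* f^(i-j) turns the vector found in P into u_{j+1} + f^(k-j) t, whose second term is in P by
   induction. *)
have Pu : P (uW j.+1).
  have := submod_iter_fW (i - j) sP Pz.
  rewrite (homD (hom_iter _ fW_hom)) iter_fW_u // -iterD.
  rewrite (_ : (i.+1 - (i - j) = j.+1)%N); last by lia.
  rewrite (_ : (i - j + (k - i) = k - j)%N); last by lia.
  by move=> H; have := linsetB lsP H (IH t (ltnW ji)); rewrite addrK.
have hi := hom_iter (k - j.+1) fW_hom.
suff : [set w | P (iter (k - j.+1) fW w)] w by [].
rewrite (@W_gen [set w | P (iter (k - j.+1) fW w)]) //; first exact: (preim_is_submod hi sP).
(* u_m is f^(k-m) u_k, and f^(k-j-1) u_k = u_{j+1} is in P. *)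
move=> m /andP[m0 mk]; rewrite /= -[m]/(m)%N -(subKn mk) -iter_fW_u // -iterD addnC iterD.
rewrite iter_fW_u // subKn; last by lia.
exact: submod_iter_fW.
Qed.

Lemma gwt_Wdeg l : gwt T (h + l%:R) = Wdeg c h k l.
Proof.
apply/seteqP; split=> [w gw|w dw]; last by exists k; rewrite -/(shifted T _) Wdeg_shifted // iter_fW_k.
have [n [x [dx ew]]] := Wdeg_sum w; rewrite ew.
have gT u : gwt T (h + l%:R) u -> gwt T (h + l%:R) (T u).
  move=> [m um]; exists m; rewrite -/(shifted T (h + l%:R)).
  have -> : T u = shifted T (h + l%:R) u + (h + l%:R) *: u by rewrite subrK.
  rewrite -[shifted _ _ _]scale1r iter_shifted_linear scale1r iter_shiftedC.
  rewrite -[X in _ + iter _ _ X]addr0 iter_shifted_linear iter_shifted0 um.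
  by rewrite /shifted linear0 !scaler0 !addr0 subr0.
have gx l' : (l' < n)%N -> gwt T (h + l%:R) (x l').
  apply: (Wdeg_component (gwt_lin T _) gT dx); by rewrite -ew.
apply: linset_sum => [|l' _]; first exact: Wdeg_lin.
case: (eqVneq l l') => [->|ll']; first exact: dx.
rewrite (_ : x l' = 0); first by case: (Wdeg_lin l).
apply: (@gwt_disjoint _ _ T (h + l%:R) (h + l'%:R)); first by rewrite (inj_eq weight_inj).
  by apply: gx.
by exists k; rewrite -/(shifted T _) Wdeg_shifted // iter_fW_k.
Qed.

Lemma gwt_trivial mu : (forall l : nat, mu <> h + l%:R) -> gwt T mu = [set 0].
Proof.
move=> nl; apply/seteqP; split=> [w gw|_ ->]; last by case: (gwt_lin T mu).
have [n [x [dx ew]]] := Wdeg_sum w; rewrite /= ew.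
have gT u : gwt T mu u -> gwt T mu (T u).
  move=> [m um]; exists m; rewrite -/(shifted T mu).
  have -> : T u = shifted T mu u + mu *: u by rewrite subrK.
  rewrite -[shifted _ _ _]scale1r iter_shifted_linear scale1r iter_shiftedC.
  rewrite -[X in _ + iter _ _ X]addr0 iter_shifted_linear iter_shifted0 um.
  by rewrite /shifted linear0 !scaler0 !addr0 subr0.
rewrite big1 // => l _; apply: (@gwt_disjoint _ _ T mu (h + l%:R)).
- by apply/eqP.
- by apply: (Wdeg_component (gwt_lin T _) gT dx (n := n)) => //; rewrite -ew.
- by exists k; rewrite -/(shifted T _) Wdeg_shifted // iter_fW_k.
Qed.

(** [ker_range] gives a preimage of unknown degree; its component of degree l is again a preimage
    because J is graded. *)
Lemma Wdeg_lift l x : Wdeg c h k l x -> fW x = 0 ->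
  exists2 y, Wdeg c h k l y & iter k.-1 fW y = x.
Proof.
move=> /Wdeg_iff[v dv <-] fx.
have [|u eu] := @ker_range k.-1 (p v) (leq_pred _).
  by rewrite (_ : (k - k.-1 = 1)%N) //; lia.
have [u' eu'] := proj_surj u; exists (p (gproj l%:Z u')).
  by apply/Wdeg_iff; exists (gproj l%:Z u') => //; rewrite gproj_gproj eqxx.
apply/eqP; rewrite eq_sym -subr_eq0 iter_fW_proj -(homB hp); apply/eqP/projW_eq0.
have : J (v - iter k.-1 (@nil_end K c h k) u').
  by apply/projW_eq0; rewrite (homB hp) eu eu' -/p iter_fW_proj subrr.
move=> /(Jset_gproj l%:Z); congr J.
rewrite -scaleN1r addrC gproj_linear scaleN1r addrC dv; congr (_ - _).
by elim: (k.-1) => //= n <-; rewrite gproj_nil.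
Qed.

(* M(c,h) -> W, 1 |-> u_1: the socle of W is L(c,h) *)
Definition socmap : Verma c h -> W := vlift (uW 1).

Let u1pos n : 0 < n -> op n (uW 1) = 0.
Proof. by move=> n0; rewrite /uW -hp.2 ug_pos ?(hom0 hp). Qed.

Let u1zero : op 0 (uW 1) = h *: uW 1.
Proof. by rewrite /uW -hp.2 ug_zero // addr0 (homZ _ hp). Qed.

Lemma soc_hom : is_hom socmap.
Proof. exact: vlift_hom virW u1pos u1zero. Qed.

Lemma soc_hwv : socmap (hwv c h) = uW 1.
Proof. exact: vlift_hwv virW u1pos u1zero. Qed.

(** f^(k-1) factors as M(c,h,k) -> M(c,h) -> W, which relates the top layer of W to its socle. *)
Lemma soc_top v : socmap (topmap v) = iter k.-1 fW (p v).
Proof.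
move: v; apply: ind_hom_eq.
- exact: hom_comp (@top_hom K c h k) soc_hom.
- exact: hom_comp hp (hom_iter _ fW_hom).
move=> j; rewrite top_gen -ugS [RHS](@iter_fW_u k.-1 j.+1) //.
case: eqP => jk; first by rewrite soc_hwv; congr uW; lia.
rewrite (hom0 soc_hom) (_ : (j.+1 - k.-1 = 0)%N) ?/uW ?(hom0 hp) //.
by have := ltn_ord j; lia.
Qed.

(** The kernel is proper since u_1 <> 0. Conversely an element of T(c,h) is the image of some z in
    J, which vanishes in W. *)
Lemma ker_soc v : socmap v = 0 <-> maxsub (Verma c h) v.
Proof.
have sk := ker_is_submod soc_hom; split=> [v0|/J_full[z Jz <-]].
  apply: gen_sub; exists (Submod sk); split=> // e; apply: uW1_neq0.
  have : sset (Submod sk) (hwv c h) by rewrite e.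
  by rewrite /= soc_hwv.
rewrite soc_top (_ : p z = 0); last exact/projW_eq0.
exact: (hom0 (hom_iter _ fW_hom)).
Qed.

End Wmodule.

Lemma degree_mono (R : comUnitRingType) (M : opmod R int) (E E' : set M) l v :
  E `<=` E' -> degree E l v -> degree E' l v.
Proof.
move=> EE'; apply: span_mono => _ [w [e [sw Ee ->]]]; exists w, e; split=> //.
exact: EE'.
Qed.

Lemma degree_pspan (R : comUnitRingType) (c h : R) (l : nat) (v : Verma c h) :
  degree [set hwv c h] l v -> exists m, pspan (- l%:Z) m v.
Proof.
have l1 : linset [set v : Verma c h | exists m, pspan (- l%:Z) m v].
  split; first by exists 0%N; case: (@pspan_lin R c _ (h%:M : 'M[R]_1) (- l%:Z) 0).
  move=> a u w [m um] [n wn]; exists (maxn m n).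
  have [_ lin] := @pspan_lin R c _ (h%:M : 'M[R]_1) (- l%:Z) (maxn m n).
  by apply: lin; apply: pspan_mono; [|exact: um| |exact: wn]; rewrite ?leq_maxl ?leq_maxr.
rewrite /degree; move: v; apply: (span_min l1) => _ [w [_ [sw -> ->]]] /=.
exists (size w).+1; rewrite -sw; exact: (@pspan_words R c _ (h%:M : 'M[R]_1)).
Qed.

(** * Bases of L(c,h) and of the socle of W *)

Section Characters.
Variables (K : numFieldType) (c h : K) (k d : nat) (S : {ffun pbw d -> K}).
Hypotheses (k0 : (0 < k)%N)
  (S1 : forall b, pbw_word b = nseq d (-1) -> S b = 1)
  (Spos : forall n : int, 0 < n -> op n (uact (pbw_elt S) (hwv c h)) = 0)
  (maxE : maxsub (Verma c h) = gen [set uact (pbw_elt S) (hwv c h)])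
  (J_full : maxsub (Verma c h) `<=` (@topmap K c h k) @` Jset (@Mtop K c h k)).

(** Stated for any homomorphism with kernel T(c,h), so as to serve both L(c,h) and its copy ker f
    inside W. *)
Lemma rwords_basis (N : opmod K int) (f : Verma c h -> N) (l : nat) (P : set N) : is_hom f ->
  (forall v, f v = 0 <-> maxsub (Verma c h) v) ->
  (forall x, P x <-> exists2 v, degree [set hwv c h] l v & f v = x) ->
  is_basis P (fun i : 'I_(size (rwords d l)) => wact (nth [::] (rwords d l) i) (f (hwv c h))).
Proof.
move=> hf kf PE; have ur : uniq (rwords d l) by rewrite filter_uniq ?uniq_gwords.
have dw w : w \in rwords d l -> wsum w = - l%:Z.
  by rewrite mem_filter mem_gwords => /and3P[_ _ /eqP].
have sumE (a : seq int -> K) : f (\sum_(w <- rwords d l) a w *: wact w (hwv c h)) =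
    \sum_(i < size (rwords d l)) a (nth [::] (rwords d l) i) *: wact (nth [::] (rwords d l) i) (f (hwv c h)).
  rewrite (hom_sum hf) (big_nth [::]) big_mkord; apply: eq_bigr => i _.
  by rewrite (homZ _ hf) wact_hom.
split=> [i|a a0 i|x /PE[v dv <-]].
- apply/PE; exists (wact (nth [::] (rwords d l) i) (hwv c h)); last by rewrite wact_hom.
  by apply: sub_span; eexists; eexists; split; [exact: (dw _ (mem_nth [::] (ltn_ord i)))|..].
(* Coefficients indexed by positions become a function of words, the list being free of repetitions;
   the default 0 is never reached on it. *)
- pose b w := if insub (index w (rwords d l)) is Some i then a i else 0.
  have bE (j : 'I_(size (rwords d l))) : b (nth [::] (rwords d l) j) = a j.
    by rewrite /b index_uniq // valK.
  rewrite -bE; apply: (rwords_free S1 Spos (l := l)); last by rewrite mem_nth.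
  rewrite -maxE -kf sumE -[RHS]a0; apply: eq_bigr => j _; by rewrite bE.
- have [m vm] := degree_pspan dv; have [a] := rwords_span S1 vm.
  rewrite -maxE -kf (homB hf) => /eqP; rewrite subr_eq0 => /eqP ->.
  by exists (fun i : 'I_(size (rwords d l)) => a (nth [::] (rwords d l) i)); rewrite sumE.
Qed.

Lemma Lirr_basis l : is_basis (Lirr_deg c h l)
  (fun i : 'I_(size (rwords d l)) => wact (nth [::] (rwords d l) i)
     (proj (maxsub (Verma c h)) (hwv c h))).
Proof.
have hp := proj_hom (maxsub (Verma c h)).
apply: (@rwords_basis _ (proj (maxsub (Verma c h)))) => // [v|x].
  by rewrite proj_eq0 gen_id //; exact: gen_is_submod.
rewrite /Lirr_deg -image_set1; split=> [/(degree_lift hp) //|[v dv <-]].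
exact: degree_proj.
Qed.

Lemma soc_basis l : is_basis [set x : Wmod c h k | fW x = 0 /\ Wdeg c h k l x]
  (fun i : 'I_(size (rwords d l)) => wact (nth [::] (rwords d l) i) (uW c h k 1)).
Proof.
rewrite -(@soc_hwv K c h k k0); apply: (@rwords_basis _ (@socmap K c h k) l).
- exact: soc_hom.
- exact: ker_soc.
move=> x; split=> [[fx dx]|[v dv <-]].
  have [y dy <-] := Wdeg_lift k0 J_full dx fx.
  have /Wdeg_iff[u du <-] := dy; exists (topmap u); last exact: soc_top.
  by rewrite -range_gen -du -gproj_top; exact: gproj_degree.
split.
  have hz : is_hom (fun _ : Verma c h => 0 : Wmod c h k).
    by split=> *; rewrite ?scaler0 ?addr0 ?linear0.
  have E := ind_hom_eq (hom_comp (@soc_hom K c h k k0) (@fW_hom K c h k)) hz.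
  apply: (E _ v) => j /=.
  rewrite ind_gen_hwv soc_hwv //; have := @iter_fW_u K c h k 1 1 k0.
  by rewrite /= => ->; rewrite /uW (hom0 (proj_hom _)).
have dd := degree_proj (@soc_hom K c h k k0) dv; rewrite image_set1 soc_hwv // in dd.
have sub : [set uW c h k 1] `<=` proj (Jset (@Mtop K c h k)) @` @Mtop K c h k.
  by move=> _ ->; exists (ug c h k 1) => //; exists (Ordinal k0) => //; rewrite -ugS.
exact: (degree_mono sub dd).
Qed.

End Characters.

(** * The Shapovalov form and kappa *)

Section PolyAction.
Variables (K : fieldType) (V : lmodType K) (f : V -> V).
Hypothesis lf : forall a u v, f (a *: u + v) = a *: f u + f v.

(** p(f) v, the K[X]-module structure given by f. *)
Definition pact (p : {poly K}) (v : V) : V := \sum_(i < size p) p`_i *: iter i f v.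

Lemma pact_wide n (p : {poly K}) v : (size p <= n)%N -> pact p v = \sum_(i < n) p`_i *: iter i f v.
Proof.
move=> pn; rewrite /pact (big_ord_widen n (fun i => p`_i *: iter i f v)) // big_mkcond.
by apply: eq_bigr => i _; case: ltnP => // /(nth_default 0) ->; rewrite scale0r.
Qed.

Let iter_lin n a u v : iter n f (a *: u + v) = a *: iter n f u + iter n f v.
Proof. by elim: n => //= n ->; rewrite lf. Qed.

Lemma pact_linr p a u v : pact p (a *: u + v) = a *: pact p u + pact p v.
Proof.
rewrite /pact scaler_sumr -big_split; apply: eq_bigr => i _ /=.
by rewrite iter_lin scalerDr !scalerA mulrC.
Qed.

Lemma pact_linl a p q v : pact (a *: p + q) v = a *: pact p v + pact q v.
Proof.
pose n := maxn (size p) (size q).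
have sn : (size (a *: p + q)%R <= n)%N.
  apply: leq_trans (size_polyD _ _) _; rewrite geq_max /n leq_max.
  by rewrite (leq_trans (size_scale_leq _ _)) //= leq_maxr.
rewrite (pact_wide _ sn) !(@pact_wide n) ?leq_maxl ?leq_maxr // scaler_sumr -big_split.
by apply: eq_bigr => i _; rewrite coefD coefZ scalerDl scalerA.
Qed.

Lemma pactD p q v : pact (p + q) v = pact p v + pact q v.
Proof. by rewrite -[p]scale1r pact_linl !scale1r. Qed.

Lemma pactC a v : pact a%:P v = a *: v.
Proof. by rewrite (@pact_wide 1) ?size_polyC ?leq_b1 // big_ord1 coefC. Qed.

Lemma pact0r p : pact p 0 = 0.
Proof. by have := pact_linr p (-1) 0 0; rewrite scaleN1r addNr scaleN1r addNr. Qed.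

Lemma pactMX p v : pact (p * 'X) v = pact p (f v).
Proof.
have s : (size (p * 'X)%R <= (size p).+1)%N.
  by apply: leq_trans (size_polyMleq _ _) _; rewrite size_polyX addn2.
rewrite (pact_wide _ s) big_ord_recl coefMX eqxx scale0r add0r.
by apply: eq_bigr => i _; rewrite coefMX /= -iterSr.
Qed.

Lemma pact_f p v : pact p (f v) = f (pact p v).
Proof.
rewrite /pact; have fD u w : f (u + w) = f u + f w by rewrite -[u]scale1r lf !scale1r.
have f0 : f 0 = 0 by apply: (addrI (f 0)); rewrite -fD !addr0.
rewrite (big_morph f fD f0); apply: eq_bigr => i _.
by rewrite -iterSr -[in RHS](addr0 (p`_i *: iter i f v)) lf f0 addr0.
Qed.

Lemma pactM p q v : pact (p * q) v = pact p (pact q v).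
Proof.
elim/poly_ind: p v => [|p a IH] v; first by rewrite mul0r /pact size_poly0 !big_ord0.
rewrite mulrDl mulrAC pactD pactMX IH pact_f mul_polyC -[a *: q]addr0 pact_linl pactD pactMX pactC.
by congr (_ + _); rewrite [X in _ + X](_ : _ = 0) ?addr0 // /pact size_poly0 big_ord0.
Qed.

Lemma pact_sum (I : Type) (s : seq I) (P : pred I) (F : I -> {poly K}) v :
  pact (\sum_(i <- s | P i) F i) v = \sum_(i <- s | P i) pact (F i) v.
Proof.
apply: (big_morph (pact^~ v)); first by move=> p q; exact: pactD.
by rewrite /pact size_poly0 big_ord0.
Qed.
End PolyAction.

Lemma pact_op (K : fieldType) (M : opmod K int) (f : M -> M) p n (v : M) : is_hom f ->
  op n (pact f p v) = pact f p (op n v).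
Proof.
move=> hf; rewrite /pact linear_sum; apply: eq_bigr => i _.
by rewrite linearZ (hom_iter i hf).2.
Qed.

Lemma coef_comp_XaddC (R : comNzRingType) (p : {poly R}) (h : R) i :
  (p \Po ('X + h%:P))`_i = p^`N(i).[h].
Proof.
rewrite /comp_poly addrC.
pose n := maxn (size p) i.+1.
rewrite (@nderiv_taylor_wide _ n) ?size_map_polyC ?leq_maxl //; last exact: commr_polyX.
under eq_bigr => j _ do rewrite nderivn_map horner_map /= mul_polyC.
rewrite -(poly_def n (fun j => p^`N(j).[h])) coef_poly.
by rewrite /n leq_maxr.
Qed.

Section KappaVector.
Variables (K : numFieldType) (c h : K) (k : nat).
Local Notation M := (Mind c h k).
Local Notation Kxy := {poly {poly K}}.
Local Notation f := (@nil_end K c h k).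
Local Notation G := (genVerma K).
Local Notation g0 := (genhwv K).

(* evaluation of K[x,y] at x = c, y = h + 'X, where 'X will act by nil_end *)
Definition sig : Kxy -> {poly K} := comp_poly ('X + h%:P) \o map_poly (horner_eval c).
HB.instance Definition _ := GRing.RMorphism.on sig.

(** By Taylor's formula in y, these are exactly the divided derivatives at (c,h) in [kappa_cond]. *)
Lemma sig_coef (a : Kxy) i : (sig a)`_i = (i`!%:R)^-1 * (a^`(i)).[h%:P].[c].
Proof.
rewrite /sig /= coef_comp_XaddC nderivn_map.
have eh : h = horner_eval c h%:P by rewrite /horner_eval hornerC.
rewrite [in LHS]eh horner_map /= nderivn_def hornerMn hornerMn /horner_eval.
by rewrite -[X in _ * X]mulr_natr mulrCA mulVf ?mulr1 // pnatr_eq0 -lt0n fact_gt0.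
Qed.

Definition rho (a : Kxy) (v : M) : M := pact f (sig a) v.

Let lf := (@nil_hom K c h k).1.

(** Specialization of the generic Verma module: its generator goes to u_j, x to c and y to h +
    [nil_end], which is how L_0 acts on u_j. It is semilinear along [sig], so it is not an instance
    of [ilift]. *)
Fixpoint twist (j : nat) (x : ind_term Kxy 1) : M :=
  match x with
  | ITgen _ => ug c h k j
  | ITzero => 0
  | ITadd x y => twist j x + twist j y
  | ITscale a x => rho a (twist j x)
  | ITL n x => op n (twist j x)
  end.

Lemma rhoD a b v : rho (a + b) v = rho a v + rho b v.
Proof. by rewrite /rho rmorphD pactD. Qed.
Lemma rhoM a b v : rho (a * b) v = rho a (rho b v).
Proof. by rewrite /rho rmorphM pactM. Qed.
Lemma rho_linr a r u v : rho a (r *: u + v) = r *: rho a u + rho a v.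
Proof. exact: pact_linr. Qed.
Lemma rho_addr a u v : rho a (u + v) = rho a u + rho a v.
Proof. by rewrite -[u]scale1r rho_linr !scale1r. Qed.
Lemma rhoC (a : Kxy) r v : sig a = r%:P -> rho a v = r *: v.
Proof. by rewrite /rho => ->; rewrite pactC. Qed.
Lemma rho_op a n v : op n (rho a v) = rho a (op n v).
Proof. by apply: pact_op; exact: nil_hom. Qed.

Lemma sig_x : sig 'X%:P = c%:P.
Proof. by rewrite /sig /= map_polyC /= /horner_eval hornerX comp_polyC. Qed.
Lemma sig_y : sig 'X = 'X + h%:P.
Proof. by rewrite /sig /= map_polyX comp_polyX. Qed.
Lemma sig_int m : sig m%:~R = (m%:~R)%:P.
Proof. by rewrite !rmorph_int. Qed.

Lemma sig_cen m n : sig (cen ('X%:P : Kxy) m n) = (cen c m n)%:P.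
Proof.
rewrite /cen; case: ifP => _; last by rewrite rmorph0.
have n12 : (12%:R : K) != 0 by rewrite pnatr_eq0.
have e12 : (12%:R : Kxy) = (12%:R : K)%:P%:P by rewrite !rmorph_nat.
have v12 : (12%:R : Kxy)^-1 = (12%:R^-1 : K)%:P%:P.
  have u12 : (12%:R : Kxy) \is a GRing.unit.
    by apply/unitrP; exists (12%:R^-1 : K)%:P%:P; rewrite e12 -!polyCM mulfV ?mulVf.
  by apply: (mulrI u12); rewrite mulrV // e12 -!polyCM mulfV.
have sM a b : sig (a * b) = sig a * sig b by rewrite rmorphM.
rewrite v12 !sM sig_x sig_int !polyCM; congr (_ * _ * _).
by rewrite /sig /= map_polyC /= /horner_eval hornerC comp_polyC.
Qed.

Lemma twist_eq j x y : (j <= k)%N ->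
  ind_eq ('X%:P : Kxy) (('X : Kxy)%:M) x y -> twist j x = twist j y.
Proof.
move=> jk H; elim: x y / H => //=; try by move=> *; congruence.
- by move=> x y z; rewrite addrA.
- by move=> x y; rewrite addrC.
- by move=> x; rewrite add0r.
- move=> x; rewrite (@rhoC _ (-1)) ?scaleN1r ?addNr //.
  by rewrite rmorphN rmorph1 polyCN.
- by move=> a b x; rewrite rhoM.
- by move=> x; rewrite (@rhoC _ 1) ?scale1r // rmorph1.
- by move=> a x y; rewrite rho_addr.
- by move=> a b x; rewrite rhoD.
- by move=> n x y; exact: linearD.
- by move=> n a x; exact: rho_op.
- move=> m n x; rewrite [LHS](vir_ind m n (twist j x)) (rhoC _ (sig_int _)).
  by rewrite -/(cen ('X%:P : Kxy) m n) (rhoC _ (sig_cen _ _)).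
- by move=> n i n0; exact: ug_pos.
- move=> i; have Xi : (('X : Kxy)%:M : 'M[Kxy]_1) ord0 i = 'X.
    by rewrite mxE (ord1 i).
  rewrite [LHS](@ug_zero K c h k j jk) big_ord_recl big_ord0 /= addr0 Xi /rho sig_y.
  by rewrite pactD pactC addrC -['X]mul1r pactMX // pactC scale1r nil_ug.
Qed.

Section AtGenerator.
Variable j : nat.
Hypothesis jk : (j <= k)%N.

Definition gtwist (v : G) : M := twist j (repr (v : ind_car _ _)).

Lemma gtwist_pi x : gtwist (ind_pi _ _ x) = twist j x.
Proof. by apply: twist_eq => //; exact: ind_repr. Qed.

Lemma gtwistZ a v : gtwist (a *: v) = rho a (gtwist v).
Proof. by rewrite -[v]ind_piK ind_piZ !gtwist_pi. Qed.

Lemma gtwist_wact w v : gtwist (wact w v) = wact w (gtwist v).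
Proof.
elim: w => [|n w IH]; first by [].
transitivity (op n (gtwist (wact w v))); last by rewrite IH.
rewrite -[wact w v in RHS]ind_piK gtwist_pi.
transitivity (gtwist (ind_pi _ _ (ITL n (repr (wact w v : ind_car _ _))))); last exact: gtwist_pi.
by congr gtwist; rewrite -[wact w v in LHS]ind_piK [LHS]ind_LE ind_piK.
Qed.

Lemma gtwist_g0 : gtwist g0 = ug c h k j.
Proof. exact: gtwist_pi. Qed.

(** f^i u_j = u_{j-i}, with u_0 = 0. The range 1 <= m <= k with the condition m <= j allows the sums
    over j and m to be exchanged later. *)
Lemma pact_ug p : pact f p (ug c h k j) =
  \sum_(1 <= m < k.+1 | (m <= j)%N) p`_(j - m) *: ug c h k m.
Proof.
rewrite (@pact_wide _ _ _ (size p + j.+1) p) ?leq_addr //.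
rewrite -(big_mkord xpredT (fun i => p`_i *: iter i f (ug c h k j))) /=.
rewrite (@big_cat_nat _ _ _ j.+1) //= ?leq_addl // [X in _ + X]big_nat_cond [X in _ + X]big1 ?addr0; last first.
  move=> i /andP[/andP[ji _] _]; rewrite iter_nil_ug //.
  by rewrite (_ : (j - i = 0)%N) ?scaler0 //; lia.
rewrite big_nat_recr //= iter_nil_ug // subnn scaler0 addr0.
rewrite big_nat_rev /= add0n.
have -> : \sum_(0 <= i < j) p`_(j - i.+1) *: iter (j - i.+1) f (ug c h k j) =
    \sum_(0 <= i < j) p`_(j - i.+1) *: ug c h k i.+1.
  rewrite !big_mkord; apply: eq_bigr => i _; rewrite iter_nil_ug //.
  by rewrite subKn.
rewrite [RHS](_ : _ = \sum_(1 <= m < j.+1) p`_(j - m) *: ug c h k m); last first.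
  by rewrite [RHS](big_nat_widen _ _ k.+1).
by rewrite big_add1.
Qed.

End AtGenerator.

Lemma shap_wact F (u v : G) w : shapovalov F ->
  F u (wact w v) = F (wact (rev (map -%R w)) u) v.
Proof.
move=> sF; elim: w u => //= n w IH u.
rewrite rev_cons -cats1 wact_cat /= -IH.
by rewrite -{2}[n]opprK; have := shap_contra sF (- n) u (wact w v); rewrite opprK.
Qed.

Lemma shap_sumr F (u : G) (I : Type) (s : seq I) (v : I -> G) : shapovalov F ->
  F (\sum_(i <- s) v i) u = \sum_(i <- s) F (v i) u.
Proof.
move=> sF; apply: (big_morph (fun x => F x u)).
  by move=> x y; rewrite -[x]scale1r (shap_linl sF) mul1r scale1r.
by have := shap_linl sF (-1) 0 0 u; rewrite scaleN1r addNr mulN1r addNr.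
Qed.

(* By Taylor's formula the conditions defining kappa say that the vector
   \sum_j R_d^j u_j of M(c,h,k) is in the radical J(c,h,k); its image under
   topmap is R_d^k. *)
Lemma kappa_vector d : (0 < k)%N -> kappa_cond c h d k ->
  exists2 z, Jset (@Mtop K c h k) z &
    gproj d%:Z (topmap z) = topmap z /\ topmap z <> 0.
Proof.
move=> k0 [F sF [Rd Rk HR]].
pose z : M := \sum_(1 <= j < k.+1) \sum_(b : pbw d) Rd j b *: wact (pbw_word b) (ug c h k j).
have gw l w j : gproj l (wact w (ug c h k j)) = if wsum w == - l then wact w (ug c h k j) else 0.
  by rewrite gproj_wact gproj_ug -[_ == - l]subr_eq0 opprK addrC; case: ifP; rewrite ?wact0.
(* By contravariance L_w moves to the other side as a word of degree d, which expands in the PBW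
   basis; so the rows of the Gram matrix test every such w. *)
have dual w : wsum w = d%:Z -> exists al : pbw d -> Kxy, forall v : G,
    F g0 (wact w v) = \sum_a al a * F (wact (pbw_word a) g0) v.
  move=> sw; set w' := rev (map -%R w).
  have sw' : wsum w' = - d%:Z.
    by rewrite -sw /w' /wsum (perm_big (map -%R w)) ?perm_rev //= big_map sumrN.
  pose x := wact w' g0.
  have xE : x = gproj d%:Z x by rewrite /x /g0 /genhwv gproj_word sw' eqxx.
  exists (fun a => coord (pbw_word a) ord0 x) => v.
  rewrite (shap_wact _ _ _ sF) -/w' -/x {1}xE gproj_expand (shap_sumr _ _ _ sF).
  rewrite (eq_bigr (fun y => coord y ord0 x * F (wact y g0) v)); last first.
    move=> y _; rewrite big_ord1 ind_gen_hwv; have := shap_linl sF (coord y ord0 x) (wact y g0) 0 v.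
    by rewrite addr0 (_ : F 0 v = 0) ?addr0 //; have := shap_linl sF (-1) 0 0 v;
      rewrite scaleN1r addNr mulN1r addNr.
  rewrite -(big_map (@pbw_word d) xpredT (fun y => coord y ord0 x * F (wact y g0) v)).
  apply: perm_big; apply: uniq_perm; first exact: uniq_gwords.
    by rewrite map_inj_uniq ?index_enum_uniq //; exact: pbw_word_inj.
  move=> y; rewrite mem_gwords; apply/andP/mapP => [[gy /eqP sy]|[b _ ->]].
    by have [b ->] := pbw_word_surj gy sy; exists b => //; rewrite mem_index_enum.
  by rewrite good_pbw wsum_pbw.
(* L_w L_b has degree 0, so on the generic highest weight vector it is a scalar, read off by the
   form; the specialization turns that scalar into a polynomial in [nil_end]. *)
have act0 w (b : pbw d) j : (j <= k)%N -> wsum w = d%:Z ->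
    wact w (wact (pbw_word b) (ug c h k j)) =
    rho (F g0 (wact w (wact (pbw_word b) g0))) (ug c h k j).
  move=> jk sw; rewrite -(gtwist_g0 jk) -!(gtwist_wact jk).
  have [p ep] : exists p, wact w (wact (pbw_word b) g0) = p *: g0.
    have [p ep] := gproj00 (wact w (wact (pbw_word b) g0)); exists p.
    by rewrite -ep -wact_cat gproj_word wsum_cat sw wsum_pbw subrr oppr0 eqxx.
  rewrite ep (gtwistZ jk); congr rho.
  have := shap_linr sF p g0 0 g0; rewrite addr0 (shap_norm sF) mulr1 => ->.
  by rewrite (_ : F g0 0 = 0) ?addr0 //; have := shap_linr sF (-1) 0 0 g0;
    rewrite scaleN1r addNr mulN1r addNr.
(* The coefficient of u_m is the condition of [kappa_cond] with i = m, in row a. *)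
have inner (a : pbw d) : \sum_(1 <= j < k.+1) \sum_(b : pbw d)
    Rd j b *: rho (gram F a b) (ug c h k j) = 0.
  rewrite (eq_big_nat _ _ (F2 := fun j => \sum_(1 <= m < k.+1 | (m <= j)%N)
     (\sum_(b : pbw d) Rd j b * (sig (gram F a b))`_(j - m)) *: ug c h k m)); last first.
    move=> j /andP[_ jk].
    rewrite (eq_bigr (fun b => \sum_(1 <= m < k.+1 | (m <= j)%N)
       (Rd j b * (sig (gram F a b))`_(j - m)) *: ug c h k m)); last first.
      move=> b _; rewrite /rho pact_ug // scaler_sumr; apply: eq_bigr => m _.
      by rewrite scalerA.
    rewrite exchange_big /=; apply: eq_bigr => m _; by rewrite scaler_suml.
  under eq_bigr do rewrite big_mkcond.
  rewrite exchange_big /= big_nat_cond big1 // => m /andP[/andP[m1 mk] _].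
  rewrite -big_mkcond /= -scaler_suml.
  have -> : \sum_(1 <= i < k.+1 | (m <= i)%N)
      \sum_(b : pbw d) Rd i b * (sig (gram F a b))`_(i - m) = 0; last by rewrite scale0r.
  rewrite -[RHS](HR m _ a); last by rewrite m1.
  rewrite [RHS](big_nat_widenl m 1) //=; apply: eq_bigr => i _.
  rewrite mulr_sumr; apply: eq_bigr => b _; rewrite sig_coef; ring.
have zT : topmap z = \sum_(b : pbw d) Rd k b *: wact (pbw_word b) (hwv c h).
  rewrite /z (hom_sum (@top_hom K c h k)) big_nat_recr //= big_nat_cond big1 ?add0r.
    rewrite (hom_sum (@top_hom K c h k)); apply: eq_bigr => b _.
    by rewrite (homZ _ (@top_hom K c h k)) (wact_hom _ _ (@top_hom K c h k)) top_ug.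
  move=> j /andP[/andP[j1 jk] _]; rewrite (hom_sum (@top_hom K c h k)) big1 // => b _.
  rewrite (homZ _ (@top_hom K c h k)) (wact_hom _ _ (@top_hom K c h k)).
  case: j j1 jk => // j _ jk; rewrite -[j.+1]/(Ordinal (ltnW jk)).+1 ugS top_gen ltn_eqF //.
  by rewrite wact0 scaler0.
exists z; [apply/Jset_iff => w|split].
- rewrite /z wact_sum gproj_sum (eq_big_nat _ _ (F2 := fun j => \sum_(b : pbw d)
     Rd j b *: (if wsum w == d%:Z then wact w (wact (pbw_word b) (ug c h k j)) else 0))); last first.
    move=> j _; rewrite wact_sum gproj_sum; apply: eq_bigr => b _.
    rewrite wactZ gprojZ -wact_cat gw wsum_cat wsum_pbw oppr0 subr_eq0 wact_cat.
    by [].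
  (* Words with letter sum other than d send z, of degree d, outside degree 0. *)
  case: eqP => sw; last by rewrite big1 // => j _; rewrite big1 // => b _; rewrite scaler0.
  have [al alE] := dual w sw.
  rewrite (eq_big_nat _ _ (F2 := fun j => \sum_(b : pbw d) \sum_(a : pbw d)
    Rd j b *: rho (al a) (rho (gram F a b) (ug c h k j)))); last first.
    move=> j /andP[_ jk]; apply: eq_bigr => b _; rewrite act0 // alE.
    rewrite -scaler_sumr; congr (_ *: _).
    rewrite (big_morph (fun p => rho p (ug c h k j)) (id1 := 0) (op1 := +%R)).
    - by apply: eq_bigr => a _; rewrite rhoM.
    - by move=> p q; exact: rhoD.
    - by rewrite (@rhoC _ 0) ?scale0r // rmorph0.
  have rho0 a : rho a 0 = 0 by exact: (pact0r lf).
  have rhoZ a r v : rho a (r *: v) = r *: rho a v.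
    by rewrite -[r *: v]addr0 rho_linr rho0 addr0.
  rewrite (eq_bigr (fun j => \sum_(a : pbw d) rho (al a)
     (\sum_(b : pbw d) Rd j b *: rho (gram F a b) (ug c h k j)))); last first.
    move=> j _; rewrite exchange_big; apply: eq_bigr => a _.
    rewrite (big_morph (rho (al a)) (id1 := 0) (op1 := +%R)) //.
      by apply: eq_bigr => b _; rewrite rhoZ.
    by move=> u v; exact: rho_addr.
  rewrite exchange_big big1 // => a _.
  have := congr1 (rho (al a)) (inner a).
  rewrite (big_morph (rho (al a)) (id1 := 0) (op1 := +%R)) // ?rho0 //.
  by move=> u v; exact: rho_addr.
- rewrite zT gproj_sum; apply: eq_bigr => b _.
  by rewrite gprojZ /hwv gproj_word wsum_pbw eqxx.
- rewrite zT => e; case/eqP: Rk; apply/ffunP => b; rewrite ffunE.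
  have := congr1 (coord (pbw_word b) ord0) e; rewrite coord0 coord_sum => <-.
  rewrite (bigD1 b) //= coordZ /hwv coord_word ?good_pbw // !eqxx mulr1 big1 ?addr0 // => b' bb'.
  by rewrite coordZ coord_word ?good_pbw // (inj_eq (@pbw_word_inj d)) (negbTE bb') mulr0.
Qed.

End KappaVector.

(** The conditions involve only the differences j - i, so the last m vectors of a family of length n
    form a family of length m. *)
Lemma kappa_cond_le (K : fieldType) (c h : K) d m n : (0 < m <= n)%N ->
  kappa_cond c h d n -> kappa_cond c h d m.
Proof.
move=> /andP[m0 mn] [F sF [Rd Rn HR]]; exists F => //.
exists (fun j => Rd (j + (n - m))%N); first by rewrite subnKC.
move=> i /andP[i0 im] a.
have ii : (1 <= i + (n - m) <= n)%N by lia.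
have := HR _ ii a; rewrite (_ : n.+1 = m.+1 + (n - m))%N; last by lia.
rewrite big_addn addnK => H; rewrite -[RHS]H; apply: eq_bigr => j _.
by rewrite subnDr.
Qed.

(** * Modules of the Virasoro vertex algebra *)

Section Isomorphisms.
Variables (R : pzRingType) (I : Type).
Implicit Types M N : opmod R I.

Lemma bij_hom_inv M N (f : M -> N) (g : N -> M) :
  is_hom f -> cancel f g -> cancel g f -> is_hom g.
Proof.
move=> hf fK gK; split=> [a u v|i u]; apply: (can_inj fK).
  by rewrite gK hf.1 !gK.
by rewrite gK hf.2 gK.
Qed.

Lemma isomorphic_sym M N : isomorphic M N -> isomorphic N M.
Proof.
move=> [f [hf [g fK gK]]]; exists g; split; first exact: bij_hom_inv fK gK.
by exists f.
Qed.

Lemma first_iso M N (G : set M) (f : M -> N) : is_hom f ->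
  (forall v, f v = 0 <-> gen G v) -> (forall y, exists v, f v = y) ->
  isomorphic (quo G) N.
Proof.
move=> hf kf sf; have Gf v : G v -> f v = 0 by move=> Gv; apply/kf; exact: gen_sub.
exists (qlift (G := G) f); split; first exact: qlift_hom.
pose g y : quo G := proj G (projT1 (cid (sf y))).
have gE y : qlift f (g y) = y by rewrite qliftE //; case: (cid (sf y)).
exists g => // x; have [u ->] := proj_surj x.
rewrite qliftE //; apply/proj_eq/kf; rewrite (homB hf).
by case: (cid (sf (f u))) => /= v ->; rewrite subrr.
Qed.

Lemma val_hom M (P : submod M) : is_hom (val : subm P -> M).
Proof. by split=> [a u v|i u]. Qed.

Lemma sub_lift M N (P : submod N) (f : M -> N) : is_hom f -> (forall v, sset P (f v)) ->
  exists2 g : M -> subm P, is_hom g & forall v, val (g v) = f v.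
Proof.
move=> hf fP; have fP' v : f v \in sub_pred P by exact/asboolP.
exists (fun v => SubCar (fP' v)) => //; split=> [a u v|i u]; apply: val_inj => /=.
  exact: hf.1.
exact: hf.2.
Qed.

Lemma sub_valP M (P : submod M) (x : subm P) : sset P (val x).
Proof. exact/asboolP/(valP x). Qed.

Lemma val_image_submod M (P : submod M) (A : set (subm P)) : is_submod A ->
  is_submod (val @` A : set M).
Proof. exact: image_is_submod (val_hom P). Qed.

Definition uniserial M := forall A B : set M, is_submod A -> is_submod B ->
  A `<=` B \/ B `<=` A.

Lemma uniserial_sub M (P : submod M) : uniserial M -> uniserial (subm P).
Proof.
move=> uM A B sA sB.
have [H|H] := uM _ _ (val_image_submod sA) (val_image_submod sB); [left|right] => x Ax.
  by have [|y By /val_inj <-] := H (val x); [exists x|].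
by have [|y By /val_inj <-] := H (val x); [exists x|].
Qed.

(** Of two comparable submodules with zero intersection, the smaller one is zero. *)
Lemma uniserial_indecomposable M : uniserial M -> (exists v : M, v <> 0) ->
  indecomposable M.
Proof.
move=> uM nz; split=> // A B AB _.
have A0 : sset A 0 by case: (submodP A).
have B0 : sset B 0 by case: (submodP B).
have [H|H] := uM _ _ (submodP A) (submodP B); [left|right].
  apply/seteqP; split=> [x Ax|_ -> //]; rewrite -AB; split=> //; exact: H.
apply/seteqP; split=> [x Bx|_ -> //]; rewrite -AB; split=> //; exact: H.
Qed.

End Isomorphisms.

Section VertexModule.
Variables (K : numFieldType) (c : K).
Variable Y : VirV c -> int -> {linear VirV c -> VirV c}.
Hypothesis hY : is_voa (vac c) (omega c) Y.
Variable W : opmod K int.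
Variable YW : VirV c -> int -> {linear W -> W}.
Hypothesis hYW : is_voa_module (vac c) (omega c) Y YW.

Lemma VirV_ind (Q : set (VirV c)) : is_submod Q -> Q (vac c) -> Q = setT.
Proof.
move=> sQ Qv; apply/seteqP; split=> // x _; have [v ->] := proj_surj x.
suff : [set v | Q (proj [set op (-1) (hwv c 0)] v)] v by [].
rewrite (@ind_mod_ind _ _ _ _ [set v | Q (proj [set op (-1) (hwv c 0)] v)]) //.
  exact: (preim_is_submod (proj_hom _) sQ).
by move=> j; rewrite /= ind_gen_hwv.
Qed.

Lemma binz0 i : binz K 0 i = (i == 0%N)%:R.
Proof.
rewrite /binz; case: i => [|i]; first by rewrite big_ord0 fact0 divr1.
by rewrite big_ord_recl /= subrr mul0r mul0r.
Qed.

Lemma YW_omega n w : YW (omega c) n w = op (n - 1) w.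
Proof. by rewrite -(vm_vir hYW) subrK. Qed.

(* Borcherds' identity with m = 0: the modes of L_n v in terms of those of v *)
Lemma YW_op v w (l n : int) : exists N0, forall N, (N0 <= N)%N ->
  YW (op l v) n w = \sum_(i < N) ((-1) ^+ i * binz K (l + 1) i) *:
      (op (l - i%:Z) (YW v (n + i%:Z) w)
       - (-1) ^ (l + 1) *: YW v (l + 1 + n - i%:Z) (op (i%:Z - 1) w)).
Proof.
have [N0 H] := vm_borcherds hYW (omega c) v w (l + 1) 0 n.
exists N0.+1 => N N0N; have := H N (ltnW N0N).
have -> : \sum_(i < N) binz K 0 i *: YW (Y (omega c) (l + 1 + i%:Z) v) (0 + n - i%:Z) w =
    YW (op l v) n w.
  case: N N0N => // N _; rewrite big_ord_recl binz0 eqxx scale1r big1 ?addr0.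
    by rewrite add0r (vm_vir (voa_mod hY)).
  by move=> i _; rewrite binz0 scale0r.
move=> ->; apply: eq_bigr => i _; rewrite addr0 add0r !YW_omega.
by rewrite (_ : l + 1 - i%:Z - 1 = l - i%:Z) //; lia.
Qed.

Lemma YW_lin a u v n w : YW (a *: u + v) n w = a *: YW u n w + YW v n w.
Proof. exact: (vm_lin hYW). Qed.

Lemma YW0 n w : YW 0 n w = 0.
Proof. by have := YW_lin (-1) 0 0 n w; rewrite scaleN1r addNr scaleN1r addNr. Qed.

(** The vacuum generates V under the L_n, and [YW_op] writes the modes of L_l v by those of v and
    the L_n. *)
Lemma YW_stable (P : set W) v n w : is_submod P -> P w -> P (YW v n w).
Proof.
move=> sP Pw; have [P0 lP oP] := sP; have lsP : linset P by [].
suff : [set v | forall n w, P w -> P (YW v n w)] v by apply.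
rewrite (@VirV_ind [set v | forall n w, P w -> P (YW v n w)]) //.
  split=> [m x Px|a x y Hx Hy m z Pz|m x Hx p z Pz].
  - by rewrite YW0.
  - by rewrite YW_lin; apply: lP; [exact: Hx|exact: Hy].
  - have [N0 /(_ N0 (leqnn _)) ->] := YW_op x z m p.
    apply: (linset_sum _ lsP) => i _; apply: (linsetZ _ lsP); apply: (linsetB lsP).
      by apply: oP; exact: Hx.
    by apply: (linsetZ _ lsP); apply: Hx; exact: oP.
by move=> m x Px; rewrite (vm_vac hYW); case: ifP.
Qed.

Lemma YW_comm (g : W -> W) v n w : is_hom g -> g (YW v n w) = YW v n (g w).
Proof.
move=> hg; suff : [set v | forall n w, g (YW v n w) = YW v n (g w)] v by apply.
rewrite (@VirV_ind [set v | forall n w, g (YW v n w) = YW v n (g w)]) //.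
  split=> [m x|a x y Hx Hy m z|m x Hx p z].
  - by rewrite !YW0 (hom0 hg).
  - by rewrite !YW_lin hg.1 Hx Hy.
  - have [N1 H1] := YW_op x z m p; have [N2 H2] := YW_op x (g z) m p.
    (* The truncations for z and for g z differ; both expansions are valid at the larger one. *)
    rewrite (H1 (maxn N1 N2)) ?leq_maxl // (H2 (maxn N1 N2)) ?leq_maxr // (hom_sum hg).
    apply: eq_bigr => i _; rewrite (homZ _ hg) (homB hg) hg.2 Hx (homZ _ hg) Hx hg.2.
    by [].
by move=> m x; rewrite !(vm_vac hYW); case: ifP => // _; rewrite (hom0 hg).
Qed.

Local Notation VW := (voa_opmod YW).

Lemma voa_submod (P : set W) : @is_submod _ _ VW P <-> @is_submod _ _ W P.
Proof.
split=> sP; have [P0 lP oP] := sP; split=> //.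
  move=> n u Pu; have := oP (omega c, n + 1) u Pu.
  by rewrite /op /= YW_omega addrK.
by move=> [v n] u Pu; exact: YW_stable.
Qed.

Lemma voa_hom (g : W -> W) : @is_hom _ _ VW VW g <-> @is_hom _ _ W W g.
Proof.
split=> hg; split; [exact: hg.1| |exact: hg.1|].
  move=> n u; have := hg.2 (omega c, n + 1) u.
  by rewrite /op /= !YW_omega addrK.
by move=> [v n] u; exact: YW_comm.
Qed.

Lemma L0opE : YW (omega c) 1 = op 0 :> (W -> W).
Proof. by apply/funext => w; rewrite YW_omega subrr. Qed.

End VertexModule.

(** * Submodules, layers and endomorphisms of W(c,h,k) *)

Section Interlocked.
Variables (K : numFieldType) (c h : K) (k : nat).
Hypothesis k0 : (0 < k)%N.
Local Notation W := (Wmod c h k).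
Local Notation f := (@fW K c h k).
Hypothesis J_full : maxsub (Verma c h) `<=` (@topmap K c h k) @` Jset (@Mtop K c h k).
Variable Y : VirV c -> int -> {linear VirV c -> VirV c}.
Hypothesis hY : is_voa (vac c) (omega c) Y.
Variable YW : VirV c -> int -> {linear W -> W}.
Hypothesis hYW : is_voa_module (vac c) (omega c) Y YW.
Local Notation VW := (voa_opmod YW).
Local Notation L0 := (YW (omega c) 1 : VW -> VW).

Lemma fV_hom n : @is_hom _ _ VW VW (iter n f).
Proof. by apply/(voa_hom hY hYW); apply: hom_iter; exact: fW_hom. Qed.

Definition filt n : submod VW := Submod (ker_is_submod (fV_hom n)).

Lemma filt_mono i j : (i <= j)%N -> sset (filt i) `<=` sset (filt j).
Proof.
by move=> ij w /= fw; rewrite -(subnK ij) iterD fw (hom0 (fV_hom _)).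
Qed.

Lemma voa_chain (P : set VW) : @is_submod _ _ VW P ->
  exists2 i, (i <= k)%N & P = sset (filt i).
Proof. by move/(voa_submod hY hYW)/(submod_chain k0 J_full). Qed.

Lemma voa_uniserial : uniserial VW.
Proof.
move=> _ _ /voa_chain[i _ ->] /voa_chain[j _ ->].
by case: (leqP i j) => [|/ltnW] ij; [left|right]; exact: filt_mono.
Qed.

Lemma filt_u j : (0 < j)%N -> sset (filt j) (uW c h k 1).
Proof.
move=> j0; rewrite /filt /= iter_fW_u // (_ : (1 - j = 0)%N); last by lia.
by rewrite /uW /ug (hom0 (proj_hom _)).
Qed.

(** f^(k-i) maps W onto ker f^i, by [ker_range], with kernel ker f^(k-i). Thus ker f^i and ker
    f^(k-i) are interlocking partners. *)
Lemma filt_iso i : (i <= k)%N -> isomorphic (quo (sset (filt (k - i)))) (subm (filt i)).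
Proof.
move=> ik; have fi w : sset (filt i) (iter (k - i) f w).
  by rewrite /= -iterD subnKC // iter_fW_k.
have [g hg gE] := sub_lift (fV_hom (k - i)) fi.
apply: (first_iso hg) => [v|y].
  rewrite gen_id; last exact: submodP.
  split=> [gv|fv]; first by rewrite /= -gE gv.
  by apply: val_inj; rewrite gE.
have [|u eu] := ker_range k0 J_full (leq_subr i k) (w := val y).
  by rewrite subKn //; exact: (sub_valP y).
by exists u; apply: val_inj; rewrite gE -eu.
Qed.

(** The isomorphism is induced by f^j. A preimage of y = f^(k-1) u is f^(k-1-j) u. *)
Lemma filt_quo j : (j < k)%N -> isomorphic
  (quo [set x : subm (filt j.+1) | sset (filt j) (val x)]) (subm (filt 1)).
Proof.
move=> jk; have hv := val_hom (filt j.+1).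
have f1 (x : subm (filt j.+1)) : sset (filt 1) (iter j f (val x)).
  exact: (sub_valP x).
have hf : is_hom (fun x : subm (filt j.+1) => iter j f (val x) : VW).
  exact: (hom_comp hv (fV_hom j)).
have [g hg gE] := sub_lift hf f1.
have sG : is_submod [set x : subm (filt j.+1) | sset (filt j) (val x)].
  exact: (preim_is_submod hv (submodP _)).
apply: (first_iso hg) => [v|y].
  rewrite (gen_id sG); split=> [gv|fv]; first by rewrite /= -gE gv.
  by apply: val_inj; rewrite gE.
have [|u eu] := ker_range k0 J_full (leq_pred k) (w := val y).
  by rewrite (_ : (k - k.-1 = 1)%N); [exact: (sub_valP y)|lia].
have fu : sset (filt j.+1) (iter (k.-1 - j) f u).
  by rewrite /= -iterS -iterD (_ : (j.+1 + (k.-1 - j) = k)%N) ?iter_fW_k //; lia.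
have fu' : iter (k.-1 - j) f u \in sub_pred (filt j.+1) by exact/asboolP.
exists (SubCar fu' : subm (filt j.+1)); apply: val_inj; rewrite gE /= -iterD eu.
by congr (iter _ _ _); lia.
Qed.

Lemma voa_indecomposable j : (0 < j)%N -> indecomposable (subm (filt j)).
Proof.
move=> j0; apply: uniserial_indecomposable.
  by apply: uniserial_sub; exact: voa_uniserial.
have uP : uW c h k 1 \in sub_pred (filt j) by apply/asboolP; exact: filt_u.
by exists (SubCar uP) => /(congr1 val); exact: uW1_neq0.
Qed.

(** Every nonzero submodule contains u_1, so an irreducible one meets ker f and lies in it; and ker
    f is irreducible by the chain of submodules. *)
Lemma socleE : socle VW = [set w | f w = 0].
Proof.
have sf : is_submod (sset (filt 1)) := submodP _.
apply/seteqP; split.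
  apply: (gen_min sf) => w [P [[_ irr] Pw]].
  have sQ : is_submod [set x : subm P | f (val x) = 0].
    exact: (preim_is_submod (val_hom P) sf).
  have [Q0|QT] := irr (Submod sQ); last first.
    have wP : w \in sub_pred P by exact/asboolP.
    by have : sset (Submod sQ) (SubCar wP) by rewrite QT.
  have [[|i] _ PE] := voa_chain (submodP P).
    by move: Pw; rewrite PE /= => ->; exact: hom0 (fW_hom _ _ _).
  have uP : uW c h k 1 \in sub_pred P by apply/asboolP; rewrite PE; exact: filt_u.
  have : sset (Submod sQ) (SubCar uP) by exact: (@filt_u 1).
  by rewrite Q0 => /(congr1 val) /= /(uW1_neq0 k0).
move=> w fw; apply: gen_sub; exists (filt 1); split=> //; split.
  have uP : uW c h k 1 \in sub_pred (filt 1) by apply/asboolP; exact: filt_u.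
  by exists (SubCar uP) => /(congr1 val); exact: uW1_neq0.
move=> P; have [[|i] _ PE] := voa_chain (val_image_submod (submodP P)); [left|right].
  apply/seteqP; split=> [x Px|_ ->]; last by case: (submodP P).
  apply: val_inj; suff : sset (filt 0) (val x) by [].
  by rewrite -PE; exists x.
apply/seteqP; split=> // x _.
have : sset (filt i.+1) (val x) by apply: (@filt_mono 1) => //; exact: sub_valP.
by rewrite -PE => -[y Py /val_inj <-].
Qed.

Lemma gwt_L0 l : gwt L0 (h + l%:R) = Wdeg c h k l.
Proof. by rewrite (L0opE hYW) gwt_Wdeg. Qed.

Lemma gwt_L0_trivial mu : (forall l : nat, mu <> h + l%:R) -> gwt L0 mu = [set 0].
Proof. by rewrite (L0opE hYW); exact: gwt_trivial. Qed.

Lemma weight_cases mu : (exists l : nat, mu = h + l%:R) \/ gwt L0 mu = [set 0].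
Proof.
case: (pselect (exists l : nat, mu = h + l%:R)) => [|nl]; [by left|right].
by apply: gwt_L0_trivial => l e; apply: nl; exists l.
Qed.

Lemma fW_weight mu w : gwt L0 mu w -> f w = L0 w - mu *: w /\ gwt L0 mu (f w).
Proof.
have [[l ->]|->] := weight_cases mu; last first.
  by move=> ->; rewrite (hom0 (fW_hom _ _ _)) (L0opE hYW) linear0 scaler0 subr0.
rewrite gwt_L0 => dw; split; last exact: Wdeg_fW.
by rewrite (L0opE hYW) (Wdeg_zero dw) addrAC subrr add0r.
Qed.

(** Modes commute with the homomorphism f. An endomorphism preserves weight spaces and commutes with
    L_0, hence with f, which is L_0 minus a scalar there. *)
Lemma op_alg_comm (s : VW -> VW) : op_alg s ->
  (forall a u v, s (a *: u + v) = a *: s u + s v) /\ (forall w, s (f w) = f (s w)).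
Proof.
have fl := (fW_hom c h k).1.
elim=> {s} [[v n]|g hg|s1 s2 _ [l1 c1] _ [l2 c2]|a s _ [ls cs]|s1 s2 _ [l1 c1] _ [l2 c2]].
- split=> [a u w|w]; first exact: linearP.
  by rewrite -[LHS](YW_comm hY hYW v n w (fW_hom c h k)).
- split=> [|w]; first exact: hg.1.
  have hg' : @is_hom _ _ W W g by exact/(voa_hom hY hYW).
  have [n [x [dx ->]]] := Wdeg_sum w.
  rewrite (hom_sum (fW_hom c h k)) !(hom_sum hg') (hom_sum (fW_hom c h k)).
  apply: eq_bigr => l _.
  have fE y : Wdeg c h k l y -> f y = op 0 y - (h + l%:R) *: y.
    by move=> dy; rewrite (Wdeg_zero dy) addrAC subrr add0r.
  have dg : Wdeg c h k l (g (x l)).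
    have gI m y : iter m (shifted (op 0 : {linear W -> W}) (h + l%:R)) (g y) =
       g (iter m (shifted (op 0 : {linear W -> W}) (h + l%:R)) y).
      by elim: m => //= m ->; rewrite /shifted (homB hg') (homZ _ hg') hg'.2.
    have := dx l; rewrite -!gwt_Wdeg => -[m xm]; exists m.
    rewrite -/(shifted (op 0 : {linear W -> W}) (h + l%:R)) in xm *.
    by rewrite gI xm (hom0 hg').
  rewrite (fE _ (dx l)) (fE _ dg) (homB hg') (homZ _ hg').
  by rewrite hg'.2.
- split=> [a u v|w]; first by rewrite l1 l2 scalerDr addrACA.
  by rewrite c1 c2 (homD (fW_hom c h k)).
- split=> [b u v|w]; first by rewrite ls scalerDr !scalerA mulrC.
  by rewrite cs (homZ _ (fW_hom c h k)).
- by split=> [a u v|w]; rewrite ?l2 ?l1 // c2 c1.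
Qed.

End Interlocked.

(** * Traces in bases of Jordan type *)

Lemma basis_size (K : fieldType) (V : lmodType K) (P : set V) m n
    (e : 'I_m -> V) (e' : 'I_n -> V) : is_basis P e -> is_basis P e' -> m = n.
Proof.
suff H m' n' (b : 'I_m' -> V) (b' : 'I_n' -> V) : is_basis P b -> is_basis P b' -> (m' <= n')%N.
  by move=> be be'; apply/eqP; rewrite eqn_leq (H _ _ _ _ be be') (H _ _ _ _ be' be).
move=> [Pb fb sb] [Pb' fb' sb'].
have [A AE] := choice (fun i => sb' _ (Pb i)); have [B BE] := choice (fun i => sb _ (Pb' i)).
apply: (@mulmx1_min _ _ _ (\matrix_(i, j) A i j) (\matrix_(i, j) B i j)).
apply/matrixP => i l; rewrite !mxE.
under eq_bigr => j _ do rewrite !mxE.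
apply/eqP; rewrite -subr_eq0; apply/eqP.
apply: (fb (fun l => \sum_j A i j * B j l - (i == l)%:R)).
under eq_bigr => l' _ do rewrite scalerBl.
rewrite sumrB [X in _ - X](bigD1 i) //= eqxx scale1r [X in _ - (_ + X)]big1 ?addr0; last first.
  by move=> j /negbTE; rewrite eq_sym => ->; rewrite scale0r.
under eq_bigr => l' _ do rewrite scaler_suml.
rewrite exchange_big /= [X in _ - X]AE -sumrB big1 // => j _.
rewrite [in X in _ - X]BE scaler_sumr -sumrB big1 // => l' _.
by rewrite scalerA subrr.
Qed.

Lemma wdim_basis (K : fieldType) (V : lmodType K) (P : set V) n (e : 'I_n -> V) :
  is_basis P e -> wdim P = n.
Proof.
move=> be; rewrite /wdim; have [e' be'] : [set n | exists e : 'I_n -> V, is_basis P e]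
    (xget 0%N [set n | exists e : 'I_n -> V, is_basis P e]).
  by apply: (@xgetPex _ 0%N); exists n, e.
exact: basis_size be' be.
Qed.

Lemma basis_reindex (K : fieldType) (V : lmodType K) (P : set V) (J : finType) (e : J -> V) :
  is_basis P e -> findim P.
Proof.
move=> [Pe fe se]; exists #|J|, (fun i => e (enum_val i)).
split=> [i|a a0 i|v /se[a ->]]; first exact: Pe.
  rewrite -(enum_valK i); apply: (fe (fun j => a (enum_rank j))).
  rewrite -[RHS]a0 (reindex (@enum_val J predT)); last first.
    by apply: onW_bij; exact: enum_val_bij.
  by apply: eq_bigr => j _; rewrite enum_valK.
exists (fun i => a (enum_val i)); rewrite (reindex (@enum_val J predT)) //.
by apply: onW_bij; exact: enum_val_bij.
Qed.

Section BlockBasis.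
Variables (K : fieldType) (V : lmodType K) (f : V -> V) (k : nat).
Hypotheses (k0 : (0 < k)%N)
  (lf : forall a u v, f (a *: u + v) = a *: f u + f v).

Let f0 : f 0 = 0.
Proof. by have := lf (-1) 0 0; rewrite scaleN1r addNr scaleN1r addNr. Qed.

Let iter_lin n a u v : iter n f (a *: u + v) = a *: iter n f u + iter n f v.
Proof. by elim: n => //= n ->; rewrite lf. Qed.

Let iter0 n : iter n f 0 = 0.
Proof. by elim: n => //= n ->. Qed.

Let iter_sum n (I : Type) (s : seq I) (P : pred I) (F : I -> V) :
  iter n f (\sum_(i <- s | P i) F i) = \sum_(i <- s | P i) iter n f (F i).
Proof.
apply: (big_morph (iter n f)); last exact: iter0.
by move=> u v; rewrite -[u]scale1r iter_lin !scale1r.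
Qed.

Let iterZ n a u : iter n f (a *: u) = a *: iter n f u.
Proof. by rewrite -[a *: u]addr0 iter_lin iter0 addr0. Qed.

Variables (G : set V) (p : nat).
Hypothesis lG : linset G.

Definition block_basis (b : nat -> 'I_p -> V) :=
  is_basis G (fun x : 'I_k * 'I_p => b x.1 x.2) /\
  forall j i, (j < k)%N -> f (b j i) = if j is j'.+1 then b j' i else 0.

(** Lift a basis of ker f through f^(k-1) to vectors y_i and take b_j = f^(k-1-j) y. *)
Lemma block_basis_exists (e : 'I_p -> V) : (forall v, G v -> G (f v)) ->
  (forall v, G v -> iter k f v = 0) ->
  (forall x, G x -> f x = 0 -> exists2 y, G y & iter k.-1 f y = x) ->
  is_basis [set x | f x = 0 /\ G x] e ->
  exists b, block_basis b /\ b 0%N =1 e.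
Proof.
move=> fG fk lift [Ge fe se].
have Gn n v : G v -> G (iter n f v) by move=> Gv; elim: n => //= n; exact: fG.
have [y yP] : exists y : 'I_p -> V, forall i, G (y i) /\ iter k.-1 f (y i) = e i.
  suff /choice[y Hy] : forall i, exists x, G x /\ iter k.-1 f x = e i by exists y.
  move=> i; have [fe0 Gei] := Ge i; have [x Gx xe] := lift _ Gei fe0; by exists x.
pose b j i := iter (k.-1 - j) f (y i).
have bn n j i : (j < k)%N -> iter n f (b j i) = if (n <= j)%N then b (j - n)%N i else 0.
  move=> jk; rewrite /b -iterD; case: leqP => nj; first by congr iter; lia.
  rewrite (_ : (n + (k.-1 - j) = (n - j.+1) + k)%N) ?iterD ?fk ?iter0 //; last by lia.
  by case: (yP i).
exists b; split; last by move=> i; rewrite /b subn0; case: (yP i).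
split; last first.
  move=> j i jk; have := bn 1%N j i jk; rewrite /= => ->.
  by case: j jk => // j jk; rewrite subn1.
split=> [[j i]|a a0 [j i]|v Gv] /=.
- by apply: Gn; case: (yP i).
- have {}a0 : \sum_(j < k) \sum_i a (j, i) *: b j i = 0.
    by rewrite -[RHS]a0 pair_big; apply: eq_bigr => -[].
  (* Downward in j: once the coefficients of higher blocks vanish, f^j kills the lower blocks and
     sends block j to e. *)
  have H m : forall j : 'I_k, (k - j <= m)%N -> forall i, a (j, i) = 0.
    elim: m => [|m IH] {j i} j jm i; first by have := ltn_ord j; lia.
    apply: (fe (fun i => a (j, i))).
    have := congr1 (iter j f) a0; rewrite iter0 iter_sum (bigD1 j) //= iter_sum.
    rewrite [X in _ + X]big1 ?addr0 => [E|j' jj'].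
      rewrite -[RHS]E; apply: eq_bigr => l _.
      by rewrite iterZ bn // leqnn subnn; congr (_ *: _); rewrite /b subn0; case: (yP l).
    rewrite iter_sum big1 // => l _; rewrite iterZ bn //.
    case: leqP => j'j; last by rewrite scaler0.
    rewrite IH ?scale0r //; move: jj'; rewrite -val_eqE /= => /eqP; lia.
  by apply: (H k); rewrite leq_subr.
- suff H m w : (m <= k)%N -> G w -> iter m f w = 0 ->
      exists a : nat -> 'I_p -> K, w = \sum_(j < m) \sum_i a j i *: b j i.
    have [a ->] := H k v (leqnn _) Gv (fk _ Gv); exists (fun x : 'I_k * 'I_p => a x.1 x.2).
    by rewrite pair_big; apply: eq_bigr => -[].
  elim: m w => [|m IH] w mk Gw fw; first by exists (fun _ _ => 0); rewrite big_ord0.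
  (* f^m w is in ker f; subtracting the combination of block m with the same image leaves an element
     of ker f^m. *)
  have [|a0 aE] := se (iter m f w); first by split=> //; exact: Gn.
  have Gb : G (\sum_i a0 i *: b m i).
    apply: (linset_sum _ lG) => i _; apply: (linsetZ _ lG); apply: Gn.
    by case: (yP i).
  have [||a wE] := IH (w - \sum_i a0 i *: b m i) (ltnW mk); first exact: linsetB.
    rewrite addrC -scaleN1r iter_lin aE iter_sum scaleN1r addrC -sumrB big1 // => i _.
    rewrite iterZ bn // leqnn subnn (_ : b 0%N i = e i) ?subrr //.
    by rewrite /b subn0; case: (yP i).
  exists (fun j i => if j == m then a0 i else a j i).
  rewrite big_ord_recr /= eqxx -[LHS](subrK (\sum_i a0 i *: b m i)) wE; congr (_ + _).
  by apply: eq_bigr => j _; rewrite ltn_eqF.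
Qed.

Section Fixed.
Variable b : nat -> 'I_p -> V.
Hypothesis bb : block_basis b.

Lemma block_iter n j i : (j < k)%N ->
  iter n f (b j i) = if (n <= j)%N then b (j - n)%N i else 0.
Proof.
move=> jk; elim: n => [|n IH]; first by rewrite subn0.
rewrite iterS IH; case: (leqP n j) => nj; last by rewrite f0 ltnNge (ltnW nj).
rewrite bb.2; last by lia.
case: (ltnP n j) => nj'; first by rewrite subnS; case: (j - n)%N (subn_gt0 n j) => //=; lia.
by rewrite (_ : (j - n = 0)%N) //; lia.
Qed.

Lemma block_free (a : nat -> 'I_p -> K) : \sum_(j < k) \sum_i a j i *: b j i = 0 ->
  forall j i, (j < k)%N -> a j i = 0.
Proof.
move=> a0 j i jk; have [[_ fr _] _] := bb.
apply: (fr (fun x : 'I_k * 'I_p => a x.1 x.2) _ (Ordinal jk, i)).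
by rewrite -[RHS]a0 pair_big; apply: eq_bigr => -[].
Qed.

Lemma block_eq (a a' : nat -> 'I_p -> K) :
  \sum_(j < k) \sum_i a j i *: b j i = \sum_(j < k) \sum_i a' j i *: b j i ->
  forall j i, (j < k)%N -> a j i = a' j i.
Proof.
move=> e j i jk; apply/eqP; rewrite -subr_eq0; apply/eqP.
apply: (@block_free (fun j i => a j i - a' j i)) => //.
have E : \sum_(j < k) (\sum_i a j i *: b j i - \sum_i a' j i *: b j i) = 0.
  by rewrite sumrB e subrr.
rewrite -[RHS]E.
apply: eq_bigr => j' _; rewrite -sumrB; apply: eq_bigr => i' _.
by rewrite scalerBl.
Qed.

Lemma block_span v : G v -> exists a : nat -> 'I_p -> K,
  v = \sum_(j < k) \sum_i a j i *: b j i.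
Proof.
have [[_ _ sp] _] := bb; move=> /sp[a ->].
exists (fun j i => if insub j is Some j' then a (j', i) else 0).
rewrite pair_big; apply: eq_bigr => -[j i] _ /=.
by rewrite valK.
Qed.

Lemma block_mem j i : (j < k)%N -> G (b j i).
Proof. by move=> jk; have [[Gb _ _] _] := bb; exact: (Gb (Ordinal jk, i)). Qed.

Definition block_matrix (s : V -> V) (A : nat -> nat -> 'M[K]_p) :=
  forall j i, (j < k)%N -> s (b j i) = \sum_(j' < k) \sum_i' A j' j i' i *: b j' i'.

Section Operator.
Variables (s : V -> V) (A : nat -> nat -> 'M[K]_p).
Hypotheses (ls : forall a u v, s (a *: u + v) = a *: s u + s v)
  (sf : forall v, s (f v) = f (s v)) (As : block_matrix s A).

(** b_j = f^(k-1-j) b_(k-1) and s commutes with f, so the last block column determines all others;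
    this is the matrix shape required by [si_family]. *)
Lemma block_toeplitz m j : (m < k)%N -> (j < k)%N ->
  A m j = if (m <= j)%N then A (m + (k.-1 - j))%N k.-1 else 0.
Proof.
move=> mk jk; apply/matrixP => i' i.
have kk : (k.-1 < k)%N by rewrite prednK.
have si n v : s (iter n f v) = iter n f (s v) by elim: n => //= n <-; rewrite sf.
have bj : b j i = iter (k.-1 - j) f (b k.-1 i).
  by rewrite block_iter // leq_subr subKn //; lia.
have E := As i jk.
have {}E : \sum_(j' < k) \sum_i' A j' j i' i *: b j' i' =
   \sum_(j' < k) \sum_i' (if (j' <= j)%N then A (j' + (k.-1 - j))%N k.-1 i' i else 0) *: b j' i'.
  rewrite -E bj si (As i kk) iter_sum.
  rewrite -(big_mkord xpredT (fun j' => iter (k.-1 - j) f (\sum_i' A j' k.-1 i' i *: b j' i'))).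
  rewrite -(big_mkord xpredT (fun j' => \sum_i' (if (j' <= j)%N then A (j' + (k.-1 - j))%N k.-1 i' i else 0) *: b j' i')).
  rewrite (@big_cat_nat _ _ _ (k.-1 - j)) //=; last by lia.
  rewrite big_nat_cond big1 ?add0r; last first.
    move=> j' /andP[/andP[_ j'k] _]; rewrite iter_sum big1 // => l _.
    rewrite iterZ.
    rewrite block_iter; last first. clear -j'k k0. lia.
    rewrite leqNgt. rewrite j'k /=. by rewrite scaler0.
  rewrite [RHS](@big_cat_nat _ _ _ j.+1) //= [X in _ = _ + X]big_nat_cond [X in _ = _ + X]big1 ?addr0; last first.
    by move=> j' /andP[/andP[jj' _] _]; rewrite big1 // => l _; rewrite leqNgt jj' scale0r.
  rewrite -{1}[(k.-1 - j)%N]add0n big_addn (_ : (k - (k.-1 - j) = j.+1)%N); last by lia.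
  apply: eq_big_nat => j' /andP[_ j'j]; rewrite -ltnS j'j iter_sum; apply: eq_bigr => l _.
  by rewrite iterZ block_iter ?leq_addl ?addnK //; lia.
have -> := @block_eq (fun j' i' => A j' j i' i)
  (fun j' i' => if (j' <= j)%N then A (j' + (k.-1 - j))%N k.-1 i' i else 0) E m i' mk.
by case: ifP; rewrite ?mxE.
Qed.

End Operator.

Lemma pact_top (q : {poly K}) i :
  pact f q (b k.-1 i) = \sum_(j < k) q`_(k.-1 - j) *: b j i.
Proof.
have kk : (k.-1 < k)%N by rewrite prednK.
rewrite (@pact_wide _ _ _ (size q + k) q) ?leq_addr //.
rewrite -(big_mkord xpredT (fun j => q`_j *: iter j f (b k.-1 i))) (@big_cat_nat _ _ _ k) ?leq_addl //=.
rewrite [X in _ + X]big_nat_cond [X in _ + X]big1 ?addr0; last first.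
  move=> j /andP[/andP[kj _] _]; rewrite block_iter // ifN ?scaler0 //; lia.
rewrite big_nat_rev /= big_mkord; apply: eq_bigr => j _.
have jk := ltn_ord j; rewrite add0n block_iter // ifT; last by lia.
by congr (_`__ *: b _ _); lia.
Qed.

(** With [pact_top_span] this says that G is free over K[X]/(X^k) on the last block. *)
Lemma pact_top_free (q : 'I_p -> {poly K}) :
  \sum_i pact f (q i) (b k.-1 i) = 0 -> forall i, exists r, q i = 'X^k * r.
Proof.
move=> q0 i; exists (drop_poly k (q i)).
rewrite -[LHS](poly_take_drop k) mulrC [X in X + _](_ : _ = 0) ?add0r //.
apply/polyP => m; rewrite coef_take_poly coef0; case: ifP => // mk.
have := @block_free (fun j i => (q i)`_(k.-1 - j)) _ (k.-1 - m)%N i.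
rewrite (_ : (k.-1 - (k.-1 - m) = m)%N); last by lia.
apply; last by lia.
rewrite -[RHS]q0 exchange_big; apply: eq_bigr => l _; by rewrite pact_top.
Qed.

Lemma pact_top_span v : G v -> exists q : 'I_p -> {poly K},
  v = \sum_i pact f (q i) (b k.-1 i).
Proof.
move=> /block_span[a ->]; exists (fun i => \poly_(m < k) a (k.-1 - m)%N i).
rewrite exchange_big; apply: eq_bigr => i _; rewrite pact_top; apply: eq_bigr => j _.
by have jk := ltn_ord j; rewrite coef_poly ifT ?subKn //; lia.
Qed.

End Fixed.

(* G is free over K[f]/(f^k) on the last block b k.-1, and s is K[f]-linear: its
   matrix over K[X] is defined up to conjugation and multiples of X^k, and the trace of the corner
   block is the coefficient of X^(k-1) in its trace. *)
Lemma block_trace (b b' : nat -> 'I_p -> V) (s : V -> V) (A A' : nat -> nat -> 'M[K]_p) :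
  block_basis b -> block_basis b' ->
  (forall a u v, s (a *: u + v) = a *: s u + s v) -> (forall v, s (f v) = f (s v)) ->
  block_matrix b s A -> block_matrix b' s A' -> \tr (A 0%N k.-1) = \tr (A' 0%N k.-1).
Proof.
move=> bb bb' ls sf As As'.
have kk : (k.-1 < k)%N by rewrite prednK.
(* The matrix of s over K[X] on the last block: f^m takes that block to block k - 1 - m, so the row
   of that number carries the coefficient of X^m. *)
pose lift (B : nat -> nat -> 'M[K]_p) : 'M[{poly K}]_p :=
  \matrix_(i', i) \poly_(m < k) B (k.-1 - m)%N k.-1 i' i.
have liftE (c : nat -> 'I_p -> V) B : block_basis c -> block_matrix c s B ->
    forall i, s (c k.-1 i) = \sum_i' pact f (lift B i' i) (c k.-1 i').
  move=> cc Bs i; rewrite Bs // exchange_big; apply: eq_bigr => i' _.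
  rewrite (pact_top cc); apply: eq_bigr => j _; have jk := ltn_ord j.
  by rewrite mxE coef_poly ifT ?subKn //; lia.
have tr_lift B : (\tr (lift B))`_k.-1 = \tr (B 0%N k.-1).
  by rewrite /mxtrace coef_sum; apply: eq_bigr => i _; rewrite mxE coef_poly kk subnn.
have change c c' : block_basis c -> block_basis c' -> exists P : 'M[{poly K}]_p,
    forall i, c' k.-1 i = \sum_i' pact f (P i' i) (c k.-1 i').
  move=> cc cc'; have [q qE] := choice (fun i => pact_top_span cc (block_mem cc' i kk)).
  by exists (\matrix_(i', i) q i i') => i; rewrite qE; apply: eq_bigr => i' _; rewrite mxE.
have uniq c (M N : 'M[{poly K}]_p) : block_basis c ->
    (forall i, \sum_i' pact f (M i' i) (c k.-1 i') = \sum_i' pact f (N i' i) (c k.-1 i')) ->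
    exists D, M = N + 'X^k *: D.
  move=> cc H; have H' (x : 'I_p * 'I_p) : exists r, M x.1 x.2 - N x.1 x.2 = 'X^k * r.
    apply: (pact_top_free cc (q := fun i' => M i' x.2 - N i' x.2)).
    under eq_bigr => i' _ do rewrite -[M _ _ - _]addrC -scaleN1r pact_linl scaleN1r addrC.
    by rewrite sumrB H subrr.
  have [D DE] := choice H'; exists (\matrix_(i, j) D (i, j)).
  by apply/matrixP => i j; rewrite !mxE -DE addrC subrK.
have pact_mul c (M N : 'M[{poly K}]_p) i : \sum_i' pact f (N i' i) (\sum_i'' pact f (M i'' i') (c i''))
    = \sum_i'' pact f ((M *m N) i'' i) (c i'').
  have pact_sumr q (F : 'I_p -> V) : pact f q (\sum_l F l) = \sum_l pact f q (F l).
    apply: (big_morph (pact f q)); last exact: (pact0r lf).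
    by move=> u v; rewrite -[u]scale1r (pact_linr lf) !scale1r.
  under eq_bigr => i' _ do rewrite pact_sumr.
  rewrite exchange_big; apply: eq_bigr => i'' _; rewrite mxE (pact_sum f).
  by apply: eq_bigr => i' _; rewrite -(pactM lf) mulrC.
have s_pact q v : s (pact f q v) = pact f q (s v).
  have si n w : s (iter n f w) = iter n f (s w) by elim: n => //= n <-; rewrite sf.
  have s0 : s 0 = 0 by have := ls (-1) 0 0; rewrite scaleN1r addNr scaleN1r addNr.
  rewrite /pact (big_morph s (id1 := 0) (op1 := +%R)) //.
    by apply: eq_bigr => m _; rewrite -[_ *: _]addr0 ls s0 addr0 si.
  by move=> u w; rewrite -[u]scale1r ls !scale1r.
have s_sum (F : 'I_p -> V) : s (\sum_l F l) = \sum_l s (F l).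
  apply: (big_morph s); last by have := ls (-1) 0 0; rewrite scaleN1r addNr scaleN1r addNr.
  by move=> u v; rewrite -[u]scale1r ls !scale1r.
have [P PE] := change b b' bb bb'; have [Q QE] := change b' b bb' bb.
have [D1 e1] : exists D, lift A *m P = P *m lift A' + 'X^k *: D.
  apply: (uniq b) => // i; rewrite -!pact_mul.
  transitivity (s (b' k.-1 i)).
    rewrite PE s_sum; apply: eq_bigr => i' _; rewrite s_pact; congr pact.
    by rewrite (liftE b A).
  rewrite (liftE b' A') //; apply: eq_bigr => i' _; congr pact; exact: PE.
have one c i : \sum_i' pact f ((1%:M : 'M[{poly K}]_p) i' i) (c k.-1 i') = c k.-1 i :> V.
  rewrite (bigD1 i) //= mxE eqxx -[1 *+ _]/(1%:P) (pactC) scale1r big1 ?addr0 // => i' ii'.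
  by rewrite mxE (negbTE ii') /= mulr0n /pact size_poly0 big_ord0.
have [D2 e2] : exists D, Q *m P = 1%:M + 'X^k *: D.
  apply: (uniq b') => // i; rewrite -pact_mul one [RHS]PE.
  by apply: eq_bigr => i' _; rewrite -QE.
have [D3 e3] : exists D, P *m Q = 1%:M + 'X^k *: D.
  apply: (uniq b) => // i; rewrite -pact_mul one [RHS]QE.
  by apply: eq_bigr => i' _; rewrite -PE.
(* The two matrices are conjugate modulo X^k; multiples of X^k do not show in the coefficient of
   X^(k-1). *)
have t1 : \tr (Q *m (lift A *m P)) = \tr (lift A') + 'X^k * \tr (D2 *m lift A' + Q *m D1).
  rewrite e1 mulmxDr mulmxA e2 mulmxDl mul1mx -scalemxAl -scalemxAr -addrA -scalerDr.
  by rewrite [LHS]mxtraceD mxtraceZ.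
have t2 : \tr (Q *m (lift A *m P)) = \tr (lift A) + 'X^k * \tr (lift A *m D3).
  by rewrite mxtrace_mulC -mulmxA e3 mulmxDr mulmx1 -scalemxAr mxtraceD mxtraceZ.
have := congr1 (fun q : {poly K} => q`_k.-1) t1; rewrite t2 !coefD !coefXnM kk !addr0.
by rewrite !tr_lift.
Qed.

End BlockBasis.

(** * Partition numbers *)

(** The number of partitions of l into parts at most n; [part l] counts all partitions of l. *)
Definition npart (n l : nat) : nat := size (enum_words (n + l).+1 n l).
Definition part (l : nat) : nat := size (gwords (- l%:Z)).

Lemma npart_fuel N n l : (n + l < N)%N -> size (enum_words N n l) = npart n l.
Proof.
move=> nlN; apply/perm_size/uniq_perm; try exact: uniq_enum_words.
by move=> w; rewrite !mem_enum_words.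
Qed.

Lemma npart00 n : npart n 0 = 1%N.
Proof. by rewrite /npart; case: n. Qed.

Lemma npart0S l : npart 0 l.+1 = 0%N. Proof. by []. Qed.

Lemma npartS n l : npart n.+1 l =
  (npart n l + (if (n < l)%N then npart n.+1 (l - n.+1) else 0))%N.
Proof.
case: l => [|l]; first by rewrite !npart00.
have E N : enum_words N.+1 n.+1 l.+1 = enum_words N n l.+1 ++
  (if (n < l.+1)%N then [seq rcons w (- n.+1%:Z) | w <- enum_words N n.+1 (l.+1 - n.+1)]
   else [::]) by [].
rewrite {1}/npart E size_cat npart_fuel; last by lia.
by case: ifP => nl //; rewrite size_map npart_fuel //; lia.
Qed.

Lemma npart_part n l : (l <= n)%N -> npart n l = part l.
Proof.
move=> ln; apply/perm_size/uniq_perm; [exact: uniq_enum_words|exact: uniq_gwords|].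
move=> w; rewrite mem_enum_words // mem_gwords; apply/and3P/andP => [[-> _ ->]//|[gw sw]].
split=> //; apply/allP => a aw; have := wsum_mem (good_all gw) aw.
by rewrite (eqP sw); lia.
Qed.

Lemma npart_le n l : (npart n l <= part l)%N.
Proof.
apply: uniq_leq_size => [|w]; first exact: uniq_enum_words.
by rewrite mem_enum_words // mem_gwords => /and3P[-> _ ->].
Qed.

Section RealBounds.
Variables (R : realType) (x : R).
Hypotheses (x0 : 0 <= x) (x1 : x < 1).

Let D (m n : nat) : R := \prod_(m <= j < n) (1 - x ^+ j).

Let f01 j : (0 < j)%N -> 0 < 1 - x ^+ j <= 1.
Proof.
move=> j0; rewrite subr_gt0 exprn_ilt1 ?lerBlDr ?lerDl ?exprn_ge0 //.
by case: j j0.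
Qed.

(** Weierstrass' product inequality. *)
Lemma prod_weierstrass m n : (0 < m)%N -> 1 - \sum_(m <= j < n) x ^+ j <= D m n.
Proof.
move=> m0; rewrite /D; elim: n => [|n IH]; first by rewrite !big_geq ?subr0.
case: (leqP m n) => mn; last by rewrite !big_geq ?subr0.
rewrite !big_nat_recr //=; have /andP[fn _] := f01 (leq_trans m0 mn).
apply: le_trans (ler_wpM2r (ltW fn) IH).
set s := \sum_(_ <= _ < _) _; have s0 : 0 <= s by apply: sumr_ge0 => j _; exact: exprn_ge0.
have xn := exprn_ge0 n x0; rewrite -subr_ge0.
have -> : (1 - s) * (1 - x ^+ n) - (1 - (s + x ^+ n)) = s * x ^+ n by ring.
exact: mulr_ge0.
Qed.

Lemma geometric_sum_le m n : (1 - x) * \sum_(m <= j < n) x ^+ j <= x ^+ m.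
Proof.
case: (leqP m n) => mn; last by rewrite big_geq ?mulr0 ?exprn_ge0 // ltnW.
have -> : (1 - x) * \sum_(m <= j < n) x ^+ j = x ^+ m - x ^+ n.
  elim: n mn => [|n IH]; first by rewrite leqn0 => /eqP ->; rewrite big_geq // mulr0 subrr.
  rewrite leq_eqVlt => /predU1P[->|mn]; first by rewrite big_geq // mulr0 subrr.
  by rewrite big_nat_recr //= mulrDr IH // exprS; ring.
by rewrite gerBl exprn_ge0.
Qed.

(** Once x^m <= (1 - x)/2, the tail sum of x^j from m on is at most 1/2, and so the tail product is
    at least 1/2. *)
Lemma D_lower : exists2 del : R, 0 < del & forall n, del <= D 1 n.
Proof.
have [m m0 xm] : exists2 m, (0 < m)%N & x ^+ m <= (1 - x) / 2.
  have := @cvg_expr _ x; rewrite ger0_norm // => /(_ x1) /cvgrPdist_le H.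
  have e0 : 0 < (1 - x) / 2 by rewrite divr_gt0 // subr_gt0.
  have [N _ /(_ N.+1 (leqnSn _))] := H _ e0.
  by rewrite /= sub0r normrN ger0_norm ?exprn_ge0 // => xN; exists N.+1.
have Dpos a b : (0 < a)%N -> 0 < D a b.
  move=> a0; rewrite /D big_nat_cond; apply: prodr_gt0 => j /andP[/andP[aj _] _].
  by have /andP[] := f01 (leq_trans a0 aj).
have D1 a b : (0 < a)%N -> D a b <= 1.
  move=> a0; rewrite /D big_nat_cond.
  suff /andP[] : 0 <= \prod_(a <= j < b | (a <= j < b)%N && true) (1 - x ^+ j) <= 1 by [].
  elim/big_ind: _ => [|y z /andP[y0 y1] /andP[z0 z1]|j /andP[/andP[aj _] _]].
  - by rewrite ler01 lexx.
  - by rewrite mulr_ge0 //= mulr_ile1.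
  - by have /andP[/ltW -> ->] := f01 (leq_trans a0 aj).
have half n : 2^-1 <= D m n.
  apply: le_trans (prod_weierstrass n m0).
  have s2 : \sum_(m <= j < n) x ^+ j <= 2^-1.
    have p1 : 0 < 1 - x by rewrite subr_gt0.
    by rewrite -(ler_pM2l p1); apply: le_trans xm; exact: geometric_sum_le.
  by move: s2; set s := \sum_(_ <= _ < _) _ => s2; lra.
exists (D 1 m / 2); first by rewrite divr_gt0 ?Dpos.
move=> n; case: (leqP m n) => mn.
  have -> : D 1 n = D 1 m * D m n by rewrite /D -big_cat_nat.
  by apply: ler_wpM2l; [exact/ltW/Dpos|exact: half].
apply: (@le_trans _ _ (D 1 m)).
  by rewrite ler_pdivrMr // ler_peMr ?(ltW (Dpos _ _ _)) // ler1n.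
case: n mn => [|n] mn; first by rewrite {2}/D big_geq ?D1.
have -> : D 1 m = D 1 n.+1 * D n.+1 m by rewrite /D -big_cat_nat // ltnW.
by rewrite ger_pMr ?Dpos // D1.
Qed.

(** A truncated form of Euler's identity, by induction on n; truncation turns the equality into an
    inequality uniform in N and n. *)
Lemma npart_bound n N : D 1 n.+1 * \sum_(l < N) (npart n l)%:R * x ^+ l <= 1.
Proof.
elim: n => [|n IH].
  rewrite /D big_geq // mul1r; case: N => [|N]; first by rewrite big_ord0.
  by rewrite big_ord_recl npart00 mulr1 big1 ?addr0 // => i _; rewrite npart0S mul0r.
apply: le_trans IH; rewrite /D big_nat_recr //= -mulrA; apply: ler_wpM2l.
  rewrite big_nat_cond; apply: prodr_ge0 => j /andP[/andP[j0 _] _].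
  by have /andP[/ltW] := f01 j0.
rewrite mulrBl mul1r lerBlDr mulr_sumr.
have -> : \sum_(l < N) (npart n.+1 l)%:R * x ^+ l = \sum_(l < N) (npart n l)%:R * x ^+ l
   + \sum_(l < N) (if (n < l)%N then (npart n.+1 (l - n.+1))%:R * x ^+ l else 0).
  rewrite -big_split; apply: eq_bigr => l _ /=; rewrite npartS.
  by case: ifP => _; rewrite ?addn0 ?addr0 // natrD mulrDl.
rewrite lerD2l -(big_mkord xpredT (fun l => if (n < l)%N then (npart n.+1 (l - n.+1))%:R * x ^+ l else 0)).
rewrite -(big_mkord xpredT (fun l => x ^+ n.+1 * ((npart n.+1 l)%:R * x ^+ l))).
case: (leqP n.+1 N) => nN; last first.
  rewrite big_nat_cond big1 ?sumr_ge0 // => [l _|l /andP[/andP[_ lN] _]].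
    by rewrite !mulr_ge0 ?exprn_ge0.
  by rewrite ifN //; lia.
rewrite (@big_cat_nat _ _ _ n.+1) //= big_nat_cond big1 ?add0r; last first.
  by move=> l /andP[/andP[_ ln] _]; rewrite ltnNge -ltnS ln.
rewrite -{1}[n.+1]add0n big_addn.
rewrite [X in _ <= X](@big_cat_nat _ _ _ (N - n.+1)) ?leq_subr //=.
apply: (@le_trans _ _ (\sum_(0 <= l < N - n.+1) x ^+ n.+1 * ((npart n.+1 l)%:R * x ^+ l))).
  apply: ler_sum => l _; rewrite addnK ifT; last by rewrite leq_addl.
  by rewrite exprD mulrA mulrC.
by rewrite lerDl sumr_ge0 // => l _; rewrite !mulr_ge0 ?exprn_ge0.
Qed.

Lemma part_bound : exists M : R, forall N, \sum_(l < N) (part l)%:R * x ^+ l <= M.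
Proof.
have [del d0 dD] := D_lower; exists del^-1 => N.
have := npart_bound N N; rewrite (eq_bigr (fun l : 'I_N => (part l)%:R * x ^+ l)) => [H|l _]; last first.
  by rewrite npart_part // ltnW.
have s0 : 0 <= \sum_(l < N) (part l)%:R * x ^+ l.
  by apply: sumr_ge0 => l _; rewrite mulr_ge0 ?exprn_ge0.
rewrite -[del^-1]mul1r ler_pdivlMr // mulrC; apply: le_trans H.
exact: ler_wpM2r.
Qed.

End RealBounds.

(** * Series of complex numbers *)

Lemma sum_nat_tail (V : zmodType) (F : nat -> V) m n : (m <= n)%N ->
  \sum_(m <= l < n) F l = \sum_(0 <= l < n) F l - \sum_(0 <= l < m) F l.
Proof.
move=> mn; apply/eqP; rewrite eq_sym subr_eq addrC; apply/eqP.
exact: (@big_cat_nat _ _ _ m 0 n).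
Qed.

Section ComplexSums.
Variable R : realType.
Local Notation C := R[i].
Implicit Types (z w : C) (t : nat -> C).

(* the modulus as an element of R; in R[i] the norm is complex-valued *)
Definition nc z : R := complex.Re `|z|.

Lemma ncE z : `|z| = (nc z)%:C%C.
Proof. by rewrite /nc normc_def. Qed.

Lemma nc_ge0 z : 0 <= nc z.
Proof. by rewrite -ler0c -ncE. Qed.

Lemma ncM z w : nc (z * w) = nc z * nc w.
Proof. by apply: (@complexI R); rewrite rmorphM /= -!ncE normrM. Qed.

Lemma ncD z w : nc (z + w) <= nc z + nc w.
Proof. by rewrite -lecR rmorphD /= -!ncE ler_normD. Qed.

Lemma ncN z : nc (- z) = nc z.
Proof. by rewrite /nc normrN. Qed.

Lemma ncB z w : nc (z - w) = nc (w - z).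
Proof. by rewrite -ncN opprB. Qed.

Lemma nc0 : nc 0 = 0. Proof. by rewrite /nc normr0. Qed.
Lemma nc1 : nc 1 = 1. Proof. by rewrite /nc normr1. Qed.

Lemma ncX z n : nc (z ^+ n) = nc z ^+ n.
Proof. by elim: n => [|n IH]; rewrite ?expr0 ?nc1 // !exprS ncM IH. Qed.

Lemma nc_real (x : R) : nc x%:C%C = `|x|.
Proof. by rewrite /nc normc_def /= expr0n addr0 sqrtr_sqr. Qed.

Lemma nc_nat n : nc n%:R = n%:R.
Proof. by rewrite /nc normr_nat -(rmorph_nat (real_complex R)). Qed.

Lemma nc_eq0 z : (nc z == 0) = (z == 0).
Proof. by rewrite -(inj_eq (@complexI R)) -ncE normr_eq0. Qed.

Lemma nc_sum (I : Type) (s : seq I) (P : pred I) (F : I -> C) :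
  nc (\sum_(i <- s | P i) F i) <= \sum_(i <- s | P i) nc (F i).
Proof.
elim/big_rec2: _ => [|i y x _ H]; first by rewrite nc0.
by apply: le_trans (ncD _ _) _; rewrite lerD2l.
Qed.

Lemma nc_Re z : `|complex.Re z| <= nc z.
Proof.
by rewrite /nc normc_def /= -sqrtr_sqr ler_wsqrtr // lerDl sqr_ge0.
Qed.

Lemma nc_Im z : `|complex.Im z| <= nc z.
Proof.
by rewrite /nc normc_def /= -sqrtr_sqr ler_wsqrtr // lerDr sqr_ge0.
Qed.

Lemma nc_ReIm z : nc z <= `|complex.Re z| + `|complex.Im z|.
Proof.
rewrite -ler_sqr ?nnegrE ?nc_ge0 ?addr_ge0 //.
rewrite {1}/nc normc_def /= sqr_sqrtr ?addr_ge0 ?sqr_ge0 // sqrrD.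
have sq (a : R) : `|a| ^+ 2 = a ^+ 2 by rewrite -normrX ger0_norm ?sqr_ge0.
rewrite !sq addrAC lerDl.
by rewrite mulrn_wge0 // mulr_ge0.
Qed.

Lemma pos_real (e : C) : 0 < e -> exists2 x : R, 0 < x & e = x%:C%C.
Proof.
case: e => a b; rewrite ltcE /= => /andP[/eqP -> a0].
by exists a.
Qed.

(** Positive elements of R[i] are real, so real radii suffice. *)
Lemma ccvgP (T : Type) (F : set_system T) (FF : Filter F) (f : T -> C^o) (l : C^o) :
  f @ F --> l <-> forall e : R, 0 < e -> \forall x \near F, nc (l - f x) <= e.
Proof.
rewrite cvgrPdist_le; split=> H e e0.
  have : 0 < e%:C%C by rewrite ltcR.
  by move=> /H; apply: filterS => x; rewrite ncE lecR.
have [x x0 ->] := pos_real e0.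
by have := H x x0; apply: filterS => y; rewrite ncE lecR.
Qed.

(** Convergence along all finite sets that contain a long initial segment; it serves both ordinary
    series and sums over finite sets of weights. *)
Lemma abs_sum t (M : R) : (forall N, \sum_(l < N) nc (t l) <= M) ->
  exists s : C, forall e : R, 0 < e -> exists N0, forall J : seq nat, uniq J ->
    (forall l, (l < N0)%N -> l \in J) -> nc (s - \sum_(l <- J) t l) <= e.
Proof.
move=> tM.
have scvg (u : nat -> R) : (forall l, `|u l| <= nc (t l)) -> cvgn (series u).
  move=> ut; apply: normed_cvg; apply: nondecreasing_is_cvgn.
    apply/nondecreasing_seqP => n; rewrite /normed_series_of /= /series /=.
    by rewrite big_nat_recr //= lerDl.
  exists M => _ [n _ <-]; rewrite /normed_series_of /series /= big_mkord; apply: le_trans (tM n).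
  by apply: ler_sum => l _.
have cR := scvg _ (fun l => nc_Re (t l)); have cI := scvg _ (fun l => nc_Im (t l)).
have cN : cvgn (series (fun l => nc (t l))).
  by apply: scvg => l; rewrite ger0_norm ?nc_ge0.
pose s : C := Complex (limn (series (fun l => complex.Re (t l))))
                      (limn (series (fun l => complex.Im (t l)))).
exists s => e e0.
have e4 : 0 < e / 4 by rewrite divr_gt0.
have [N0 _ HN] := (cvgrPdist_le _ _).1 cN _ e4.
have [N1 _ HR] := (cvgrPdist_le _ _).1 cR _ e4.
have [N2 _ HI] := (cvgrPdist_le _ _).1 cI _ e4.
exists N0 => J uJ J0.
pose N := maxn (maxn N0 (\max_(l <- J) l).+1) (maxn N1 N2).
have JN l : l \in J -> (l < N)%N.
  move=> lJ; rewrite /N; apply: leq_trans (leq_maxl _ _); apply: leq_trans (leq_maxr _ _).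
  by rewrite ltnS (big_rem l lJ) /= leq_maxl.
have sN : nc (s - \sum_(l < N) t l) <= e / 2.
  apply: le_trans (nc_ReIm _) _; rewrite (_ : e / 2 = e / 4 + e / 4); last by field.
  have RS n : complex.Re (\sum_(l < n) t l) = series (fun l => complex.Re (t l)) n.
    rewrite /series /= big_mkord; elim/big_rec2: _ => // i y x _ <-.
    by case: (t i) => a b; case: (x) => a' b'.
  have IS n : complex.Im (\sum_(l < n) t l) = series (fun l => complex.Im (t l)) n.
    rewrite /series /= big_mkord; elim/big_rec2: _ => // i y x _ <-.
    by case: (t i) => a b; case: (x) => a' b'.
  have rB (a b : C) : complex.Re (a - b) = complex.Re a - complex.Re b by case: a; case: b.
  have iB (a b : C) : complex.Im (a - b) = complex.Im a - complex.Im b by case: a; case: b.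
  rewrite rB iB RS IS; apply: lerD; [apply: HR|apply: HI] => /=;
    apply: leq_trans (leq_maxr _ _); [exact: leq_maxl|exact: leq_maxr].
have JE : \sum_(l <- J) t l = \sum_(0 <= l < N | l \in J) t l.
  rewrite -[RHS]big_filter; apply: perm_big; apply: uniq_perm => //.
    by rewrite filter_uniq // iota_uniq.
  move=> l; rewrite mem_filter mem_index_iota /=; case: (boolP (l \in J)) => //= /JN.
  by move=> ->.
have dN : nc (\sum_(l < N) t l - \sum_(l <- J) t l) <= e / 2.
  rewrite JE -(big_mkord xpredT t) (bigID (fun l => l \in J)) /= addrAC subrr add0r.
  apply: le_trans (nc_sum _ _ _) _.
  apply: (@le_trans _ _ (\sum_(N0 <= l < N) nc (t l))).
    have N0N : (N0 <= N)%N by rewrite /N -maxnA leq_maxl.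
    rewrite (@big_cat_nat _ _ _ N0) //= big_nat_cond big1 ?add0r.
      rewrite [X in X <= _]big_mkcond; apply: ler_sum => l _; case: ifP => // _.
      exact: nc_ge0.
    by move=> l /andP[/andP[_ /J0 ->]].
  have sE : \sum_(N0 <= l < N) nc (t l) = series (fun l => nc (t l)) N - series (fun l => nc (t l)) N0.
    by apply: sum_nat_tail; rewrite /N -maxnA leq_maxl.
  have N0N : (N0 <= N)%N by rewrite /N -maxnA leq_maxl.
  have h1 := HN N0 (leqnn _); have h2 := HN N N0N.
  rewrite sE; move: h1 h2 => /=; rewrite !ler_norml => /andP[h1 h1'] /andP[h2 h2'].
  lra.
rewrite -(subrK (\sum_(l < N) t l) s) -addrA; apply: le_trans (ncD _ _) _.
by rewrite (_ : e = e / 2 + e / 2); [exact: lerD|field].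
Qed.

Definition abs_bounded t := exists M : R, forall N, \sum_(l < N) nc (t l) <= M.

Definition csum t : C := limn (series (t : nat -> C^o)).

Lemma csum_eq t s : series (t : nat -> C^o) @ \oo --> (s : C^o) -> csum t = s.
Proof. by move=> H; exact: (cvg_lim (@norm_hausdorff _ _) H). Qed.

Lemma csumP t : abs_bounded t -> forall e : R, 0 < e -> exists N0, forall J : seq nat, uniq J ->
    (forall l, (l < N0)%N -> l \in J) -> nc (csum t - \sum_(l <- J) t l) <= e.
Proof.
move=> [M tM]; have [s sP] := abs_sum tM; suff -> : csum t = s by [].
apply: csum_eq; apply/ccvgP => e e0; have [N0 H] := sP e e0.
exists N0 => // n /= nN0; apply: H; first exact: iota_uniq.
by move=> l lN; rewrite mem_index_iota (leq_trans lN).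
Qed.

Lemma csum_cvg t : abs_bounded t -> series (t : nat -> C^o) @ \oo --> (csum t : C^o).
Proof.
move=> bt; apply/ccvgP => e e0; have [N0 H] := csumP bt e0.
exists N0 => // n /= nN0; apply: H; first exact: iota_uniq.
by move=> l lN; rewrite mem_index_iota (leq_trans lN).
Qed.

Lemma csum_tail t N (M : R) : abs_bounded t ->
  (forall N', \sum_(N <= l < N') nc (t l) <= M) -> nc (csum t - \sum_(0 <= l < N) t l) <= M.
Proof.
move=> bt tM; apply/ler_addgt0Pr => e e0; have [N0 H] := csumP bt e0.
pose N' := maxn N0 N; have NN' : (N <= N')%N by exact: leq_maxr.
have := H (index_iota 0 N') (iota_uniq _ _) => H'.
have {}H' : nc (csum t - \sum_(0 <= l < N') t l) <= e.
  by apply: H' => l lN; rewrite mem_index_iota (leq_trans lN) // leq_maxl.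
rewrite -(subrK (\sum_(0 <= l < N') t l) (csum t)) -addrA.
apply: le_trans (ncD _ _) _; rewrite [leRHS]addrC; apply: lerD => //.
rewrite -sum_nat_tail //.
by apply: le_trans (nc_sum _ _ _) _.
Qed.

Lemma csum_le t (M : R) : (forall N, \sum_(l < N) nc (t l) <= M) -> nc (csum t) <= M.
Proof.
move=> tM; have bt : abs_bounded t by exists M.
have := @csum_tail t 0 M bt; rewrite big_geq // subr0; apply => N'.
by rewrite big_mkord.
Qed.

Lemma abs_bounded_lin t t' a : abs_bounded t -> abs_bounded t' ->
  abs_bounded (fun l => a * t l + t' l).
Proof.
move=> [M tM] [M' tM']; exists (nc a * M + M') => N.
apply: (@le_trans _ _ (\sum_(l < N) (nc a * nc (t l) + nc (t' l)))).
  by apply: ler_sum => l _; rewrite -ncM ncD.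
rewrite big_split -mulr_sumr /=; apply: lerD; last exact: tM'.
by apply: ler_wpM2l; [exact: nc_ge0|exact: tM].
Qed.

Lemma csum_lin t t' a : abs_bounded t -> abs_bounded t' ->
  csum (fun l => a * t l + t' l) = a * csum t + csum t'.
Proof.
move=> bt bt'; apply: csum_eq.
have -> : series (fun l => a * t l + t' l : C^o) = (fun n => a *: (series (t : nat -> C^o) n) + series (t' : nat -> C^o) n).
  by apply/funext => n; rewrite /series /= big_split -scaler_sumr.
by apply: cvgD; [apply: cvgZr; exact: csum_cvg|exact: csum_cvg].
Qed.

Lemma csum_shift t m : abs_bounded t ->
  csum (fun l => if (m <= l)%N then t (l - m)%N else 0) = csum t.
Proof.
move=> bt; apply: csum_eq; rewrite -(cvg_shiftn m).
have -> : (fun n => series (fun l => if (m <= l)%N then t (l - m)%N else 0 : C^o) (n + m)%N)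
   = series (t : nat -> C^o).
  apply/funext => n; rewrite /series /= (@big_cat_nat _ _ _ m) ?leq_addl //=.
  rewrite big_nat_cond big1 ?add0r; last first.
    by move=> l /andP[/andP[_ lm] _]; rewrite leqNgt lm.
  rewrite -{1}[m]add0n big_addn addnK; apply: eq_bigr => l _.
  by rewrite leq_addl addnK.
exact: csum_cvg.
Qed.

Lemma abs_bounded_shift t m : abs_bounded t ->
  abs_bounded (fun l => if (m <= l)%N then t (l - m)%N else 0).
Proof.
move=> [M tM]; exists M => N; case: (leqP m N) => mN.
  rewrite -(big_mkord xpredT (fun l => nc (if (m <= l)%N then t (l - m)%N else 0))).
  rewrite (@big_cat_nat _ _ _ m) //= big_nat_cond big1 ?add0r; last first.
    by move=> l /andP[/andP[_ lm] _]; rewrite leqNgt lm nc0.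
  rewrite -{1}[m]add0n big_addn big_mkord; apply: le_trans (tM (N - m)%N).
  by apply: ler_sum => l _; rewrite leq_addl addnK.
rewrite big1; first by apply: le_trans (tM 0%N); rewrite big_ord0.
by move=> l _; rewrite leqNgt (ltn_trans (ltn_ord l)) ?nc0.
Qed.

Lemma abs_bounded_le t (u : nat -> R) (M : R) : (forall l, nc (t l) <= u l) ->
  (forall N, \sum_(l < N) u l <= M) -> abs_bounded t.
Proof.
by move=> tu uM; exists M => N; apply: le_trans (uM N); apply: ler_sum => l _.
Qed.

(** A function on C supported on the sequence [lam] is summed along finite subsets of C; these pull
    back to finite sets of indices. *)
Lemma csum_totally (lam : nat -> C) t (g : C -> C^o) : injective lam -> abs_bounded t ->
  (forall l, g (lam l) = t l) -> (forall x, (forall l, x <> lam l) -> g x = 0) ->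
  summability.partial_sum g @ summability.totally --> (csum t : C^o).
Proof.
have tF : ProperFilter (@summability.totally C) := summability.totally_filter.
move=> lam_inj bt gl g0; apply/ccvgP => e e0; have [N0 H] := csumP bt e0.
have [idx idxP] : exists idx : C -> option nat, forall x,
    (if idx x is Some l then x = lam l else forall l, x <> lam l).
  suff /choice[idx H'] : forall x, exists o : option nat,
      (if o is Some l then x = lam l else forall l, x <> lam l) by exists idx.
  move=> x; case: (pselect (exists l, x = lam l)) => [[l xl]|nx]; first by exists (Some l).
  by exists None => l xl; apply: nx; exists l.
pose A0 : {fset C} := seq_fset tt [seq lam l | l <- iota 0 N0].
exists A0 => // A /= A0A.
have -> : summability.partial_sum g A = \sum_(l <- pmap idx A) t l.
  rewrite /summability.partial_sum -(@big_seq_fsetE _ _ _ _ A xpredT g) /= big_pmap.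
  apply: eq_bigr => x _; have := idxP x; case: (idx x) => [l ->|/g0 //]; exact: gl.
apply: H.
  rewrite (@pmap_uniq _ _ idx lam) ?fset_uniq // => x /=.
  by have := idxP x; case: (idx x).
move=> l lN; rewrite mem_pmap; apply/mapP; exists (lam l).
  have : lam l \in A0 by rewrite seq_fsetE map_f // mem_iota.
  by move/(fsubsetP A0A).
have := idxP (lam l); case: (idx (lam l)) => [l' /lam_inj -> //|nl].
by case: (nl l).
Qed.

(** * Euler's product for the partition numbers *)

Section Partitions.
Variable q : C.
Hypothesis q1 : nc q < 1.
Local Notation x := (nc q).

Lemma part_abs : abs_bounded (fun l => (part l)%:R * q ^+ l).
Proof.
have [M HM] := part_bound (nc_ge0 q) q1; exists M => N; apply: le_trans (HM N).
by apply: ler_sum => l _; rewrite ncM nc_nat ncX.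
Qed.

Lemma part_abs_le (a : nat -> nat) : (forall l, (a l <= part l)%N) ->
  abs_bounded (fun l => (a l)%:R * q ^+ l).
Proof.
move=> ap; have [M HM] := part_bound (nc_ge0 q) q1.
apply: (@abs_bounded_le _ (fun l => (part l)%:R * nc q ^+ l) M) => [l|]; last exact: HM.
rewrite ncM nc_nat ncX; apply: ler_wpM2r; first by rewrite exprn_ge0 ?nc_ge0.
by rewrite ler_nat.
Qed.

Let A := csum (fun l => (part l)%:R * q ^+ l).
Let An n := csum (fun l => (npart n l)%:R * q ^+ l).
Let Pn n := \prod_(1 <= j < n.+1) (1 - q ^+ j).

Let An_abs n := part_abs_le (npart_le n).

(** Euler's identity for parts at most n, from the recurrence [npartS]. *)
Lemma prod_npart n : Pn n * An n = 1.
Proof.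
elim: n => [|n IH].
  rewrite /Pn big_geq // mul1r; apply: csum_eq; apply/ccvgP => e e0; exists 1%N => // N /= N1.
  rewrite /series /= (@big_cat_nat _ _ _ 1) //= big_nat1 npart00 expr0 mulr1 big_nat_cond big1.
    by rewrite addr0 subrr nc0 ltW.
  by move=> [|l] //; rewrite npart0S mul0r.
suff E : An n = (1 - q ^+ n.+1) * An n.+1.
  by rewrite /Pn big_nat_recr //= -mulrA -E.
have : An n.+1 = An n + q ^+ n.+1 * An n.+1; last by move=> e; rewrite mulrBl mul1r {1}e addrK.
have bs := abs_bounded_shift n.+1 (An_abs n.+1).
rewrite {3}/An -(csum_shift n.+1 (An_abs n.+1)) addrC -csum_lin //; congr csum.
apply/funext => l; rewrite npartS; case: ifP => nl; last by rewrite addn0 mulr0 add0r.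
by rewrite natrD mulrDl addrC mulrCA -exprD subnKC.
Qed.

(** [An n] tends to [A], as [npart n l] and [part l] differ only for l > n. The bound |P_n| <= 1/del
    keeps |A_n| above del, so the limit is nonzero and inverses converge. *)
Lemma part_lim : Pn @ \oo --> (A^-1 : C^o).
Proof.
have [del d0 dD] := D_lower (nc_ge0 q) q1.
have Pn0 n : Pn n != 0 by apply/eqP => e; have := prod_npart n; rewrite e mul0r => /esym/eqP; rewrite oner_eq0.
have PnE n : Pn n = (An n)^-1.
  have An0 : An n != 0 by apply/eqP => e; have := prod_npart n; rewrite e mulr0 => /esym/eqP; rewrite oner_eq0.
  by apply: (mulIf An0); rewrite prod_npart mulVf.
have ncPn n : nc (Pn n) * del <= 1.
  apply: (@le_trans _ _ (nc (Pn n) * \prod_(1 <= j < n.+1) (1 - x ^+ j))).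
    by rewrite ler_wpM2l ?nc_ge0.
  have -> : nc (Pn n) = \prod_(1 <= j < n.+1) nc (1 - q ^+ j).
    exact: (big_morph nc ncM nc1).
  rewrite -big_split /= big_nat_cond.
  (* |1 - q^j| (1 - x^j) <= (1 + x^j)(1 - x^j) <= 1. *)
  have f01 j : 0 <= nc (1 - q ^+ j) * (1 - x ^+ j) <= 1.
    have xj0 : 0 <= x ^+ j by rewrite exprn_ge0 ?nc_ge0.
    have xj1 : x ^+ j <= 1 by rewrite exprn_ile1 ?nc_ge0 // ltW.
    rewrite mulr_ge0 ?nc_ge0 ?subr_ge0 //=.
    apply: (@le_trans _ _ ((1 + x ^+ j) * (1 - x ^+ j))).
      apply: ler_wpM2r; first by rewrite subr_ge0.
      by have := ncD 1 (- q ^+ j); rewrite nc1 ncN ncX.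
    by rewrite -subr_ge0 (_ : _ - _ = x ^+ j * x ^+ j); [exact: mulr_ge0|ring].
  suff /andP[] : 0 <= \prod_(1 <= i < n.+1 | (1 <= i < n.+1)%N && true)
      (nc (1 - q ^+ i) * (1 - x ^+ i)) <= 1 by [].
  elim/big_ind: _ => [|y z /andP[y0 y1] /andP[z0 z1]|j _]; last exact: f01.
    by rewrite ler01 lexx.
  by rewrite mulr_ge0 //= mulr_ile1.
have ncAn n : del <= nc (An n).
  have := congr1 nc (prod_npart n); rewrite ncM nc1 => e.
  have p0 : 0 < nc (Pn n) by rewrite lt_neqAle nc_ge0 eq_sym nc_eq0 Pn0.
  by rewrite -(ler_pM2l p0) e.
have Acvg : (An : nat -> C^o) @ \oo --> (A : C^o).
  have [M HM] := part_bound (nc_ge0 q) q1.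
  have cN : cvgn (series (fun l => (part l)%:R * x ^+ l)).
    apply: nondecreasing_is_cvgn.
      apply/nondecreasing_seqP => n; rewrite /series /= big_nat_recr //= lerDl.
      by rewrite mulr_ge0 ?exprn_ge0 ?nc_ge0.
    by exists M => _ [n _ <-]; rewrite /series /= big_mkord.
  apply/ccvgP => e e0; have e2 : 0 < e / 2 by rewrite divr_gt0.
  have [N0 _ HN] := (cvgrPdist_le _ _).1 cN _ e2.
  exists N0 => // n /= N0n.
  have -> : A - An n = csum (fun l => (part l - npart n l)%N%:R * q ^+ l).
    rewrite addrC -mulN1r -csum_lin //; last exact: part_abs.
    by congr csum; apply/funext => l; rewrite natrB ?npart_le // mulN1r mulrBl addrC.
  apply: csum_le => N.
  apply: (@le_trans _ _ (\sum_(n <= l < maxn n N) (part l)%:R * x ^+ l)); last first.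
    have sE : \sum_(n <= l < maxn n N) (part l)%:R * x ^+ l =
      series (fun l => (part l)%:R * x ^+ l) (maxn n N) - series (fun l => (part l)%:R * x ^+ l) n.
      exact: sum_nat_tail (leq_maxl _ _).
    have h1 := HN n N0n; have h2 := HN (maxn n N) (leq_trans N0n (leq_maxl _ _)).
    rewrite sE; move: h1 h2 => /=; rewrite !ler_norml => /andP[h1 h1'] /andP[h2 h2'].
    lra.
  have p0 l : 0 <= (part l)%:R * x ^+ l by rewrite mulr_ge0 ?exprn_ge0 ?nc_ge0.
  apply: (@le_trans _ _ (\sum_(0 <= l < maxn n N) nc ((part l - npart n l)%N%:R * q ^+ l))).
    rewrite -(big_mkord xpredT (fun l => nc ((part l - npart n l)%N%:R * q ^+ l))).
    rewrite [X in _ <= X](@big_cat_nat _ _ _ N) ?leq_maxr //= lerDl.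
    by apply: sumr_ge0 => l _; exact: nc_ge0.
  rewrite (@big_cat_nat _ _ _ n) ?leq_maxl //= big_nat_cond big1 ?add0r.
    apply: ler_sum => l _; rewrite ncM nc_nat ncX ler_wpM2r ?exprn_ge0 ?nc_ge0 //.
    by rewrite ler_nat leq_subr.
  by move=> l /andP[/andP[_ ln] _]; rewrite npart_part ?subnn ?mul0r ?nc0 // ltnW.
have A0 : A != 0.
  apply/eqP => e; have d2 : 0 < del / 2 by rewrite divr_gt0.
  have [N _ /(_ N (leqnn _))] := (ccvgP _ _ _).1 Acvg _ d2.
  rewrite e /= sub0r ncN => H; have := le_trans (ncAn N) H; lra.
have -> : Pn = (fun n => (An n)^-1) by apply/funext => n; exact: PnE.
exact: cvgV.
Qed.

End Partitions.

End ComplexSums.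

(** * Complex derivatives *)

Lemma is_derive_compC (K : numFieldType) (f g : K^o -> K^o) (x df dg : K^o) :
  is_derive x 1 f df -> is_derive (f x) 1 g dg -> is_derive x 1 (g \o f) (dg * df : K).
Proof.
move=> [/derivable1_diffP Df f2] [/derivable1_diffP Dg g2].
split; first exact/derivable1_diffP/differentiable_comp.
rewrite -f2 -g2 -!derive1E (derive1E' (differentiable_comp Df Dg)) diff_comp //.
rewrite (derive1E' Df) (derive1E' Dg) /= -[X in 'd _ _ X = _]mulr1.
by rewrite [LHS]linearZ mulrC.
Qed.

Section ComplexDerivatives.
Variable R : realType.
Local Notation C := R[i].
Implicit Types (z w u : C).

Lemma cexpD z w : cexp (z + w) = cexp z * cexp w.
Proof.
case: z => a b; case: w => a' b'; rewrite /cexp /= expRD cosD sinD rmorphM /=.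
rewrite mulrACA; congr (_ * _).
by apply/eqP; rewrite eq_complex /=; apply/andP; split; apply/eqP; ring.
Qed.

Lemma cexp0 : cexp (0 : C) = 1.
Proof. by rewrite /cexp /= expR0 cos0 sin0 mul1r. Qed.

Lemma nc_cexp z : nc (cexp z) = expR (complex.Re z).
Proof.
rewrite /cexp ncM nc_real ger0_norm ?expR_ge0 // -[RHS]mulr1; congr (_ * _).
by rewrite /nc normc_def /= cos2Dsin2 sqrtr1.
Qed.

Lemma cexp_neq0 z : cexp z != 0.
Proof. by rewrite -nc_eq0 nc_cexp gt_eqF ?expR_gt0. Qed.

Lemma qpowD u a b : qpow u (a + b) = qpow u a * qpow u b.
Proof. by rewrite /qpow mulrDl cexpD. Qed.

Lemma qpow0 u : qpow u 0 = 1.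
Proof. by rewrite /qpow mul0r cexp0. Qed.

Lemma qpow_neq0 u a : qpow u a != 0.
Proof. exact: cexp_neq0. Qed.

Lemma qpowN u a : qpow u (- a) = (qpow u a)^-1.
Proof.
by apply: (mulIf (qpow_neq0 u a)); rewrite mulVf ?qpow_neq0 // -qpowD addNr qpow0.
Qed.

Lemma qpow_nat u n : qpow u n%:R = qpow u 1 ^+ n.
Proof.
elim: n => [|n IH]; first by rewrite qpow0.
by rewrite -addn1 natrD qpowD IH exprD expr1.
Qed.

Lemma nc_q u : 0 < complex.Im u -> nc (qpow u 1) < 1.
Proof.
move=> u0; rewrite /qpow mul1r /logq nc_cexp expR_lt1.
case: u u0 => a b /= b0; rewrite mul0r sub0r oppr_lt0.
by rewrite !mulr_gt0 // pi_gt0.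
Qed.

Lemma is_derive_nc (f : C^o -> C^o) z l :
  (forall e : R, 0 < e -> exists2 d : R, 0 < d & forall w, nc w < d ->
     nc (f (z + w) - f z - w * l) <= e * nc w) -> is_derive (z : C^o) 1 f l.
Proof.
move=> H.
have L : (fun k : C^o => k^-1 *: ((f \o shift (z : C^o)) (k *: (1 : C^o)) - f z)) @ 0^' --> (l : C^o).
  apply/ccvgP => e e0; have [d d0 Hd] := H e e0.
  have d0' : 0 < d%:C%C by rewrite ltcR.
  exists d%:C%C => //= k; rewrite /ball_ /= sub0r normrN ncE ltcR => kd k0.
  have Hk := Hd k kd; have nk : 0 < nc k by rewrite lt_neqAle nc_ge0 eq_sym nc_eq0 k0.
  rewrite -(ler_pM2l nk) [leRHS]mulrC; apply: le_trans Hk.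
  rewrite -ncM le_eqVlt; apply/orP; left; apply/eqP; rewrite -[LHS]ncN; congr nc.
  rewrite /shift /= [k *: 1](_ : _ = k); last exact: mulr1.
  rewrite -[k^-1 *: _]/(k^-1 * _) mulrBr mulrA mulfV // mul1r opprB [k + z]addrC.
  by [].
split; [by apply/cvg_ex; exists l|exact: cvg_lim L].
Qed.

(** The functional equation reduces the claim to 0, where it follows from the real derivatives of
    exp, cos and sin. *)
Lemma is_derive_cexp z : is_derive (z : C^o) 1 (fun v : C^o => cexp v : C^o) (cexp z).
Proof.
have lin (g : R -> R) (l : R) : is_derive (0 : R) 1 g l -> forall e : R, 0 < e ->
    exists2 d : R, 0 < d & forall a, `|a| < d -> `|g a - g 0 - a * l| <= e * `|a|.
  move=> [g1 g2] e e0; move: g1; rewrite /derivable => g1.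
  have L : (fun k : R => k^-1 *: ((g \o shift 0) (k *: (1 : R)) - g 0)) @ 0^' --> l.
    by move: g2; rewrite /derive => <-; exact: g1.
  have [d /= d0 Hd] := (cvgrPdist_le _ _).1 L e e0; exists d => // a ad.
  have [->|a0] := eqVneq a 0; first by rewrite mul0r subrr subr0 normr0 mulr0.
  have := Hd a; rewrite /= sub0r normrN => /(_ ad a0) Ha.
  have na : 0 < `|a| by rewrite normr_gt0.
  rewrite -(ler_pM2l na) [leRHS]mulrC in Ha; apply: le_trans Ha.
  rewrite -normrM le_eqVlt; apply/orP; left; apply/eqP; rewrite -[LHS]normrN; congr (`|_|).
  rewrite /shift /= addr0 [a *: 1](_ : _ = a); last exact: mulr1.
  by rewrite -[a^-1 *: _]/(a^-1 * _) mulrBr mulrA mulfV // mul1r opprB.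
have He := lin _ _ (is_derive_expR (0 : R)); rewrite expR0 in He.
have Hc := lin _ _ (is_derive_cos (0 : R)); rewrite sin0 oppr0 cos0 in Hc.
have Hs := lin _ _ (is_derive_sin (0 : R)); rewrite cos0 sin0 in Hs.
apply: is_derive_nc => e e0.
(* Below, real and imaginary parts are bounded by 4 e1 |w| and 5 e1 |w|; 10 covers their sum. *)
pose e1 := Num.min 1 (e / (10 * nc (cexp z))).
have nz : 0 < nc (cexp z) by rewrite nc_cexp expR_gt0.
have e10 : 0 < e1 by rewrite lt_min ltr01 divr_gt0 // mulr_gt0.
have e11 : e1 <= 1 by rewrite ge_min lexx.
have e12 : e1 <= e / (10 * nc (cexp z)) by rewrite ge_min lexx orbT.
clearbody e1.
have [d1 d10 H1] := He e1 e10; have [d2 d20 H2] := Hc e1 e10; have [d3 d30 H3] := Hs e1 e10.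
exists (Num.min e1 (Num.min d1 (Num.min d2 d3))); first by rewrite !lt_min e10 d10 d20.
move=> w; rewrite !lt_min => /and4P[we w1 w2 w3].
rewrite cexpD -[X in _ - X - _]mulr1 [w * _]mulrC -!mulrBr ncM.
suff B : nc (cexp w - 1 - w) <= 10 * e1 * nc w.
  apply: (@le_trans _ _ (nc (cexp z) * (10 * e1 * nc w))); first by rewrite ler_wpM2l ?nc_ge0.
  rewrite !mulrA ler_wpM2r ?nc_ge0 //.
  move: e12; rewrite ler_pdivlMr ?mulr_gt0 //; apply: le_trans; rewrite le_eqVlt; apply/orP; left; apply/eqP; ring.
have aw := nc_Re w; have bw := nc_Im w.
case: w we w1 w2 w3 aw bw => a b /= we w1 w2 w3 aw bw.
have h1 := H1 a (le_lt_trans aw w1); rewrite mulr1 in h1.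
have h2 := H2 b (le_lt_trans bw w2); rewrite mulr0 subr0 in h2.
have h3 := H3 b (le_lt_trans bw w3); rewrite mulr1 subr0 in h3.
apply: le_trans (nc_ReIm _) _; rewrite /cexp /=.
set n := nc (a +i* b)%C in we aw bw *; have n0 : 0 <= n := nc_ge0 _.
rewrite !mul0r subr0 addr0 oppr0 !addr0.
have ea0 := expR_ge0 a.
have ea3 : expR a <= 3.
  have : expR a - 1 - a <= e1 * `|a| by apply: le_trans h1; exact: ler_norm.
  have : a <= `|a| by exact: ler_norm.
  nra.
have ea1 : `|expR a - 1| <= 2 * n.
  have -> : expR a - 1 = (expR a - 1 - a) + a by ring.
  apply: le_trans (ler_normD _ _) _; have na := normr_ge0 a; nra.
have na := normr_ge0 a; have nb := normr_ge0 b.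
have r1 : `|expR a * cos b - 1 - a| <= 4 * e1 * n.
  have -> : expR a * cos b - 1 - a = (expR a - 1 - a) + expR a * (cos b - 1) by ring.
  apply: le_trans (ler_normD _ _) _; rewrite normrM (ger0_norm ea0).
  have nc1' := normr_ge0 (cos b - 1).
  have t1 : e1 * `|a| <= e1 * n by rewrite ler_wpM2l // ltW.
  have t2 : e1 * `|b| <= e1 * n by rewrite ler_wpM2l // ltW.
  have t3 : expR a * `|cos b - 1| <= 3 * `|cos b - 1| by rewrite ler_wpM2r.
  lra.
have r2 : `|expR a * sin b - b| <= 5 * e1 * n.
  have -> : expR a * sin b - b = expR a * (sin b - b) + (expR a - 1) * b by ring.
  apply: le_trans (ler_normD _ _) _; rewrite !normrM (ger0_norm ea0).
  have ns := normr_ge0 (sin b - b).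
  have t2 : e1 * `|b| <= e1 * n by rewrite ler_wpM2l // ltW.
  have t3 : expR a * `|sin b - b| <= 3 * `|sin b - b| by rewrite ler_wpM2r.
  have t4 : `|expR a - 1| * `|b| <= 2 * n * `|b| by rewrite ler_wpM2r.
  have t5 : n * `|b| <= e1 * n.
    apply: (@le_trans _ _ (e1 * `|b|)) => //; by rewrite ler_wpM2r // ltW.
  lra.
have t0 : 0 <= e1 * n by rewrite mulr_ge0 // ltW.
by have := lerD r1 r2; rewrite -![_ * e1 * n]mulrA => H; lra.
Qed.

Lemma is_derive_qpow u a :
  is_derive (u : C^o) 1 (fun v : C^o => qpow v a : C^o) (twopii R * a * qpow u a).
Proof.
have D1 : is_derive (u : C^o) 1 (fun v : C^o => a * (twopii R * v) : C^o) (a * twopii R).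
  apply: is_derive_nc => e e0; exists 1 => // w _.
  rewrite (_ : _ - _ = 0) ?nc0 ?mulr_ge0 ?nc_ge0 ?(ltW e0) //; ring.
have := is_derive_compC D1 (is_derive_cexp (a * (twopii R * u))).
by rewrite /qpow /logq mulrC [a * twopii R]mulrC.
Qed.

(** * Termwise differentiation of power series *)

Section PowerSeries.
Variable a : nat -> nat.
Hypothesis ap : forall l, (a l <= part l)%N.

Let t q (l : nat) : C := (a l)%:R * q ^+ l.
Let t' q (l : nat) : C := (a l)%:R * (l%:R * q ^+ l.-1).

(** The first order remainder of (q + w)^l is a polynomial in q and w with nonnegative coefficients,
    divisible by w^2; hence it is at most (|w|/eta)^2 times its value at |q| and eta. *)
Lemma power_step (q w : C) (eta : R) l : 0 < eta -> nc w <= eta ->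
  nc ((q + w) ^+ l - q ^+ l - w * (l%:R * q ^+ l.-1)) <=
    (nc w / eta) ^+ 2 * ((nc q + eta) ^+ l - nc q ^+ l - eta * (l%:R * nc q ^+ l.-1))
  /\ 0 <= (nc q + eta) ^+ l - nc q ^+ l - eta * (l%:R * nc q ^+ l.-1).
Proof.
move=> eta0 we; have q0 := nc_ge0 q; have w0 := nc_ge0 w.
(* The recursion for the remainder in l, with nonnegative terms at |q| and eta. *)
have stepE (K : comNzRingType) (x y : K) m :
    (x + y) ^+ m.+1 - x ^+ m.+1 - y * (m.+1%:R * x ^+ m) =
    (x + y) * ((x + y) ^+ m - x ^+ m - y * (m%:R * x ^+ m.-1)) + y ^+ 2 * (m%:R * x ^+ m.-1).
  case: m => [|m]; first by rewrite !expr0 expr1 /=; ring.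
  rewrite /= -[m.+2%:R]/(m.+1.+1%:R) -natr1 -natr1 !exprS; ring.
elim: l => [|l [IH1 IH2]].
  by rewrite !expr0 !mul0r !mulr0 !subrr ?subr0 nc0 mulr0.
set s := nc w / eta in IH1 *; have s0 : 0 <= s by rewrite divr_ge0 // ltW.
have s_eta : s * eta = nc w by rewrite divfK // gt_eqF.
rewrite /= !stepE; set e := (nc q + eta) ^+ l - _ - _ in IH1 IH2 *.
set E := nc (_ - _ - _) in IH1.
have lq : 0 <= l%:R * nc q ^+ l.-1 by rewrite mulr_ge0 ?exprn_ge0.
have qe0 : 0 <= nc q + eta by rewrite addr_ge0 // ltW.
split; last by apply: addr_ge0; apply: mulr_ge0 => //; exact: sqr_ge0.
apply: le_trans (ncD _ _) _; rewrite (ncM (q + w)) (ncM (w ^+ 2)) (ncM l%:R) !ncX nc_nat -/E.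
have -> : s ^+ 2 * ((nc q + eta) * e + eta ^+ 2 * (l%:R * nc q ^+ l.-1)) =
  (nc q + eta) * (s ^+ 2 * e) + nc w ^+ 2 * (l%:R * nc q ^+ l.-1) by rewrite -s_eta; ring.
rewrite lerD2r; apply: ler_pM => //; try exact: nc_ge0.
by apply: le_trans (ncD _ _) _; rewrite lerD2l.
Qed.

Lemma power_bounds (q : C) : nc q < 1 -> exists eta M : R, [/\ 0 < eta,
  (forall N, \sum_(l < N) (a l)%:R * (nc q + eta) ^+ l <= M) &
  forall N, \sum_(l < N) nc (t' q l) <= M / eta].
Proof.
move=> q1; pose eta := (1 - nc q) / 2; have e0 : 0 < eta by rewrite divr_gt0 // subr_gt0.
have r1 : nc q + eta < 1 by rewrite /eta; lra.
have q0 := nc_ge0 q; have r0 : 0 <= nc q + eta by rewrite addr_ge0 // ltW.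
have [M HM] := part_bound r0 r1; exists eta, M.
have HM' N : \sum_(l < N) (a l)%:R * (nc q + eta) ^+ l <= M.
  apply: le_trans (HM N); apply: ler_sum => l _.
  by rewrite ler_wpM2r ?exprn_ge0 // ler_nat.
split=> // N; rewrite ler_pdivlMr // mulr_suml; apply: le_trans (HM' N).
apply: ler_sum => l _; rewrite /t' !ncM !nc_nat ncX -mulrA ler_wpM2l //.
(* Nonnegativity of the remainder at |q| and eta gives eta l |q|^(l-1) <= (|q| + eta)^l. *)
have [_ H] := @power_step q 0 eta l e0 (eq_ind_r (fun x => x <= eta) (ltW e0) (nc0 R)).
have := exprn_ge0 l q0; rewrite mulrC; move: H; lra.
Qed.

Lemma is_derive_power (q : C) : nc q < 1 ->
  is_derive (q : C^o) 1 (fun x : C^o => csum (t x) : C^o) (csum (t' q)).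
Proof.
move=> q1; have [eta [M [e0 HM Ht']]] := power_bounds q1.
have M0 : 0 <= M by have := HM 0%N; rewrite big_ord0.
apply: is_derive_nc => e epos.
(* The total remainder is at most (|w|/eta)^2 M, which is below e |w| for |w| under the second
   bound; M + 1 avoids division by 0. *)
have dpos : 0 < Num.min eta (e * eta ^+ 2 / (M + 1)).
  by rewrite lt_min e0 divr_gt0 ?mulr_gt0 ?exprn_gt0 // ltr_wpDl.
exists (Num.min eta (e * eta ^+ 2 / (M + 1))) => // w; rewrite lt_min => /andP[we wd].
have q0 := nc_ge0 q.
have bt x : nc x <= nc q + eta -> abs_bounded (t x).
  move=> xq; exists M => N; apply: le_trans (HM N); apply: ler_sum => l _.
  by rewrite ncM nc_nat ncX ler_wpM2l // lerXn2r ?nnegrE ?nc_ge0 ?addr_ge0 ?(ltW e0).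
have b1 : abs_bounded (t (q + w)).
  by apply: bt; apply: le_trans (ncD _ _) _; rewrite lerD2l ltW.
have b2 : abs_bounded (t q) by apply: bt; rewrite lerDl ltW.
have b3 : abs_bounded (t' q) by exists (M / eta).
have -> : csum (t (q + w)) - csum (t q) - w * csum (t' q) =
    csum (fun l => (a l)%:R * ((q + w) ^+ l - q ^+ l - w * (l%:R * q ^+ l.-1))).
  have b12 := abs_bounded_lin (-1) b2 b1.
  transitivity (- w * csum (t' q) + (-1 * csum (t q) + csum (t (q + w)))); first by ring.
  rewrite -(csum_lin _ b2 b1) -(csum_lin _ b3 b12).
  by congr csum; apply/funext => l; rewrite /t /t'; ring.
apply: (@le_trans _ _ ((nc w / eta) ^+ 2 * M)).
  apply: csum_le => N; apply: (@le_trans _ _ ((nc w / eta) ^+ 2 * \sum_(l < N) (a l)%:R * (nc q + eta) ^+ l)).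
    rewrite mulr_sumr; apply: ler_sum => l _; rewrite ncM nc_nat.
    have [H1 H2] := @power_step q w eta l e0 (ltW we).
    rewrite [leRHS]mulrCA; apply: ler_wpM2l => //; apply: le_trans H1 _.
    apply: ler_wpM2l; first exact: sqr_ge0.
    have h1 := exprn_ge0 l q0; have h2 : 0 <= eta * (l%:R * nc q ^+ l.-1).
      by rewrite !mulr_ge0 ?exprn_ge0 // ltW.
    by rewrite -addrA gerDl -opprD oppr_le0 addr_ge0.
  by rewrite ler_wpM2l ?sqr_ge0.
have w0 := nc_ge0 w.
have e2 : 0 < eta ^+ 2 by rewrite exprn_gt0.
have -> : (nc w / eta) ^+ 2 * M = nc w * M / eta ^+ 2 * nc w by field; rewrite gt_eqF.
apply: ler_wpM2r => //; rewrite ler_pdivrMr //.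
have M1 : 0 < M + 1 by rewrite ltr_wpDl.
move: wd; rewrite ltr_pdivlMr // => wd; apply: le_trans (ltW wd).
by rewrite ler_wpM2l // lerDl.
Qed.

End PowerSeries.

End ComplexDerivatives.

(** * Strong interlocking and pseudo-traces *)

Lemma wdim_spec (K : fieldType) (V : lmodType K) (P : set V) :
  findim P -> exists e : 'I_(wdim P) -> V, is_basis P e.
Proof. by move=> [n [e be]]; rewrite (wdim_basis be); exists e. Qed.

Lemma submod_eq (R : pzRingType) (I : Type) (M : opmod R I) (P Q : submod M) :
  sset P = sset Q -> P = Q.
Proof.
case: P => A a; case: Q => B b /= e; case: B / e b => b.
by rewrite (Prop_irrelevance a b).
Qed.

Section Induced.
Variables (K : numFieldType) (c h : K) (k d : nat) (S : {ffun pbw d -> K}).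
Hypothesis k0 : (0 < k)%N.
Hypothesis S1 : forall b : pbw d, pbw_word b = nseq d (-1) -> S b = 1.
Hypothesis Spos : forall n : int, 0 < n -> op n (uact (pbw_elt S) (hwv c h)) = 0.
Hypothesis maxE : maxsub (Verma c h) = gen [set uact (pbw_elt S) (hwv c h)].
Local Notation W := (Wmod c h k).
Local Notation f := (@fW K c h k).
Hypothesis J_full : maxsub (Verma c h) `<=` (@topmap K c h k) @` Jset (@Mtop K c h k).
Variable Y : VirV c -> int -> {linear VirV c -> VirV c}.
Hypothesis hY : is_voa (vac c) (omega c) Y.
Variable YW : VirV c -> int -> {linear W -> W}.
Hypothesis hYW : is_voa_module (vac c) (omega c) Y YW.
Local Notation VW := (voa_opmod YW).
Local Notation L0 := (YW (omega c) 1 : VW -> VW).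
Local Notation filt := (@filt K c h k Y hY YW hYW).

Let fl := (fW_hom c h k).1.

Lemma gwt_linset mu : linset (gwt L0 mu).
Proof.
have [[l ->]|->] := weight_cases hYW mu; first by rewrite (gwt_L0 hYW); exact: Wdeg_lin.
by split=> // a u v -> ->; rewrite scaler0 addr0.
Qed.

Lemma iter_weight mu w n : gwt L0 mu w ->
  iter n (fun u => L0 u - mu *: u) w = iter n f w /\ gwt L0 mu (iter n f w).
Proof.
move=> gw; elim: n => [|n [IH IHg]]; first by [].
rewrite !iterS IH; have [fE fg] := fW_weight hYW IHg.
by split; [rewrite -fE|].
Qed.

Lemma soc_findim mu : findim (socle VW `&` gwt L0 mu).
Proof.
rewrite (socleE k0 J_full hY hYW); have [[l ->]|->] := weight_cases hYW mu.
  rewrite (gwt_L0 hYW); exists (size (rwords d l)).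
  by eexists; exact: (soc_basis k0 S1 Spos maxE J_full l).
exists 0%N, (fun _ => 0); split=> [[]//|a _ []//|v [_ ->]].
by exists (fun _ => 0); rewrite big_ord0.
Qed.

Lemma soc_dimE l : soc_dim (W := VW) L0 (h + l%:R) = size (rwords d l).
Proof.
rewrite /soc_dim (socleE k0 J_full hY hYW) (gwt_L0 hYW).
exact: (wdim_basis (soc_basis k0 S1 Spos maxE J_full l)).
Qed.

Lemma soc_dim_trivial mu : gwt L0 mu = [set 0] -> soc_dim (W := VW) L0 mu = 0%N.
Proof.
move=> e; have : is_basis (socle VW `&` gwt L0 mu) (fun _ : 'I_0 => 0).
  split=> [[]//|a _ []//|v [_]]; rewrite e => ->.
  by exists (fun _ => 0); rewrite big_ord0.
by move/wdim_basis.
Qed.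

Lemma weight_lift mu x : gwt L0 mu x -> f x = 0 -> exists2 y, gwt L0 mu y & iter k.-1 f y = x.
Proof.
have [[l ->]|->] := weight_cases hYW mu.
  by rewrite (gwt_L0 hYW); exact: (Wdeg_lift k0 J_full).
by move=> -> _; exists 0 => //; rewrite (hom0 (hom_iter _ (fW_hom c h k))).
Qed.

Lemma weight_block_basis mu : exists b : nat -> 'I_(soc_dim (W := VW) L0 mu) -> W,
  block_basis f k (gwt L0 mu) b /\ is_basis (socle VW `&` gwt L0 mu) (b 0%N).
Proof.
have [e be] := wdim_spec (soc_findim mu).
have [b [bb b0]] : exists b : nat -> 'I_(soc_dim (W := VW) L0 mu) -> W,
    block_basis f k (gwt L0 mu) b /\ b 0%N =1 e.
  apply: (block_basis_exists k0 fl (gwt_linset mu)).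
  - by move=> v /(fW_weight hYW)[].
  - by move=> v _; exact: iter_fW_k.
  - exact: weight_lift.
  - have -> // : [set x | f x = 0 /\ gwt L0 mu x] = socle VW `&` gwt L0 mu.
    by rewrite (socleE k0 J_full hY hYW).
by exists b; split=> //; rewrite (funext b0).
Qed.

Lemma jordan_block b : jordan_normalized (W := VW) (L0 := L0) k b ->
  (forall mu, is_basis (gwt L0 mu) (fun x : 'I_k * 'I_(soc_dim (W := VW) L0 mu) => b mu x.1 x.2)) ->
  forall mu, block_basis f k (gwt L0 mu) (b mu).
Proof.
move=> bn bb mu; split=> // j i jk; have [Gb _ _] := bb mu.
have [-> _] := fW_weight hYW (Gb (Ordinal jk, i)).
by rewrite /= (bn mu i j jk) addrAC subrr add0r.
Qed.

Lemma block_normalized b : (forall mu, block_basis f k (gwt L0 mu) (b mu)) ->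
  jordan_normalized (W := VW) (L0 := L0) k b.
Proof.
move=> bb mu i j jk; have [fE _] := fW_weight hYW (block_mem (bb mu) i jk).
have [_ /(_ j i jk) <-] := bb mu.
by rewrite fE addrC subrK.
Qed.

(** All operators concerned commute with f, so [block_toeplitz] makes every Jordan basis a strongly
    interlocked one. *)
Lemma block_si_family b : (forall mu, block_basis f k (gwt L0 mu) (b mu)) ->
  (forall mu, is_basis (socle VW `&` gwt L0 mu) (b mu 0%N)) ->
  si_family (W := VW) (L0 := L0) k b.
Proof.
move=> bb bs mu; split=> //; first by have [] := bb mu.
move=> s A sa _ As; have [ls cs] := op_alg_comm hY hYW sa.
have T m j := @block_toeplitz _ _ _ _ k0 fl _ _ _ (bb mu) s A cs As m j.
split=> [j j' /andP[jj' jk]|j jk|j jk].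
- by rewrite T // ?ifN //; lia.
- by rewrite (T j j) // (T 0%N 0%N) // leqnn leq0n; congr (A _ _); lia.
- by rewrite (T 0%N j) // leq0n.
Qed.

Lemma pstr_well_defined : well_defined_pstr (W := VW) L0 k.
Proof.
split.
  pose b mu := projT1 (cid (weight_block_basis mu)).
  have bP mu : block_basis f k (gwt L0 mu) (b mu) /\
     is_basis (socle VW `&` gwt L0 mu) (b mu 0%N).
    exact: (projT2 (cid (weight_block_basis mu))).
  exists b; split; last by apply: block_normalized => mu; have [] := bP mu.
  by apply: block_si_family => mu; have [] := bP mu.
move=> b b' sb nb sb' nb' s sa _ mu A A' As As'.
have [ls cs] := op_alg_comm hY hYW sa.
have bb := jordan_block nb (fun mu => let: And3 H _ _ := sb mu in H).
have bb' := jordan_block nb' (fun mu => let: And3 H _ _ := sb' mu in H).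
exact: (block_trace k0 fl (bb mu) (bb' mu) ls cs As As').
Qed.

(** The operators in the theorem are polynomials in f on each weight space. Their matrices are found
    in every normalized basis, so that membership in [op_alg] need not be known, for instance for
    [opexp]. *)
Lemma pstr_poly mu (s : VW -> VW) (a : nat -> K) :
  (forall w, gwt L0 mu w -> s w = \sum_(m < k) a m *: iter m f w) ->
  pstr L0 k mu s = a k.-1 * (soc_dim (W := VW) L0 mu)%:R.
Proof.
move=> sE; have kk : (k.-1 < k)%N by rewrite prednK.
pose A j' j : 'M[K]_(soc_dim (W := VW) L0 mu) := if (j' <= j)%N then (a (j - j')%N)%:M else 0.
have bA b : block_basis f k (gwt L0 mu) b -> block_matrix k b s A.
  move=> bb j i jk; rewrite (sE _ (block_mem bb i jk)).
  have -> : \sum_(m < k) a m *: iter m f (b j i) = \sum_(m < j.+1) a m *: b (j - m)%N i.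
    rewrite (big_ord_widen _ (fun m => a m *: b (j - m)%N i) jk) [RHS]big_mkcond.
    apply: eq_bigr => m _; rewrite (block_iter k0 fl bb) // ltnS.
    by case: ifP; rewrite ?scaler0.
  have -> : \sum_(j' < k) \sum_i' A j' j i' i *: b j' i' = \sum_(j' < j.+1) a (j - j')%N *: b j' i.
    rewrite (big_ord_widen _ (fun j' => a (j - j')%N *: b j' i) jk) [RHS]big_mkcond.
    apply: eq_bigr => j' _; rewrite ltnS /A; case: ifP => _; last first.
      by apply: big1 => i' _; rewrite mxE scale0r.
    rewrite (bigD1 i) //= mxE eqxx big1 ?addr0 // => i' ii'.
    by rewrite mxE (negbTE ii') scale0r.
  rewrite [RHS](reindex_inj rev_ord_inj); apply: eq_bigr => m _ /=.
  by have mj := ltn_ord m; rewrite subSS subKn.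
have tA : \tr (A 0%N k.-1) = a k.-1 * (soc_dim (W := VW) L0 mu)%:R.
  by rewrite /A leq0n subn0 mxtrace_scalar mulr_natr.
rewrite /pstr; apply: xget_unique.
  have [[b [sb nb]] _] := pstr_well_defined.
  exists b, A; split=> //.
  exact: (bA _ (jordan_block nb (fun mu => let: And3 H _ _ := sb mu in H) mu)).
move=> x [b [B [sb nb Bs ->]]]; rewrite -tA; congr (\tr _).
have bb := jordan_block nb (fun mu => let: And3 H _ _ := sb mu in H) mu.
apply/matrixP => i' i.
apply: (block_eq bb (a := fun j' i' => B j' k.-1 i' i) (a' := fun j' i' => A j' k.-1 i' i)) => //.
by rewrite -(Bs _ _ kk) (bA _ bb).
Qed.

(** f^j as a polynomial of degree less than k, equal to 0 when j >= k. *)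
Lemma sum_pick w j : \sum_(m < k) (m == j :> nat)%:R *: iter m f w = iter j f w.
Proof.
case: (ltnP j k) => jk.
  rewrite (bigD1 (Ordinal jk)) //= eqxx scale1r big1 ?addr0 // => m mj.
  by rewrite (_ : (m == j :> nat) = false) ?scale0r //; apply: negbTE; rewrite -val_eqE in mj.
rewrite big1 => [|m _]; last first.
  by rewrite (_ : (m == j :> nat) = false) ?scale0r //; apply/eqP; have := ltn_ord m; lia.
by rewrite -(subnK jk) iterD iter_fW_k (hom0 (hom_iter _ (fW_hom c h k))).
Qed.

Lemma pstr_vac mu j : pstr (W := VW) L0 k mu
    (fun w => (j`!%:R)^-1 *: YW (vac c) (0 - 1) (iter j (fun u => L0 u - mu *: u) w)) =
  (j`!%:R)^-1 * (k.-1 == j)%:R * (soc_dim (W := VW) L0 mu)%:R.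
Proof.
rewrite (@pstr_poly mu _ (fun m => (j`!%:R)^-1 * (m == j)%:R)) // => w gw.
rewrite (vm_vac hYW) (iter_weight j gw).1 -sum_pick scaler_sumr.
by apply: eq_bigr => m _; rewrite scalerA.
Qed.

(** o(omega) = L_0 = mu + f, so f^(k-1) arises from j = k - 1 and, through the nilpotent part, from
    j = k - 2. *)
Lemma pstr_omega mu j : pstr (W := VW) L0 k mu
    (fun w => (j`!%:R)^-1 *: YW (omega c) (2 - 1) (iter j (fun u => L0 u - mu *: u) w)) =
  (j`!%:R)^-1 * (mu * (k.-1 == j)%:R + (k.-1 == j.+1)%:R) * (soc_dim (W := VW) L0 mu)%:R.
Proof.
rewrite (@pstr_poly mu _ (fun m => (j`!%:R)^-1 * (mu * (m == j)%:R + (m == j.+1)%:R))) // => w gw.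
have [-> gi] := iter_weight j gw; have [fE _] := fW_weight hYW gi.
have -> : YW (omega c) (2 - 1) (iter j f w) = mu *: iter j f w + iter j.+1 f w.
  by rewrite iterS fE [RHS]addrC subrK.
rewrite -(sum_pick w j) -(sum_pick w j.+1) scaler_sumr -big_split scaler_sumr.
by apply: eq_bigr => m _; rewrite /= scalerA -scalerDl scalerA.
Qed.

(** The exponential sum is constant from k terms on, and z^(k-1)/(k-1)! is its coefficient of
    f^(k-1). *)
Lemma pstr_opexp mu z : pstr (W := VW) L0 k mu
    (opexp (W := VW) z (fun u => L0 u - mu *: u)) =
  z ^+ k.-1 / (k.-1)`!%:R * (soc_dim (W := VW) L0 mu)%:R.
Proof.
rewrite (@pstr_poly mu _ (fun m => z ^+ m / m`!%:R)) // => w gw.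
have E m : (k <= m)%N -> \sum_(j < m) (z ^+ j / j`!%:R) *: iter j (fun u => L0 u - mu *: u) w =
    \sum_(j < k) (z ^+ j / j`!%:R) *: iter j f w.
  move=> km; rewrite [RHS](big_ord_widen _ (fun j => (z ^+ j / j`!%:R) *: iter j f w) km).
  rewrite [RHS]big_mkcond; apply: eq_bigr => j _; rewrite (iter_weight j gw).1.
  case: ifP => // /negbT; rewrite -leqNgt => kj.
  by rewrite -(subnK kj) iterD iter_fW_k (hom0 (hom_iter _ (fW_hom c h k))) scaler0.
apply: xget_unique; first by exists k => // m /= /E ->.
by move=> u [m _ /(_ (maxn m k) (leq_maxl _ _)) ->]; rewrite E // leq_maxr.
Qed.

Lemma jordan_parts_deg l : jordan_parts (Wdeg c h k l) L0
  (fun w => (h + l%:R) *: w) (fun w => L0 w - (h + l%:R) *: w).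
Proof.
have L0f w : Wdeg c h k l w -> L0 w - (h + l%:R) *: w = f w.
  by rewrite -(gwt_L0 hYW) => /(fW_weight hYW)[->].
have lW := @Wdeg_lin K c h k l.
split=> [w _|w dw|w dw|w dw|].
- by rewrite addrC subrK.
- by split; [exact: (linsetZ _ lW)|rewrite L0f //; exact: Wdeg_fW].
- by rewrite scalerBr [in RHS]linearZ.
- by apply: sub_span; split=> //; exists (h + l%:R).
- exists k => w; rewrite -(gwt_L0 hYW) => gw.
  by rewrite (iter_weight k gw).1 iter_fW_k.
Qed.

Lemma generalized : is_generalized (W := VW) L0.
Proof.
split=> [w|mu|mu].
- have [n [x [dx ->]]] := Wdeg_sum w.
  apply: (linset_sum _ (@span_linset _ _ _)) => l _; apply: sub_span.
  by exists (h + l%:R); rewrite (gwt_L0 hYW).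
- by have [b [[bb _] _]] := weight_block_basis mu; exact: basis_reindex bb.
(* If mu - n0 = h + l0, any other weight mu - n = h + l has n + l = n0 + l0, which bounds n. *)
- case: (pselect (exists n l : nat, mu - n%:R = h + l%:R)) => [[n0 [l0 e0]]|H].
    exists (n0 + l0).+1 => n nN; apply: (gwt_L0_trivial hYW) => l e.
    have : (n + l)%N%:R = (n0 + l0)%N%:R :> K.
      have e1 : mu = h + l%:R + n%:R by rewrite -e subrK.
      have e2 : mu = h + l0%:R + n0%:R by rewrite -e0 subrK.
      apply: (addrI h); transitivity mu; [rewrite e1|rewrite e2]; rewrite natrD; ring.
    by move/eqP; rewrite eqr_nat => /eqP; lia.
  exists 0%N => n _; apply: (gwt_L0_trivial hYW) => l e; apply: H.
  by exists n, l.
Qed.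

Lemma strong_interlocking : strongly_interlocked (W := VW) L0 k.
Proof.
have u1 := uW1_neq0 (c := c) (h := h) k0.
split; first exact: generalized.
  split.
    apply: uniserial_indecomposable; first exact: (voa_uniserial k0 J_full hY hYW).
    by exists (uW c h k 1).
  move=> P; have [i ik PE] := voa_chain k0 J_full hY hYW (submodP P).
  have -> : P = filt i by exact: submod_eq.
  exists (filt (k - i)); split; first exact: (isomorphic_sym (filt_iso k0 J_full hY hYW ik)).
  apply: isomorphic_sym; have := filt_iso k0 J_full hY hYW (leq_subr i k).
  by rewrite subKn.
right; exists filt; split.
- split; first by apply/seteqP; split=> [w /= ->|w ->].
  by apply/seteqP; split=> // w _; exact: iter_fW_k.
- move=> j jk; split; first exact: filt_mono.
  (* u_{j+1} separates consecutive terms, since f^j u_{j+1} = u_1 <> 0. *)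
  move=> /(_ (uW c h k j.+1)) /=; rewrite iter_fW_u // subSn // subnn => H; apply: u1; apply: H.
  exact: (filt_u k0 hY hYW (ltn0Sn 0)).
- by move=> P; exact: (voa_chain k0 J_full hY hYW (submodP P)).
- by move=> j /andP[j0 _]; exact: (voa_indecomposable k0 J_full).
- by move=> j jk; exact: (filt_quo k0 J_full).
Qed.

End Induced.

(** * Graded pseudo-traces *)

(** Product rule for (log q)^(k-1), q^h and the power series in q. *)
Lemma is_derive_mul_exp (K : numFieldType) (C : K) (a b p : K^o -> K^o) (x da db dp : K^o) n :
  is_derive x 1 a da -> is_derive x 1 b db -> is_derive x 1 p dp ->
  is_derive x 1 (fun u : K^o => C * a u ^+ n.+1 * (b u * p u) : K^o)
    (C * (n.+1%:R * a x ^+ n * da * (b x * p x) + a x ^+ n.+1 * (b x * dp + p x * db)) : K).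
Proof.
move=> Da Db Dp.
have D1 : is_derive x 1 (fun u : K^o => a u ^+ n.+1 : K^o) (n.+1%:R * a x ^+ n * da : K).
  have -> : (fun u : K^o => a u ^+ n.+1 : K^o) = a ^+ n.+1 by rewrite exprfctE.
  exact: is_deriveX.
have D2 : is_derive x 1 (fun u : K^o => b u * p u : K^o) (b x * dp + p x * db : K).
  exact: is_deriveM.
have D3 : is_derive x 1 (fun u : K^o => a u ^+ n.+1 * (b u * p u) : K^o)
    (a x ^+ n.+1 * (b x * dp + p x * db) + b x * p x * (n.+1%:R * a x ^+ n * da) : K).
  exact: (is_deriveM D1 D2).
have -> : (fun u : K^o => C * a u ^+ n.+1 * (b u * p u) : K^o) =
    C \*: (fun u : K^o => a u ^+ n.+1 * (b u * p u) : K^o).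
  by apply/funext => u; rewrite /= -mulrA.
apply: is_derive_eq (is_deriveZ C D3) _.
by rewrite -[C *: _]/(C * _) addrC [_ * (_ * da)]mulrC.
Qed.

Section ComplexSeries.
Variable R : realType.
Local Notation C := R[i].

Lemma csum0 : csum (fun=> 0 : C) = 0.
Proof.
apply: csum_eq; apply/ccvgP => e e0; exists 0%N => // n _.
by rewrite /series /= big1 // subr0 nc0 ltW.
Qed.

Lemma abs_bounded0 : abs_bounded (fun=> 0 : C).
Proof. by exists 0 => N; rewrite big1 // => i _; rewrite nc0. Qed.

Lemma csumZ a (t : nat -> C) : abs_bounded t -> csum (fun l => a * t l) = a * csum t.
Proof.
move=> bt; rewrite -[RHS]addr0 -csum0 -(csum_lin a bt abs_bounded0).
by congr csum; apply/funext => l; rewrite addr0.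
Qed.

Lemma abs_boundedZ a (t : nat -> C) : abs_bounded t -> abs_bounded (fun l => a * t l).
Proof.
move=> bt; have := abs_bounded_lin a bt abs_bounded0.
by congr abs_bounded; apply/funext => l; rewrite addr0.
Qed.

Lemma csum_finite (u : nat -> C) N : (forall j, (N <= j)%N -> u j = 0) ->
  csum u = \sum_(j < N) u j.
Proof.
move=> u0; apply: csum_eq; apply/ccvgP => e e0; exists N => // n /= Nn.
rewrite -(big_mkord xpredT u) -ncB /series /= -(sum_nat_tail u Nn) big_nat_cond big1 ?nc0 ?ltW //.
by move=> j /andP[/andP[Nj _] _]; exact: u0.
Qed.

Lemma csum_delta (F G : nat -> C) m n :
  csum (fun j => (m == j)%:R * F j + (n == j)%:R * G j) = F m + G n.
Proof.
have delta (H : nat -> C) i N : (i < N)%N -> \sum_(j < N) (i == j)%:R * H j = H i.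
  move=> iN; rewrite (bigD1 (Ordinal iN)) //= eqxx mul1r big1 ?addr0 // => j ij.
  by rewrite (_ : (i == j :> nat) = false) ?mul0r //; apply: negbTE; rewrite eq_sym.
rewrite (@csum_finite _ (maxn m n).+1) => [|j mj]; last by rewrite !ltn_eqF ?mul0r ?addr0 //; lia.
by rewrite big_split /= !delta // ltnS ?leq_maxl ?leq_maxr.
Qed.

Lemma summability_sum (g : C -> C^o) s :
  summability.partial_sum g @ summability.totally --> (s : C^o) ->
  summability.sum g = s.
Proof.
have tF : ProperFilter (@summability.totally C) := summability.totally_filter.
exact: (cvg_lim (@norm_hausdorff _ _)).
Qed.

Lemma Im_gt0_near (u : C) : 0 < complex.Im u -> \forall v \near (u : C^o), 0 < complex.Im (v : C).
Proof.
move=> u0; have u0' : 0 < (complex.Im u)%:C%C by rewrite ltcR.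
exists (complex.Im u)%:C%C => //= v; rewrite /ball_ /= ncE ltcR => uv.
have := le_lt_trans (nc_Im _) uv.
have -> : complex.Im (u - v) = complex.Im u - complex.Im v by case: (u); case: (v).
by rewrite ltr_norml => /andP[_]; lra.
Qed.

Lemma twopii_neq0 : twopii R != 0.
Proof. by rewrite eq_complex /= eqxx /= mulf_neq0 // gt_eqF // pi_gt0. Qed.

Lemma abs_bounded_derivative (a : nat -> nat) (q : C) : (forall l, (a l <= part l)%N) ->
  nc q < 1 -> abs_bounded (fun l => (a l)%:R * (l%:R * q ^+ l.-1)).
Proof.
by move=> ap q1; have [eta [M [_ _ H]]] := power_bounds ap q1; exists (M / eta).
Qed.

Lemma eta_part (tau : C) : 0 < complex.Im tau ->
  eta tau = qpow tau 24^-1 * (csum (fun l => (part l)%:R * qpow tau 1 ^+ l))^-1.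
Proof.
move=> /nc_q q1; congr (_ * _).
have H := @part_lim R (qpow tau 1) q1.
have -> : (fun n => \prod_(1 <= j < n.+1) (1 - qpow tau j%:R) : C^o) =
    (fun n => \prod_(1 <= j < n.+1) (1 - qpow tau 1 ^+ j)).
  by apply/funext => n; apply: eq_bigr => j _; rewrite qpow_nat.
exact: (@cvg_lim (C^o : normedModType C) (@norm_hausdorff _ _) nat _ _ (fun n => _ : C^o) _ H).
Qed.

Lemma rwords_le d l : (size (rwords d l) <= part l)%N.
Proof. by rewrite /part -(size_gwords_ones d l) leq_addr. Qed.

(** The count of [size_gwords_ones], summed over l; the words of degree l - d give the shifted
    series. *)
Lemma rwords_series d (q : C) : nc q < 1 ->
  csum (fun l => (size (rwords d l))%:R * q ^+ l) =
  (1 - q ^+ d) * csum (fun l => (part l)%:R * q ^+ l).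
Proof.
move=> q1; have bp := part_abs q1; have bq := part_abs_le q1 (rwords_le d).
apply/eqP; rewrite mulrBl mul1r eq_sym subr_eq addrC; apply/eqP.
rewrite -{2}(csum_shift d bp) -(csum_lin _ (abs_bounded_shift d bp) bq).
congr csum; apply/funext => l.
rewrite {1}/part -(size_gwords_ones d l) natrD mulrDl addrC; congr (_ + _).
case: ifP => dl; last first.
  (* For l < d no good word has the positive letter sum d - l. *)
  rewrite mulr0 (_ : gwords (d%:Z - l%:Z) = [::]) ?mul0r //.
  case E : (gwords _) => [//|w s]; have := mem_head w s; rewrite -E mem_gwords.
  by move=> /andP[/good_all/wsum_le0 + /eqP]; lia.
rewrite mulrCA -exprD subnKC //; congr (_%:R * _); rewrite /part.
by congr (size (gwords _)); lia.
Qed.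

End ComplexSeries.

Section GradedPseudotrace.
Variables (R : realType) (c h : R[i]) (k' d : nat) (S : {ffun pbw d -> R[i]}).
Local Notation C := R[i].
(** Written so that k - 1 and k - 2, the powers of log q in the pseudo-traces, need no truncated
    subtraction. *)
Local Notation k := k'.+2.
Hypothesis S1 : forall b : pbw d, pbw_word b = nseq d (-1) -> S b = 1.
Hypothesis Spos : forall n : int, 0 < n -> op n (uact (pbw_elt S) (hwv c h)) = 0.
Hypothesis maxE : maxsub (Verma c h) = gen [set uact (pbw_elt S) (hwv c h)].
Local Notation W := (Wmod c h k).
Hypothesis J_full : maxsub (Verma c h) `<=` (@topmap C c h k) @` Jset (@Mtop C c h k).
Variable Y : VirV c -> int -> {linear VirV c -> VirV c}.
Hypothesis hY : is_voa (vac c) (omega c) Y.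
Variable YW : VirV c -> int -> {linear W -> W}.
Hypothesis hYW : is_voa_module (vac c) (omega c) Y YW.
Local Notation VW := (voa_opmod YW).
Local Notation L0 := (YW (omega c) 1 : VW -> VW).
Local Notation sd mu := (soc_dim (W := VW) L0 mu).
Local Notation p l := (size (rwords d l)).
Local Notation Pq q := (csum (fun l => (p l)%:R * q ^+ l)).
Local Notation Pq' q := (csum (fun l => (p l)%:R * (l%:R * q ^+ l.-1))).
Implicit Types (tau mu : C).

Let k0 : (0 < k)%N := ltn0Sn _.

Lemma pstr_term_vac tau mu : pstr_term (omega c) YW c k (vac c) 0 tau mu =
  ((k'.+1)`!%:R)^-1 * logq tau ^+ k'.+1 * (sd mu)%:R * qpow tau (mu - c / 24).
Proof.
congr (_ * _); pose F j : C := (j`!%:R)^-1 * (sd mu)%:R * logq tau ^+ j.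
transitivity (csum (fun j => (k'.+1 == j)%:R * F j + (k'.+1 == j)%:R * 0)).
  congr (limn (series _)); apply/funext => j.
  transitivity ((j`!%:R)^-1 * (k'.+1 == j)%:R * (sd mu)%:R * logq tau ^+ j : C).
    congr (_ * _); exact: (pstr_vac k0 S1 Spos maxE J_full hY hYW).
  by rewrite /F mulr0 addr0 !mulrA [_ * (j`!%:R)^-1]mulrC.
by rewrite (csum_delta F (fun=> 0)) addr0 /F mulrAC.
Qed.

Lemma pstr_term_omega tau mu : pstr_term (omega c) YW c k (omega c) 2 tau mu =
  (((k'.+1)`!%:R)^-1 * mu * logq tau ^+ k'.+1 + (k'`!%:R)^-1 * logq tau ^+ k') * (sd mu)%:R *
  qpow tau (mu - c / 24).
Proof.
congr (_ * _); pose F j : C := (j`!%:R)^-1 * mu * (sd mu)%:R * logq tau ^+ j.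
pose G j : C := (j`!%:R)^-1 * (sd mu)%:R * logq tau ^+ j.
transitivity (csum (fun j => (k'.+1 == j)%:R * F j + (k' == j)%:R * G j)).
  congr (limn (series _)); apply/funext => j.
  transitivity ((j`!%:R)^-1 * (mu * (k'.+1 == j)%:R + (k'.+1 == j.+1)%:R) * (sd mu)%:R
      * logq tau ^+ j : C).
    congr (_ * _); exact: (pstr_omega k0 S1 Spos maxE J_full hY hYW).
  rewrite eqSS /F /G; move: (j`!%:R)^-1 (_ == _)%:R (_ == _)%:R (sd mu)%:R => x y z u.
  by ring.
rewrite csum_delta /F /G; move: ((k'.+1)`!%:R)^-1 (k'`!%:R)^-1 (sd mu)%:R => x y z.
by ring.
Qed.

Let vac_coef tau : C := ((k'.+1)`!%:R)^-1 * logq tau ^+ k'.+1 * qpow tau (h - c / 24).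

Lemma qpow_weight tau l : qpow tau (h + l%:R - c / 24) = qpow tau (h - c / 24) * qpow tau 1 ^+ l.
Proof. by rewrite addrAC [LHS]qpowD qpow_nat. Qed.

(** Each term is a multiple of the dimension of the socle in that weight, hence zero off the weights
    h + l. *)
Lemma pstr_series (v : VirV c) n tau (t : nat -> C) : abs_bounded t ->
  (forall mu, exists x : C, pstr_term (omega c) YW c k v n tau mu = (sd mu)%:R * x) ->
  (forall l, pstr_term (omega c) YW c k v n tau (h + l%:R) = t l) ->
  pstr_cvg (omega c) YW c k v n tau /\ pstr_graded (omega c) YW c k v n tau = csum t.
Proof.
move=> bt T0 tE; have H : summability.partial_sum (pstr_term (omega c) YW c k v n tau)
    @ summability.totally --> (csum t : C^o).
  refine (@csum_totally R (fun l => h + l%:R) t (pstr_term (omega c) YW c k v n tau) (@weight_inj C h) bt tE _) => mu nmu.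
  have [x ->] := T0 mu; rewrite soc_dim_trivial ?mul0r //.
  by apply: (gwt_L0_trivial hYW).
split; last exact: summability_sum.
by apply/cvg_ex; exists (csum t).
Qed.

Lemma vac_series tau : 0 < complex.Im tau ->
  [/\ pstr_cvg (omega c) YW c k (vac c) 0 tau,
      pstr_graded (omega c) YW c k (vac c) 0 tau = vac_coef tau * Pq (qpow tau 1)
    & series (fun l => ((k'.+1)`!%:R)^-1 * logq tau ^+ k'.+1 * (p l)%:R *
        qpow tau (h + l%:R - c / 24) : C^o) @ \oo -->
      (pstr_graded (omega c) YW c k (vac c) 0 tau : C^o)].
Proof.
move=> /nc_q q1; have bp := part_abs_le q1 (rwords_le d).
pose t l : C := vac_coef tau * ((p l)%:R * qpow tau 1 ^+ l).
have bt : abs_bounded t by exact: abs_boundedZ.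
have tE l : t l = ((k'.+1)`!%:R)^-1 * logq tau ^+ k'.+1 * (p l)%:R * qpow tau (h + l%:R - c / 24).
  by rewrite /t /vac_coef qpow_weight; move: (_%:R)^-1 (p l)%:R => x y; ring.
have [] := @pstr_series (vac c) 0 tau t bt.
- move=> mu; rewrite pstr_term_vac; move: (_%:R)^-1 (sd mu)%:R => x y.
  by exists (x * logq tau ^+ k'.+1 * qpow tau (mu - c / 24)); ring.
- by move=> l; rewrite pstr_term_vac (soc_dimE k0 S1 Spos maxE J_full hY hYW) tE.
move=> H ->; split; [exact: H|exact: csumZ|].
by have := csum_cvg bt; rewrite {1}(funext tE).
Qed.

Lemma omega_series tau : 0 < complex.Im tau ->
  pstr_cvg (omega c) YW c k (omega c) 2 tau /\
  pstr_graded (omega c) YW c k (omega c) 2 tau = qpow tau (h - c / 24) *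
    ((((k'.+1)`!%:R)^-1 * h * logq tau ^+ k'.+1 + (k'`!%:R)^-1 * logq tau ^+ k') * Pq (qpow tau 1)
     + ((k'.+1)`!%:R)^-1 * logq tau ^+ k'.+1 * qpow tau 1 * Pq' (qpow tau 1)).
Proof.
move=> /nc_q q1; have bp := part_abs_le q1 (rwords_le d).
have bp' := abs_bounded_derivative (rwords_le d) q1.
pose B1 : C := qpow tau (h - c / 24) *
  (((k'.+1)`!%:R)^-1 * h * logq tau ^+ k'.+1 + (k'`!%:R)^-1 * logq tau ^+ k').
pose B2 : C := qpow tau (h - c / 24) * (((k'.+1)`!%:R)^-1 * logq tau ^+ k'.+1 * qpow tau 1).
pose t l : C := B1 * ((p l)%:R * qpow tau 1 ^+ l) +
  B2 * ((p l)%:R * (l%:R * qpow tau 1 ^+ l.-1)).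
have bt : abs_bounded t by apply: abs_bounded_lin => //; exact: abs_boundedZ.
have [] := @pstr_series (omega c) 2 tau t bt.
- move=> mu; rewrite pstr_term_omega; move: (_%:R)^-1 (k'`!%:R)^-1 (sd mu)%:R => x y z.
  by exists ((x * mu * logq tau ^+ k'.+1 + y * logq tau ^+ k') * qpow tau (mu - c / 24)); ring.
- move=> l; rewrite pstr_term_omega (soc_dimE k0 S1 Spos maxE J_full hY hYW) qpow_weight.
  have -> : t l = B1 * ((p l)%:R * qpow tau 1 ^+ l) + qpow tau (h - c / 24) *
      (((k'.+1)`!%:R)^-1 * logq tau ^+ k'.+1 * l%:R) * ((p l)%:R * qpow tau 1 ^+ l).
    rewrite /t /B2; case: l => [|l]; first by rewrite !(mul0r, mulr0).
    congr (_ + _); rewrite (exprS (qpow tau 1)) /=.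
    move: (_`!%:R)^-1 (p _)%:R (l.+1)%:R (_ ^+ k'.+1) => x y z u; ring.
  rewrite /B1; move: ((k'.+1)`!%:R)^-1 (k'`!%:R)^-1 (p l)%:R l%:R => x y z u; ring.
move=> H ->; split; first exact: H.
rewrite (csum_lin B1 bp (abs_boundedZ B2 bp')) (csumZ B2 bp').
by rewrite /B1 /B2 [RHS]mulrDr !mulrA.
Qed.

Lemma Zirr_series tau : 0 < complex.Im tau ->
  Zirr c h tau = qpow tau (- (c / 24)) * (qpow tau h * Pq (qpow tau 1)).
Proof.
move=> /nc_q q1; have bp := part_abs_le q1 (rwords_le d); congr (_ * _).
transitivity (csum (fun l => (wdim (Lirr_deg c h l))%:R * qpow tau (l%:R + h))); first by [].
rewrite -csumZ //; congr csum; apply/funext => l.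
rewrite (wdim_basis (Lirr_basis S1 Spos maxE l)) qpowD qpow_nat.
by rewrite mulrA mulrC.
Qed.

(** Differentiating q^h and the power series gives the two parts of the action of the weight h + l,
    while (log q)^(k-1)/(k-1)! gives the contribution of the nilpotent part of L_0. *)
Lemma vac_derivative tau : 0 < complex.Im tau ->
  is_derive (tau : C^o) 1
    (fun u : C^o => (qpow u (c / 24) * pstr_graded (omega c) YW c k (vac c) 0 u) : C^o)
    (twopii R * (qpow tau (c / 24) * pstr_graded (omega c) YW c k (omega c) 2 tau)).
Proof.
move=> tau0; have q1 := nc_q tau0.
have shift u : qpow u (c / 24) * qpow u (h - c / 24) = qpow u h by rewrite -qpowD addrC subrK.
(* The closed form is known on the upper half-plane only, which is open and so contains a
   neighbourhood of tau. *)
have near_eq : \forall u \near (tau : C^o), ((k'.+1)`!%:R)^-1 * logq (u : C) ^+ k'.+1 *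
    (qpow (u : C) h * Pq (qpow (u : C) 1)) =
    qpow (u : C) (c / 24) * pstr_graded (omega c) YW c k (vac c) 0 u :> C^o.
  near=> u; have u0 : 0 < complex.Im (u : C) by near: u; exact: Im_gt0_near.
  have [_ -> _] := vac_series u0; rewrite -shift /vac_coef; move: (_%:R)^-1 => x; ring.
apply: (near_eq_is_derive near_eq).
have Dl : is_derive (tau : C^o) 1 (fun u : C^o => logq u : C^o) (twopii R).
  apply: is_derive_nc => e e0; exists 1 => // w _.
  rewrite (_ : _ - _ = 0) ?nc0 ?mulr_ge0 ?nc_ge0 ?(ltW e0) //; rewrite /logq; ring.
have Dq := is_derive_qpow tau h.
have DP := is_derive_compC (is_derive_qpow tau 1) (is_derive_power (rwords_le d) q1).
apply: is_derive_eq (is_derive_mul_exp ((k'.+1)`!%:R)^-1 k' Dl Dq DP) _.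
have [_ ->] := omega_series tau0.
have fE : ((k'.+1)`!%:R)^-1 * (k'.+1)%:R = (k'`!%:R)^-1 :> C.
  rewrite factS natrM invfM mulrAC mulVf ?mul1r // pnatr_eq0.
rewrite -fE -shift; move: (_`!%:R)^-1 (k'.+1)%:R => x y; rewrite exprS.
rewrite -[(_ \o _) tau]/(Pq (qpow tau 1)).
move: y (Pq _) (Pq' _) => y P P'; rewrite -[y]/(y : C); ring.
Unshelve. all: by end_near.
Qed.

End GradedPseudotrace.

Theorem corollary8p2 (R : realType) (t : R[i]) (r s k : nat) (c h : R[i])
  (ht : t = 1 \/ t = -1) (hr : (0 < r)%N) (hs : (0 < s)%N) (hrs : r <> s)
  (hc : c = cc t) (hh : h = hh r s t)
  (* T(c, h) is generated by the singular vector S_{r,s}(t) 1_{c,h} *)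
  (S : {ffun pbw (r * s) -> R[i]}) (hS : is_Srs t S)
  (hT : maxsub (Verma c h) = gen [set uact (pbw_elt S) (hwv c h)])
  (* 2 <= k <= kappa_{r,s} *)
  (kappa : option nat) (hkappa : is_kappa c h (r * s) kappa)
  (hk2 : (2 <= k)%N) (hk : le_kappa k kappa)
  (* the vertex operator algebra V_Vir(c, 0) *)
  (Y : VirV c -> int -> {linear VirV c -> VirV c})
  (hY : is_voa (vac c) (omega c) Y)
  (* the V_Vir(c, 0)-module W(c, h, k) *)
  (YW : VirV c -> int -> {linear Wmod c h k -> Wmod c h k})
  (hYW : is_voa_module (vac c) (omega c) Y YW) :
  let W := voa_opmod YW in
  let L0 : W -> W := L0op (omega c) YW in
  (* S_l and N_l *)
  let Sl (l : nat) (w : W) : W := (h + l%:R) *: w in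
  let Nl (l : nat) (w : W) : W := L0 w - Sl l w in
  let pstr1 := pstr_graded (omega c) YW c k (vac c) 0 in
  let pstrw := pstr_graded (omega c) YW c k (omega c) 2 in
  [/\ strongly_interlocked L0 k,
      well_defined_pstr L0 k,
      (forall l, jordan_parts (Wdeg c h k l) L0 (Sl l) (Nl l))
    & forall tau : R[i], 0 < complex.Im tau ->
      [/\ pstr_cvg (omega c) YW c k (vac c) 0 tau
          /\ pstr_cvg (omega c) YW c k (omega c) 2 tau,
          series (fun l : nat =>
             (pstr L0 k (h + l%:R) (opexp (logq tau) (Nl l))
              * qpow tau (h + l%:R - c / 24)) : R[i]^o) @ \oo
            --> (pstr1 tau : R[i]^o),
          pstr1 tau =
            qpow tau ((1 - c) / 24 + h) * (1 - qpow tau (r * s)%:R)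
            * (((k.-1)`!%:R)^-1 * logq tau ^+ k.-1) * (eta tau)^-1,
          pstr1 tau =
            ((k.-1)`!%:R)^-1 * logq tau ^+ k.-1 * Zirr c h tau
        & derivable (fun u : R[i]^o => (qpow u (c / 24) * pstr1 u) : R[i]^o)
            tau 1
          /\ pstrw tau =
               qpow tau (- (c / 24)) *
               qddq (fun u => qpow u (c / 24) * pstr1 u) tau ]].
Proof.
case: k hk2 hk YW hYW => [|[|k']] // _ hk YW hYW.
have [S1 Spos] := hS; rewrite -hc -hh in Spos.
have k0 : (0 < k'.+2)%N by [].
have kc : kappa_cond c h (r * s) k'.+2.
  case: kappa hkappa hk => [n [n0 kn _] /= kn'|H _]; last exact: H.
  by apply: kappa_cond_le kn; rewrite kn'.
have [z Jz [zd z0]] := kappa_vector k0 kc.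
have J_full := top_J_full k0 S1 Spos hT Jz zd z0.
move=> W L0 Sl Nl pstr1 pstrw; split.
- exact: (strong_interlocking k0 S1 Spos hT J_full hY hYW).
- exact: (pstr_well_defined k0 S1 Spos hT J_full hY hYW).
- exact: (jordan_parts_deg hYW).
move=> tau tau0.
have [cv1 vE sE] := vac_series S1 Spos hT J_full hY hYW tau0.
have [cvw wE] := omega_series S1 Spos hT J_full hY hYW tau0.
have [D DE] := vac_derivative S1 Spos hT J_full hY hYW tau0.
split.
- by split.
- have -> : (fun l : nat => (pstr L0 k'.+2 (h + l%:R) (opexp (logq tau) (Nl l))
       * qpow tau (h + l%:R - c / 24)) : R[i]^o) =
      (fun l => ((k'.+1)`!%:R)^-1 * logq tau ^+ k'.+1 * (size (rwords (r * s) l))%:R *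
        qpow tau (h + l%:R - c / 24)).
    apply/funext => l; congr (_ * _).
    rewrite (_ : pstr _ _ _ _ = logq tau ^+ k'.+1 / (k'.+1)`!%:R *
      (soc_dim (W := W) L0 (h + l%:R))%:R).
      by rewrite (soc_dimE k0 S1 Spos hT J_full hY hYW) [_ / _]mulrC.
    exact: (pstr_opexp k0 S1 Spos hT J_full hY hYW).
  exact: sE.
- rewrite /pstr1 vE eta_part // (rwords_series _ (nc_q tau0)) (qpow_nat tau (r * s)).
  rewrite invfM invrK -qpowN.
  (* The exponent -1/24 split off here is the one in 1/eta. *)
  have -> : qpow tau (h - c / 24) = qpow tau ((1 - c) / 24 + h) * qpow tau (- 24^-1).
    by rewrite -qpowD; congr qpow; field.
  by move: (_`!%:R)^-1 (csum _) => x y; ring.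
- rewrite /pstr1 vE (Zirr_series S1 Spos hT tau0) [h - _]addrC qpowD.
  by rewrite -!mulrA.
split; first exact: D.
rewrite /pstrw /qddq derive1E DE mulKf ?twopii_neq0 //.
by rewrite [RHS]mulrA -qpowD addNr qpow0 mul1r.
Qed.
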